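(* There exists a surjection $R\twoheadrightarrow\mathcal P^\prec$ with kernel $J$ mapping $X_{i_1,\dots,i_k}$ to $(e_{i_1,\dots,i_k}^\prec)^*$ for all $1\le k\le n-1$, $1\le i_1<\dots<i_k\le n$.
   Context: Fix $n\ge2$ and $\mathfrak g=\mathfrak{sl}_n(\mathbb C)$ with simple roots $\alpha_1,\dots,\alpha_{n-1}$ and fundamental weights $\omega_k$. $\mathfrak n_-$ is spanned by negative root vectors $f_{i,j}$, $1\le i<j\le n$, of weight $-(\alpha_i+\dots+\alpha_{j-1})$ (matrix units $f_{i,j}e_i=e_j$). $L_\lambda$ is the irreducible representation with highest weight $\lambda$ and highest weight vector $v_\lambda$. $R=\mathbb C[\{X_{i_1,\dots,i_k}\mid1\le k\le n-1,\ 1\le i_1<\dots<i_k\le n\}]$ is the polynomial ring in Plücker variables. $J\subset R$ is the toric ideal that is the kernel of the homomorphism $R\to\mathbb C[z_{i,j},1\le i\le j\le n]$ taking $X_{i_1,\dots,i_k}$ to $\prod_{l=1}^kz_{l,i_l}$; it cuts out the Gelfand–Tsetlin toric variety in $\prod_k\mathbb P(\wedge^k\mathbb C^n)$. $\mathcal F_n$ is the free associative $\mathbb C$-algebra on symbols $\hat f_{i,j}$, $1\le i<j\le n$; $\mathcal I$ is the kernel of $\mathcal F_n\to\mathcal U(\mathfrak n_-)$, $\hat f_{i,j}\mapsto f_{i,j}$; $\mathcal I_\lambda\subset\mathcal F_n$ is the left ideal of elements whose image in $\mathcal U(\mathfrak n_-)$ annihilates $v_\lambda$. Monomial order $\prec$: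 for a monomial $x=\hat f_{i_1,j_1}\cdots\hat f_{i_m,j_m}$ put $|x|=\sum_k(j_k-i_k)$. For two monomials $x=\hat f_{i_1,j_1}\cdots\hat f_{i_m,j_m}$ and $y=\hat f_{p_1,q_1}\cdots\hat f_{p_r,q_r}$ set $x\prec y$ if $|x|<|y|$; if $|x|=|y|$ and $x\ne y$, take the least $k$ with $(i_k,j_k)\ne(p_k,q_k)$ and set $x\prec y$ if $i_k<p_k$, or $i_k=p_k$ and $j_k<q_k$. $\mathrm{in}_\prec f$ is the $\prec$-maximal monomial occurring in $f$; $\mathrm{in}_\prec\mathcal I$ (two-sided ideal) and $\mathrm{in}_\prec\mathcal I_\lambda$ (left ideal containing it) are the spans of initial parts. $\mathcal U^\prec=\mathcal F_n/\mathrm{in}_\prec\mathcal I$, and $L_\lambda^\prec=\mathcal F_n/\mathrm{in}_\prec\mathcal I_\lambda$ is a left $\mathcal U^\prec$-module generated by the image $v_\lambda^\prec$ of $1$. $\chi_{i,j}\in\mathcal U^\prec$ is the image of $\hat f_{i,j}$. For $T\in\mathbb Z_{\ge0}^{\{1\le i<j\le n\}}$ let $\chi^T=\prod\chi_{i,j}^{T_{i,j}}$, factors ordered first by $i$ and then by $j$ increasing from left to right; the $\chi^T$ form a basis of $\mathcal U^\prec$ and all other monomials in the $\chi_{i,j}$ are zero. $\mathcal U^\prec$ and all $L_\lambda^\prec$ are graded by $\mathbb Z_{\ge0}^{\{1\le i<j\le n\}}$ via $\mathrm{grad}(\chi^T)=T$. On $L_\lambda^\prec\otimes L_\mu^\prec$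 with the induced grading, $\mathcal U^\prec$ acts as follows: for homogeneous $v_1\otimes v_2$, $\chi_{i,j}(v_1\otimes v_2)=0$ if $\mathrm{grad}(v_1\otimes v_2)_{l,m}\ne0$ for some $(l,m)$ with $l<i$, or $l=i$ and $m<j$; otherwise $\chi_{i,j}(v_1\otimes v_2)=\chi_{i,j}(v_1)\otimes v_2+v_1\otimes\chi_{i,j}(v_2)$. The submodule generated by $v_\lambda^\prec\otimes v_\mu^\prec$ is isomorphic to $L_{\lambda+\mu}^\prec$ (via $v_{\lambda+\mu}^\prec\mapsto v_\lambda^\prec\otimes v_\mu^\prec$), and the dual surjections $(L_\lambda^\prec)^*\otimes(L_\mu^\prec)^*\twoheadrightarrow(L_{\lambda+\mu}^\prec)^*$ give a commutative algebra structure on $\mathcal P^\prec=\bigoplus_\lambda(L_\lambda^\prec)^*$ (sum over all integral dominant weights). $T(i_1,\dots,i_k)\in\mathbb R^{\{1\le i<j\le n\}}$ has coordinate $1$ at each pair $(l,i_l)$ with $1\le l\le k$, $i_l>l$, and all other coordinates $0$. $e^\prec_{i_1,\dots,i_k}=\chi^{T(i_1,\dots,i_k)}v_{\omega_k}^\prec\in L_{\omega_k}^\prec$; these form a basis of $L_{\omega_k}^\prec$, and $(e^\prec_{i_1,\dots,i_k})^*$ is the dual basis of $(L_{\omega_k}^\prec)^*$. *)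

(* Defs.v *)
From HB Require Import structures.
From mathcomp Require Import all_boot all_order all_algebra finmap.
From mathcomp Require Import generic_quotient ring_quotient.
From mathcomp Require Import boolp classical_sets functions cardinality fsbigop.
From mathcomp Require Import reals prodnormedzmodule complex.
From mathcomp Require Import monalg.

Set Implicit Arguments.
Unset Strict Implicit.
Unset Printing Implicit Defensive.

Import GRing.Theory.
Local Open Scope classical_set_scope.
Local Open Scope ring_scope.
Local Open Scope quotient_scope.

Section Span.
Context {F : fieldType} {V : lmodType F}.

Definition is_submod (W : set V) : Prop :=
  W 0 /\ forall (a : F) (x y : V), W x -> W y -> W (a *: x + y).

Definition span (S : set V) : set V :=
  [set x | forall W : set V, is_submod W -> S `<=` W -> W x].

Lemma span_submod (S : set V) : is_submod (span S).
Proof.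
split=> [W [W0 _] _ //|a x y Sx Sy W sW SW].
by case: (sW) => _; apply; [apply: Sx | apply: Sy].
Qed.

Lemma sub_span (S : set V) : S `<=` span S.
Proof. by move=> x Sx W _; apply. Qed.

Definition span_pred (S : set V) : {pred V} := [pred x | `[< span S x >]].

Lemma span_predP (S : set V) (x : V) : reflect (span S x) (x \in span_pred S).
Proof. by rewrite inE; apply: asboolP. Qed.

Lemma span_predZD (S : set V) (a : F) (x y : V) :
  x \in span_pred S -> y \in span_pred S -> a *: x + y \in span_pred S.
Proof.
move=> /span_predP xS /span_predP yS; apply/span_predP.
exact: (span_submod S).2.
Qed.

Lemma span_zmod_closed (S : set V) : zmod_closed (span_pred S).
Proof.
split=> [|x y xS yS]; first by apply/span_predP; exact: (span_submod S).1.
by rewrite -scaleN1r addrC span_predZD.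
Qed.

HB.instance Definition _ (S : set V) :=
  GRing.isZmodClosed.Build V (span_pred S) (span_zmod_closed S).

End Span.

(** The quotient of [V] by the span of [S], not by [S]. *)
Section QuotientModule.
Context {F : fieldType} {V : lmodType F} (S : set V).

Definition quotmod : Type := Quotient.quot (span_pred S).
HB.instance Definition _ := GRing.Zmodule.on quotmod.
HB.instance Definition _ := EqQuotient.on quotmod.

Lemma quotmodP (x y : V) :
  reflect (\pi_quotmod x = \pi_quotmod y) (x - y \in span_pred S).
Proof. by rewrite Quotient.idealrBE; apply: eqP. Qed.

Lemma quotmod_repr (x : V) : repr (\pi_quotmod x) - x \in span_pred S.
Proof. by apply/quotmodP; rewrite reprK. Qed.

Definition quotmod_scale (a : F) (u : quotmod) : quotmod :=
  \pi_quotmod (a *: repr u).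

Lemma quotmod_scaleE (a : F) (x : V) :
  quotmod_scale a (\pi_quotmod x) = \pi_quotmod (a *: x).
Proof.
apply/quotmodP; rewrite -scalerBr -[_ *: _]addr0.
by apply: span_predZD; [exact: quotmod_repr | exact: rpred0].
Qed.

Fact quotmod_scalerA a b u :
  quotmod_scale a (quotmod_scale b u) = quotmod_scale (a * b) u.
Proof. by rewrite -[u]reprK (quotmod_scaleE b) !quotmod_scaleE scalerA. Qed.
Fact quotmod_scale1r : left_id 1 quotmod_scale.
Proof. by move=> u; rewrite -[u]reprK !quotmod_scaleE scale1r. Qed.
Fact quotmod_scalerDr : right_distributive quotmod_scale +%R.
Proof.
move=> a u v; rewrite -[u]reprK -[v]reprK -raddfD !quotmod_scaleE -raddfD.
by rewrite scalerDr.
Qed.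
Fact quotmod_scalerDl u : {morph quotmod_scale^~ u : a b / a + b}.
Proof. by move=> a b; rewrite -[u]reprK !quotmod_scaleE -raddfD scalerDl. Qed.

HB.instance Definition _ := GRing.Zmodule_isLmodule.Build F quotmod
  quotmod_scalerA quotmod_scale1r quotmod_scalerDr quotmod_scalerDl.

Definition qproj (x : V) : quotmod := \pi_quotmod x.

Lemma qproj_is_linear : linear qproj.
Proof.
by move=> a x y; rewrite /qproj raddfD; congr (_ + _); rewrite -[LHS]quotmod_scaleE.
Qed.
HB.instance Definition _ :=
  GRing.isLinear.Build F V quotmod *:%R qproj qproj_is_linear.

Definition qlift {W : lmodType F} (f : V -> W) (u : quotmod) : W := f (repr u).

Lemma qliftE (W : lmodType F) (f : {linear V -> W}) (x : V) :
  (forall y, S y -> f y = 0) -> qlift f (qproj x) = f x.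
Proof.
move=> fS; apply/eqP; rewrite -subr_eq0 -raddfB; apply/eqP.
have /span_predP/(_ [set y | f y = 0]) := quotmod_repr x; apply=> //.
split=> [|a y z /= fy fz]; first exact: raddf0.
by rewrite linearP fy fz scaler0 addr0.
Qed.

Lemma qlift_is_linear (W : lmodType F) (f : {linear V -> W}) :
  (forall y, S y -> f y = 0) -> linear (qlift f).
Proof.
move=> fS a u v; rewrite -[u]reprK -[v]reprK -/(qproj _) -/(qproj (repr v)).
by rewrite -linearP !qliftE// linearP.
Qed.

End QuotientModule.

Section Hom.
Context {F : fieldType} {V W : lmodType F}.
Implicit Types f g h : {linear V -> W}.

Definition hom0 : {linear V -> W} := \0.
Definition homN f : {linear V -> W} := \- f.
Definition homD f g : {linear V -> W} := f \+ g.
Definition homZ (a : F) f : {linear V -> W} := a \*: f.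

Lemma homP f g : f =1 g -> f = g.
Proof.
case: f g => [f cf] [g cg] /= /funext fg; subst g; congr (GRing.Linear.Pack _).
case: cf cg => [[f1] [f2]] [[g1] [g2]].
by rewrite (Prop_irrelevance f1 g1) (Prop_irrelevance f2 g2).
Qed.


Fact homDA : associative homD.
Proof. by move=> f g h; apply: homP => x /=; rewrite addrA. Qed.
Fact homDC : commutative homD.
Proof. by move=> f g; apply: homP => x /=; rewrite addrC. Qed.
Fact hom0D : left_id hom0 homD.
Proof. by move=> f; apply: homP => x /=; rewrite add0r. Qed.
Fact homND : left_inverse hom0 homN homD.
Proof. by move=> f; apply: homP => x /=; rewrite addNr. Qed.
HB.instance Definition _ :=
  GRing.isZmodule.Build {linear V -> W} homDA homDC hom0D homND.

Fact homZA a b f : homZ a (homZ b f) = homZ (a * b) f.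
Proof. by apply: homP => x /=; rewrite scalerA. Qed.
Fact hom1Z : left_id 1 homZ.
Proof. by move=> f; apply: homP => x /=; rewrite scale1r. Qed.
Fact homZDr : right_distributive homZ +%R.
Proof. by move=> a f g; apply: homP => x /=; rewrite scalerDr. Qed.
Fact homZDl f : {morph homZ^~ f : a b / a + b}.
Proof. by move=> a b; apply: homP => x /=; rewrite scalerDl. Qed.
HB.instance Definition _ := GRing.Zmodule_isLmodule.Build F {linear V -> W}
  homZA hom1Z homZDr homZDl.

End Hom.

Notation dual F V := {linear V -> F^o}.

Section DirectSum.
Context {F : fieldType} {I : choiceType} (V : I -> lmodType F).

Definition finsuppd (u : forall i, V i) : Prop := finite_set [set i | u i <> 0].

Record dirsum := DirSum {
  dscomp :> forall i, V i;
  dscomp_subproof : `[< finsuppd dscomp >]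
}.

HB.instance Definition _ := [isSub for dscomp].
HB.instance Definition _ := [Choice of dirsum by <:].

Lemma dirsumP (u v : dirsum) : (forall i, u i = v i) -> u = v.
Proof. by move=> uv; apply/val_inj/functional_extensionality_dep. Qed.

Fact ds0_subproof : `[< finsuppd (fun=> 0) >].
Proof.
apply/asboolP; rewrite /finsuppd (_ : [set _ | _] = set0)//.
by apply/seteqP; split.
Qed.
Definition ds0 := DirSum ds0_subproof.

Fact dsN_subproof (u : dirsum) : `[< finsuppd (fun i => - u i) >].
Proof.
apply/asboolP; apply: (@sub_finite_set _ _ [set i | u i <> 0]).
  by move=> i /= + ui0; rewrite ui0 oppr0.
by have /asboolP := dscomp_subproof u.
Qed.
Definition dsN u := DirSum (dsN_subproof u).

Fact dsD_subproof (u v : dirsum) : `[< finsuppd (fun i => u i + v i) >].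
Proof.
apply/asboolP.
apply: (@sub_finite_set _ _ ([set i | u i <> 0] `|` [set i | v i <> 0])).
  move=> i /= uvi0; have [ui0|/eqP ui0] := eqVneq (u i) 0; last by left.
  by right => vi0; rewrite ui0 vi0 addr0 in uvi0.
have /asboolP fu := dscomp_subproof u; have /asboolP fv := dscomp_subproof v.
by rewrite finite_setU.
Qed.
Definition dsD u v := DirSum (dsD_subproof u v).

Fact dsZ_subproof (a : F) (u : dirsum) : `[< finsuppd (fun i => a *: u i) >].
Proof.
apply/asboolP; apply: (@sub_finite_set _ _ [set i | u i <> 0]).
  by move=> i /= + ui0; rewrite ui0 scaler0.
by have /asboolP := dscomp_subproof u.
Qed.
Definition dsZ a u := DirSum (dsZ_subproof a u).

Fact dsDA : associative dsD.
Proof. by move=> u v w; apply: dirsumP => i /=; rewrite addrA. Qed.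
Fact dsDC : commutative dsD.
Proof. by move=> u v; apply: dirsumP => i /=; rewrite addrC. Qed.
Fact ds0D : left_id ds0 dsD.
Proof. by move=> u; apply: dirsumP => i /=; rewrite add0r. Qed.
Fact dsND : left_inverse ds0 dsN dsD.
Proof. by move=> u; apply: dirsumP => i /=; rewrite addNr. Qed.
HB.instance Definition _ := GRing.isZmodule.Build dirsum dsDA dsDC ds0D dsND.

Fact dsZA a b u : dsZ a (dsZ b u) = dsZ (a * b) u.
Proof. by apply: dirsumP => i /=; rewrite scalerA. Qed.
Fact ds1Z : left_id 1 dsZ.
Proof. by move=> u; apply: dirsumP => i /=; rewrite scale1r. Qed.
Fact dsZDr : right_distributive dsZ +%R.
Proof. by move=> a u v; apply: dirsumP => i /=; rewrite scalerDr. Qed.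
Fact dsZDl u : {morph dsZ^~ u : a b / a + b}.
Proof. by move=> a b; apply: dirsumP => i /=; rewrite scalerDl. Qed.
HB.instance Definition _ := GRing.Zmodule_isLmodule.Build F dirsum
  dsZA ds1Z dsZDr dsZDl.

Fact dsin_subproof (i : I) (x : V i) :
  `[< finsuppd (dfwith (fun j => 0 : V j) x) >].
Proof.
apply/asboolP; apply: (@sub_finite_set _ _ [set i]); last exact: finite_set1.
by move=> j /=; case: dfwithP.
Qed.

Definition dsin (i : I) (x : V i) : dirsum := DirSum (dsin_subproof x).

End DirectSum.

Section LinearExtension.
Context {F : fieldType} {K : choiceType} {W : lmodType F} (h : K -> W).

Definition mlin (x : {malg F[K]}) : W := \sum_(k <- msupp x) x@_k *: h k.

Lemma mlinEw (d : {fset K}) (x : {malg F[K]}) :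
  (msupp x `<=` d)%fset -> mlin x = \sum_(k <- d) x@_k *: h k.
Proof.
move=> le; rewrite /mlin (big_fset_incl _ le)// => k _ /mcoeff_outdom ->.
by rewrite scale0r.
Qed.

Lemma mlinU k : mlin << k >> = h k.
Proof. by rewrite (mlinEw msuppU_le) big_seq_fset1 mcoeffUU scale1r. Qed.

Lemma mlin_is_linear : linear mlin.
Proof.
move=> a x y; pose d := (msupp x `|` msupp y)%fset.
have xd : (msupp x `<=` d)%fset by exact: fsubsetUl.
have yd : (msupp y `<=` d)%fset by exact: fsubsetUr.
have xyd : (msupp (a *: x + y) `<=` d)%fset.
  apply: fsubset_trans (msuppD_le _ _) _; apply: fsetUSS => //.
  exact: msuppZ_le.
rewrite (mlinEw xd) (mlinEw yd) (mlinEw xyd) scaler_sumr -big_split /=.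
by apply: eq_bigr => k _; rewrite mcoeffD mcoeffZ scalerDl scalerA.
Qed.
HB.instance Definition _ :=
  GRing.isLinear.Build F {malg F[K]} W *:%R mlin mlin_is_linear.

Lemma malg_basisE (x : {malg F[K]}) : x = \sum_(k <- msupp x) x@_k *: << k >>.
Proof.
rewrite {1}[x]monalgE; apply: eq_bigr => k _; apply/malgP => l.
by rewrite mcoeffZ !mcoeffU mulrnAr mulr1.
Qed.

End LinearExtension.

(** The tensor product: the free module on [V * W] modulo bilinearity. *)
Section Tensor.
Context {F : fieldType} (V W : lmodType F).

Definition bilinear_rels : set {malg F[(V * W)%type]} :=
  [set r | exists (a : F) (v v' : V) (w : W),
     r = << (a *: v + v', w) >> - a *: << (v, w) >> - << (v', w) >>] `|`
  [set r | exists (a : F) (v : V) (w w' : W),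
     r = << (v, a *: w + w') >> - a *: << (v, w) >> - << (v, w') >>].

Definition tensor : lmodType F := quotmod bilinear_rels.

Definition tens (v : V) (w : W) : tensor := qproj bilinear_rels << (v, w) >>.

Definition tpair (f : dual F V) (g : dual F W) : {malg F[(V * W)%type]} -> F^o :=
  mlin (fun vw => f vw.1 * g vw.2).
HB.instance Definition _ f g := GRing.Linear.on (tpair f g).

Lemma tpairU f g v w : tpair f g << (v, w) >> = f v * g w.
Proof. exact: mlinU. Qed.

Lemma tpair_rels f g r : bilinear_rels r -> tpair f g r = 0.
Proof.
case=> [[a [v [v' [w ->]]]]|[a [v [w [w' ->]]]]];
  rewrite !linearB linearZ /= !tpairU linearP /= -addrA -opprD;
  apply/eqP; rewrite subr_eq0; apply/eqP.
  by rewrite mulrDl /GRing.scale /= mulrA.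
by rewrite mulrDr /GRing.scale /= !mulrA [f v * a]mulrC.
Qed.

Definition dtens_fun (f : dual F V) (g : dual F W) : tensor -> F^o :=
  qlift (tpair f g).

Lemma dtens_is_linear f g : linear (dtens_fun f g).
Proof. exact: qlift_is_linear (@tpair_rels f g). Qed.
HB.instance Definition _ f g :=
  GRing.isLinear.Build F tensor F^o *:%R (dtens_fun f g) (dtens_is_linear f g).

Lemma dtensE f g v w : dtens_fun f g (tens v w) = f v * g w.
Proof. by rewrite /dtens_fun /tens qliftE; [exact: tpairU|exact: tpair_rels]. Qed.

Definition dtens (f : dual F V) (g : dual F W) : dual F tensor := dtens_fun f g.

End Tensor.

(** Rows and columns are numbered from 0: the pair (i, j) of ordinals stands for
    the indices (i + 1, j + 1) of the usual notation. *)
Definition posroot (n : nat) : Type := {p : 'I_n * 'I_n | (p.1 < p.2)%N}.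
HB.instance Definition _ n := SubFinite.on (posroot n).

(** Dominant integral weights, by their coordinates in the fundamental weights:
    [la k] is the coefficient of the fundamental weight number k + 1. *)
Definition wt (n : nat) : Type := {ffun 'I_n.-1 -> nat}.
HB.instance Definition _ n := Choice.on (wt n).
HB.instance Definition _ n := GRing.Nmodule.on (wt n).

(** The k-th fundamental weight, 1 <= k < n. *)
Definition fundwt (n k : nat) : wt n := [ffun j : 'I_n.-1 => (j.+1 == k) : nat].

Section Representations.
Context {F : fieldType} {n : nat}.

(** A finite-dimensional irreducible representation of sl_n with highest weight
    [la], with a chosen highest weight vector. The action is a function on all
    matrices, but only its values on sl_n, the traceless ones, are relevant. *)
Record hw_irrep (la : wt n) := HwIrrep {
  irr_space : vectType F;
  irr_act : 'M[F]_n -> 'End(irr_space);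
  hw_vec : irr_space;
  irr_act_linear : forall (a : F) (A B : 'M[F]_n), \tr A = 0 -> \tr B = 0 ->
    irr_act (a *: A + B) = a *: irr_act A + irr_act B;
  irr_act_bracket : forall (A B : 'M[F]_n), \tr A = 0 -> \tr B = 0 ->
    forall u : irr_space, irr_act (A *m B - B *m A) u =
      irr_act A (irr_act B u) - irr_act B (irr_act A u);
  irr_irreducible : forall U : {vspace irr_space},
    (forall A : 'M[F]_n, \tr A = 0 -> (irr_act A @: U <= U)%VS) ->
    U = 0%VS \/ U = fullv;
  hw_vec_neq0 : hw_vec != 0;
  hw_vec_raise : forall i j : 'I_n, (i < j)%N ->
    irr_act (delta_mx i j) hw_vec = 0;
  hw_vec_weight : forall (k : 'I_n.-1) (i j : 'I_n),
    i = k :> nat -> j = k.+1 :> nat ->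
    irr_act (delta_mx i i - delta_mx j j) hw_vec = (la k)%:R *: hw_vec
}.

(** The root vector f_{i,j} : e_i |-> e_j, a matrix acting on column vectors. *)
Definition fmx (p : posroot n) : 'M[F]_n := delta_mx (val p).2 (val p).1.

End Representations.
Arguments hw_irrep F {n} la.

Section MonomialOrder.
Context {n : nat}.
Implicit Types (p q : posroot n) (x y : seq (posroot n)).

Definition root_lt p q : bool :=
  ((val p).1 < (val q).1)%N ||
  ((val p).1 == (val q).1) && ((val p).2 < (val q).2)%N.

Definition root_le p q : bool := (p == q) || root_lt p q.

Definition word_wt x : nat := (\sum_(p <- x) ((val p).2 - (val p).1))%N.

(** Only meant for words of the same [word_wt]: then none of them is a proper
    prefix of the other. *)
Fixpoint word_lex x y : bool :=
  match x, y with
  | p :: x', q :: y' => root_lt p q || (p == q) && word_lex x' y'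
  | _, _ => false
  end.

Definition word_lt x y : bool :=
  (word_wt x < word_wt y)%N || (word_wt x == word_wt y) && word_lex x y.

Lemma word_lt_cat2l u x y : word_lt (u ++ x) (u ++ y) = word_lt x y.
Proof.
rewrite /word_lt /word_wt !big_cat /= ltn_add2l eqn_add2l.
congr (_ || (_ && _)); elim: u => //= p u ->; rewrite eqxx /root_lt.
by rewrite !ltnn andbF.
Qed.

End MonomialOrder.

Section FreeAlgebra.
Context {F : fieldType} {n : nat}.

(** The free associative algebra on the symbols \hat f_{i,j}. *)
Definition freealg : lalgType F := {malg F[{fmonom posroot n}]}.

Definition fhat (p : posroot n) : freealg := << fmu p >>.

Definition is_initial (x : freealg) (w : {fmonom posroot n}) : Prop :=
  x@_w != 0 /\ forall w', x@_w' != 0 -> w' != w -> word_lt w' w.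

(** \hat f^T, which maps to \chi^T. *)
Definition fhatX (T : {ffun posroot n -> nat}) : freealg :=
  \prod_(p <- sort root_le (enum {: posroot n})) fhat p ^+ T p.

Lemma freealg_scaleAr (a : F) (x y : freealg) : x * (a *: y) = a *: (x * y).
Proof.
rewrite -mul_malgC mulrA scalerAl; congr (_ * _).
rewrite malgM_def fgmulgU [RHS]malgZ_def /fgscale.
by apply: eq_bigr => k _; rewrite mulm1 mulrC.
Qed.

Lemma mcoeff_wordM (u w : {fmonom posroot n}) (x : freealg) :
  (<< u >> * x)@_(mmul u w) = x@_w.
Proof.
have eq_umul k : (mmul u k == mmul u w) = (k == w).
  rewrite !fmP /= !fmM; apply/eqP/eqP => [/eqP|->//].
  by rewrite eqseq_cat// eqxx => /eqP.
rewrite malgM_def fgmulUg raddf_sum /=.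
under eq_bigr do rewrite mcoeffU eq_umul mul1r mulrb.
rewrite -big_mkcond /=; have [wx|wx] := boolP (w \in msupp x).
  rewrite -big_filter (filter_pred1_uniq (fset_uniq _) wx).
  by rewrite big_cons big_nil addr0.
rewrite (mcoeff_outdom wx) big_seq_cond big1// => k /andP[kx /eqP kw].
by rewrite -kw kx in wx.
Qed.

Lemma word_mulU (u w : {fmonom posroot n}) :
  << u >> * << w >> = << mmul u w >> :> freealg.
Proof. by rewrite malgM_def fgmulUU mulr1. Qed.

Section Irrep.
Context {la : wt n} (M : hw_irrep F la).

Definition word_act (w : {fmonom posroot n}) (v : irr_space M) : irr_space M :=
  foldr (fun p u => irr_act M (fmx p) u) v w.

(** The composite of the map from the free algebra to U(n_-), fhat p |-> fmx p,
    with the action of U(n_-) on the representation. *)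
Definition free_act (x : freealg) (v : irr_space M) : irr_space M :=
  mlin (word_act^~ v) x.

Definition annI : set freealg := [set x | free_act x (hw_vec M) = 0].

(** Only the initial monomials of [annI]: [quotmod] takes their span. *)
Definition initial_annI : set freealg :=
  [set << w >> | w in [set w | exists x, annI x /\ is_initial x w]].

Definition Lprec : lmodType F := quotmod initial_annI.
Definition vprec : Lprec := qproj initial_annI 1.

Lemma word_act_is_linear (w : {fmonom posroot n}) : linear (word_act w).
Proof.
move=> a u v; rewrite /word_act.
by elim: (w : seq _) => //= p s ->; rewrite linearP.
Qed.
HB.instance Definition _ (w : {fmonom posroot n}) :=
  GRing.isLinear.Build F (irr_space M) (irr_space M) *:%R (word_act w)
    (word_act_is_linear w).

Lemma free_actU (u : {fmonom posroot n}) (x : freealg) (v : irr_space M) :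
  free_act (<< u >> * x) v = word_act u (free_act x v).
Proof.
rewrite {1}[x]malg_basisE mulr_sumr /free_act raddf_sum [in RHS]/mlin raddf_sum /=.
apply: eq_bigr => w _; rewrite freealg_scaleAr word_mulU !linearZ /=.
by rewrite mlinU /word_act fmM foldr_cat.
Qed.

Lemma is_initial_wordM (u w : {fmonom posroot n}) (x : freealg) :
  is_initial x w -> is_initial (<< u >> * x) (mmul u w).
Proof.
case=> xw xmax; split; first by rewrite mcoeff_wordM.
move=> w'; rewrite mcoeff_neq0 => /msuppM_le[k1 [k2 [+ k2x ->]]].
rewrite msuppU1 inE => /eqP->; rewrite fmP !fmM => k2w.
rewrite word_lt_cat2l; apply: xmax; first by rewrite mcoeff_neq0.
by apply: contraNneq k2w => ->.
Qed.

Lemma initial_annI_mull (x y : freealg) :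
  y \in span_pred initial_annI -> x * y \in span_pred initial_annI.
Proof.
move=> yI; rewrite [x]malg_basisE mulr_suml rpred_sum// => u _.
rewrite -scalerAl -[_ *: _]addr0 span_predZD ?rpred0//.
have /span_predP/(_ [set y | << u >> * y \in span_pred initial_annI]) := yI.
apply=> [|_ [w [z [zI zw]] <-] /=].
  split=> [|a z t /= zI tI]; first by rewrite /= mulr0 rpred0.
  by rewrite mulrDr freealg_scaleAr span_predZD.
suff: initial_annI (<< u >> * << w >>) by move=> /sub_span uw; apply/span_predP.
rewrite word_mulU; apply: imageP.
exists (<< u >> * z); split; last exact: is_initial_wordM.
by rewrite /annI /= free_actU zI raddf0.
Qed.

(** [Lprec M] is a module over the degenerate enveloping algebra U^\prec, which is
    a quotient of the free algebra. Its structure is given by the action of the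
    free algebra: the generator \chi_{i,j} of U^\prec acts as [fhat]. *)
Definition lact (x : freealg) (u : Lprec) : Lprec :=
  qlift (fun y => qproj initial_annI (x * y)) u.

Lemma lactE (x y : freealg) :
  lact x (qproj initial_annI y) = qproj initial_annI (x * y).
Proof.
apply/quotmodP; rewrite -mulrBr; apply: initial_annI_mull; exact: quotmod_repr.
Qed.

Lemma lact_is_linear (x : freealg) : linear (lact x).
Proof.
move=> a u v; rewrite -[u]reprK -[v]reprK -!/(qproj _ _).
by rewrite -linearP !lactE mulrDr freealg_scaleAr linearP.
Qed.
HB.instance Definition _ (x : freealg) :=
  GRing.isLinear.Build F Lprec Lprec *:%R (lact x) (lact_is_linear x).

(** [chi p] is the action of \chi_{i,j} and [chiv T] is \chi^T v. *)
Definition chi (p : posroot n) : Lprec -> Lprec := lact (fhat p).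
HB.instance Definition _ (p : posroot n) := GRing.Linear.on (chi p).

Definition chiv (T : {ffun posroot n -> nat}) : Lprec := lact (fhatX T) vprec.

(** The graded component of degree [T]. *)
Definition homog (T : {ffun posroot n -> nat}) : set Lprec :=
  [set u | exists c : F, u = c *: chiv T].

End Irrep.
End FreeAlgebra.
Arguments freealg F n : clear implicits.

Section Cartan.
Context {F : fieldType} {n : nat}.

Section TwoIrreps.
Context {la mu : wt n} (M1 : hw_irrep F la) (M2 : hw_irrep F mu).

Local Notation T2 := (tensor (Lprec M1) (Lprec M2)).

Definition is_tensor_chi (p : posroot n) (X : {linear T2 -> T2}) : Prop :=
  forall (S T : {ffun posroot n -> nat}) (u : Lprec M1) (v : Lprec M2),
    homog S u -> homog T v ->
    X (tens u v) =
      if [exists q, root_lt q p && (S q + T q != 0)%N] then 0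
      else tens (chi p u) v + tens u (chi p v).

(** The action of \chi_{i,j} on the tensor product: the unique linear map with
    the above values on homogeneous tensors, which span. *)
Definition tensor_chi (p : posroot n) : {linear T2 -> T2} :=
  xget hom0 [set X | is_tensor_chi p X].

(** A map of U^\prec-modules that sends the generator to the tensor product of the
    generators; there is only one, and it identifies [Lprec M] with the submodule
    generated by that tensor. *)
Definition is_cartan (M : hw_irrep F (la + mu)) (D : {linear Lprec M -> T2}) :
    Prop :=
  D (vprec M) = tens (vprec M1) (vprec M2) /\
  forall p u, D (chi p u) = tensor_chi p (D u).

Definition cartan (M : hw_irrep F (la + mu)) : {linear Lprec M -> T2} :=
  xget hom0 [set D | is_cartan D].

(** The image of [dtens f g] under the dual of [cartan M]. *)
Definition cartan_mul (M : hw_irrep F (la + mu))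
    (f : dual F (Lprec M1)) (g : dual F (Lprec M2)) : dual F (Lprec M) :=
  dtens f g \o cartan M.

End TwoIrreps.

Section Palgebra.
Context (L : forall la : wt n, hw_irrep F la).

Definition Pprec : lmodType F := dirsum (fun la => dual F (Lprec (L la))).

Definition Pin (la : wt n) (f : dual F (Lprec (L la))) : Pprec :=
  @dsin F (wt n) (fun la => dual F (Lprec (L la))) la f.

Definition Pmul (a b : Pprec) : Pprec :=
  \sum_(x \in [set: wt n * wt n])
    Pin (cartan_mul (L (x.1 + x.2)) (a x.1) (b x.2)).

(** The unit of [Pmul]: the functional on the line [Lprec (L 0)] with value 1 at
    the generator. *)
Definition Pone : Pprec :=
  Pin (xget hom0 [set f : dual F (Lprec (L 0)) | f (vprec (L 0)) = 1]).

End Palgebra.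
End Cartan.

(** Increasing sequences i_1 < ... < i_k with 1 <= k <= n - 1. *)
Definition pluck (n : nat) : Type :=
  {s : seq 'I_n | sorted (fun i j : 'I_n => (i < j)%N) s && (0 < size s < n)%N}.
HB.instance Definition _ n := SubChoice.on (pluck n).

(** [in_col s (l, i)] says that i = i_l, for s = (i_1, ..., i_k). *)
Definition in_col (n : nat) (s : pluck n) (p : 'I_n * 'I_n) : bool :=
  onth (val s) p.1 == Some p.2.

Definition zidx (n : nat) : Type := {p : 'I_n * 'I_n | (p.1 <= p.2)%N}.
HB.instance Definition _ n := SubFinite.on (zidx n).

Section Plucker.
Context {F : fieldType} {n : nat}.

Definition plring : comAlgType F := {malg F[{cmonom pluck n}]}.
Definition plX (s : pluck n) : plring := << ucm s >>.

Definition zring : comAlgType F := {malg F[{cmonom zidx n}]}.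
Definition zX (q : zidx n) : zring := << ucm q >>.

(** The product of the z_{l,i_l}, 1 <= l <= k. *)
Definition zcol (s : pluck n) : zring := \prod_(q | in_col s (val q)) zX q.

Definition zmonom (m : {cmonom pluck n}) : zring :=
  \prod_(s <- finsupp m) zcol s ^+ m s.

Lemma zmonomEw (d : {fset pluck n}) (m : {cmonom pluck n}) :
  (finsupp m `<=` d)%fset -> zmonom m = \prod_(s <- d) zcol s ^+ m s.
Proof.
move=> le; rewrite /zmonom (big_fset_incl _ le)// => s _.
by rewrite -cmE_eq0 => /eqP->.
Qed.

Lemma zmonom_mmorphism : mmorphism zmonom.
Proof.
split=> [m1 m2|]; last by rewrite /zmonom mdom1 big_seq_fset0.
rewrite (zmonomEw (fsubset_refl _)) mdomD.
rewrite (zmonomEw (fsubsetUl (finsupp m1) (finsupp m2))).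
rewrite (zmonomEw (fsubsetUr (finsupp m1) (finsupp m2))).
by rewrite -big_split /=; apply: eq_bigr => s _; rewrite cmM exprD.
Qed.
HB.instance Definition _ := isMultiplicative.Build _ _ zmonom zmonom_mmorphism.

(** The homomorphism of algebras with X_{i_1,...,i_k} |-> \prod_l z_{l,i_l}. *)
Definition toric_map : plring -> zring := mmap (@malgC _ F) zmonom.
HB.instance Definition _ := GRing.RMorphism.on toric_map.

Lemma toric_mapX (s : pluck n) : toric_map (plX s) = zcol s.
Proof.
rewrite /toric_map /plX mmapU /= rmorph1 mul1r.
by rewrite /zmonom mdomU big_seq_fset1 cmUU expr1.
Qed.

Lemma toric_mapZ (a : F) (x : plring) : toric_map (a *: x) = a *: toric_map x.
Proof. by rewrite /toric_map mmapZ mul_malgC. Qed.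

Definition toric_ideal : set plring := [set x | toric_map x = 0].

(** The exponent T(i_1, ..., i_k). *)
Definition pluckT (s : pluck n) : {ffun posroot n -> nat} :=
  [ffun p : posroot n => in_col s (val p) : nat].

(** e_{i_1,...,i_k}, meant for the fundamental weight number k. *)
Definition evec {la : wt n} (M : hw_irrep F la) (s : pluck n) : Lprec M :=
  chiv M (pluckT s).

Section DualBasis.
Context (L : forall la : wt n, hw_irrep F la).

Definition plwt (s : pluck n) : wt n := fundwt n (size (val s)).

(** The element of the dual basis that corresponds to e_{i_1,...,i_k}. *)
Definition evec_dual (s : pluck n) : dual F (Lprec (L (plwt s))) :=
  xget hom0 [set f | forall t : pluck n, size (val t) = size (val s) ->
    f (evec (L (plwt s)) t) = (t == s)%:R].

End DualBasis.
End Plucker.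
Arguments plring F n : clear implicits.
Arguments zring F n : clear implicits.

(* Main.v *)
(* Call a word standard for [la] if it is not initial in the annihilator of the
   highest weight vector; the standard words give a basis of L_la^prec. They are
   the sorted words of the exponents T in Pi_la, the set of sums of T(I) over the
   multisets of columns I whose fundamental weights add up to [la].

   Upper bound: a word out of order is not standard because of commutation, and
   a sorted word is not standard if T violates one of the inequalities of the
   Gelfand-Tsetlin polytope: by sl_2 theory a high power of f_{l,l+1} kills a
   vector that E_{l,l+1} kills, and multiplying by the other f_{l+1,m} makes the
   word of T the highest term of a relation. A lattice point of the polytope is a
   sum of columns, peeled off one at a time.

   Lower bound: a tensor product of Fock spaces (exterior algebras) has a
   contravariant positive definite Hermitian form, so that its submodule generated
   by a product of vacua of total weight [la] is a quotient of L_la. There a matrix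
   coefficient is nonzero at the word of T and vanishes at all lower words.

   Hence the functionals eta_T that are T! at the word of T and 0 at the other
   words, for T in Pi_la, form a basis of the dual of L_la^prec, and the formula
   for the tensor action gives eta_S eta_T = eta_{S+T}. So P^prec is the semigroup
   algebra of the pairs (la, T). Such a pair carries the same information as the
   exponents of a product of the prod_l z_{l,i_l}: the exponents of z_{l,l} are
   recovered from the row sums, which are determined by [la]. *)
Require Import Defs.
From HB Require Import structures.
From mathcomp Require Import all_boot all_order all_algebra finmap.
From mathcomp Require Import boolp classical_sets reals prodnormedzmodule complex monalg.
From mathcomp Require Import cardinality fsbigop zify ring.
Set Implicit Arguments.
Unset Strict Implicit.
Unset Printing Implicit Defensive.
Import Order.TTheory GRing.Theory Num.Theory.
Local Open Scope ring_scope.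

(** * Words and their splittings *)

(** The representations are given abstractly, so a relation that holds at the highest weight vector
    has to be carried over to a concrete module where it can be tested. This rests on two facts: the
    action of a matrix unit on a word applied to a singular vector is computed formally in the free
    algebra, by one formula for all modules of the same weight; and with a positive definite form, a
    vector of a cyclic module that is orthogonal to that module vanishes. Passing from sl_n to gl_n,
    with the partition of row lengths as weight, puts the irreducible representation and the Fock
    spaces under the same formula.

    Initial monomials are the largest ones, so a standard word is one that is not a combination of
    smaller words, and a sorted word is the smallest rearrangement of its letters. This is why the
    lower bound looks for matrix coefficients that vanish below a given word.

    The lower bound needs complex conjugation, the rest characteristic 0 only; hence it enters the
    later sections as a hypothesis [stdP]. Since [tensor_chi], [cartan], [Pone] and [evec_dual] are
    chosen elements, each of them calls for a proof of existence and uniqueness. *)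

Section Words.
Context {n : nat}.
Implicit Types (p q : posroot n) (a b s t w : seq (posroot n)).
Implicit Types (A B T : {ffun posroot n -> nat}).

Lemma posroot_lt p : ((val p).1 < (val p).2)%N.
Proof. exact: (valP p). Qed.

Lemma posroot_eqE p q :
  (p == q) = ((val p).1 == (val q).1 :> nat) && ((val p).2 == (val q).2 :> nat).
Proof. by rewrite -val_eqE -pair_eqE. Qed.

Lemma root_lt_irr p : root_lt p p = false.
Proof. by rewrite /root_lt !ltnn andbF. Qed.

Lemma root_lt_trans : transitive (@root_lt n).
Proof. by move=> q p r; rewrite /root_lt -!val_eqE /=; lia. Qed.

Lemma root_ltNle p q : root_lt p q = ~~ root_le q p.
Proof. by rewrite /root_le /root_lt posroot_eqE -!val_eqE /=; lia. Qed.

Lemma root_lt_row p q : root_lt p q -> ((val p).1 <= (val q).1)%N.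
Proof. by move=> /orP[/ltnW //|/andP[/eqP -> _]]. Qed.

Lemma root_le_refl : reflexive (@root_le n).
Proof. by move=> p; rewrite /root_le eqxx. Qed.

Lemma root_le_trans : transitive (@root_le n).
Proof. by move=> q p r; rewrite /root_le /root_lt !posroot_eqE -!val_eqE /=; lia. Qed.

Lemma root_le_anti : antisymmetric (@root_le n).
Proof.
move=> p q; rewrite {2}/root_le root_ltNle => /andP[pq].
by rewrite pq orbF => /eqP.
Qed.

Lemma root_le_total : total (@root_le n).
Proof. by move=> p q; rewrite /root_le /root_lt !posroot_eqE -!val_eqE /=; lia. Qed.

Lemma root_le_eqVlt p q : root_le p q = (p == q) || root_lt p q.
Proof. by []. Qed.

Definition cnt w : {ffun posroot n -> nat} := [ffun p => count_mem p w].

Definition tword T : seq (posroot n) :=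
  flatten [seq nseq (T p) p | p <- sort root_le (enum {: posroot n})].

Lemma addT_E A B p : (A + B) p = (A p + B p)%N.
Proof. by rewrite [LHS]ffunE. Qed.

Lemma cnt_nil : cnt [::] = 0.
Proof. by apply/ffunP => p; rewrite !ffunE. Qed.

Lemma cnt_cons p w : cnt (p :: w) = cnt [:: p] + cnt w.
Proof. by apply/ffunP => q; rewrite addT_E !ffunE /= addn0. Qed.

Lemma cnt_cat a b : cnt (a ++ b) = cnt a + cnt b.
Proof. by apply/ffunP => q; rewrite addT_E !ffunE count_cat. Qed.

Lemma cnt_perm a b : (cnt a = cnt b) <-> perm_eq a b.
Proof.
split=> [/ffunP ab|/permP ab].
  by apply/allP => p _ /=; have := ab p; rewrite !ffunE => ->.
by apply/ffunP => p; rewrite !ffunE.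
Qed.

Lemma cnt_tword T : cnt (tword T) = T.
Proof.
apply/ffunP => p; rewrite ffunE /tword count_flatten -map_comp.
rewrite (eq_map (g := fun q => ((q == p) * T q)%N)); last first.
  by move=> q /=; rewrite count_nseq.
rewrite sumnE big_map (perm_big (enum {: posroot n})) /=; last first.
  by rewrite perm_sort.
rewrite big_enum /= (bigD1 p) //= eqxx mul1n big1 ?addn0 // => q /negPf ->.
by rewrite mul0n.
Qed.

Lemma sorted_tword T : sorted root_le (tword T).
Proof.
rewrite /tword; have := sort_sorted root_le_total (enum {: posroot n}).
elim: (sort _ _) => //= p s IH; rewrite (path_sortedE root_le_trans).
case/andP=> /allP ps /IH; rewrite (sorted_pairwise root_le_trans).
rewrite (sorted_pairwise root_le_trans) pairwise_cat => ->; rewrite andbT.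
apply/andP; split.
  apply/allrelP => x y; rewrite mem_nseq => /andP[_ /eqP ->].
  by case/flatten_mapP => q /ps pq; rewrite mem_nseq => /andP[_ /eqP ->].
elim: (T p) => //= k ->; rewrite andbT; apply/allP => x.
by rewrite mem_nseq => /andP[_ /eqP ->]; exact: root_le_refl.
Qed.

Lemma tword_cnt w : sorted root_le w -> tword (cnt w) = w.
Proof.
move=> sw; apply: (sorted_eq root_le_trans root_le_anti (sorted_tword _) sw).
by apply/cnt_perm; rewrite cnt_tword.
Qed.

Lemma tword0 : tword 0 = [::].
Proof. by rewrite -cnt_nil tword_cnt. Qed.

Lemma sorted_cntP w T : sorted root_le w -> (w == tword T) = (cnt w == T).
Proof.
move=> sw; apply/eqP/eqP => [->|<-]; first exact: cnt_tword.
by rewrite tword_cnt.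
Qed.

(** The terms of the coproduct of a word in primitive letters: all ways to distribute the letters
    over two factors, listed with multiplicity. *)
Fixpoint splits w : seq (seq (posroot n) * seq (posroot n)) :=
  if w is p :: w' then
    [seq (p :: ab.1, ab.2) | ab <- splits w'] ++
    [seq (ab.1, p :: ab.2) | ab <- splits w']
  else [:: ([::], [::])].

Lemma big_splits_cons (V : nmodType) (f : seq (posroot n) * seq (posroot n) -> V)
    p w :
  \sum_(ab <- splits (p :: w)) f ab =
  \sum_(ab <- splits w) (f (p :: ab.1, ab.2) + f (ab.1, p :: ab.2)).
Proof. by rewrite /= big_cat !big_map big_split. Qed.

Lemma splits_consP p w a b :
  (a, b) \in splits (p :: w) ->
  (exists2 a', a = p :: a' & (a', b) \in splits w) \/
  (exists2 b', b = p :: b' & (a, b') \in splits w).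
Proof.
by rewrite mem_cat => /orP[] /mapP[[x y] xy [-> ->]]; [left; exists x|right; exists y].
Qed.

Lemma splits_perm w a b : (a, b) \in splits w -> perm_eq w (a ++ b).
Proof.
elim: w a b => [|p w IH] a b; first by rewrite inE => /eqP[-> ->].
case/splits_consP => [[a' ->]|[b' ->]] /IH; first by rewrite cat_cons perm_cons.
move=> pw; rewrite perm_sym (perm_catCA a [:: p] b' _) /=.
by rewrite perm_cons perm_sym.
Qed.

Lemma splits_cnt w a b : (a, b) \in splits w -> cnt w = cnt a + cnt b.
Proof. by move=> /splits_perm/cnt_perm ->; rewrite cnt_cat. Qed.

Lemma splits_subseq w a b :
  (a, b) \in splits w -> subseq a w /\ subseq b w.
Proof.
elim: w a b => [|p w IH] a b; first by rewrite inE => /eqP[-> ->].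
case/splits_consP => [[a' ->]|[b' ->]] /IH [aw bw]; split; rewrite /= ?eqxx //;
  exact: (subseq_trans _ (subseq_cons w p)).
Qed.

Lemma splits_sorted w a b :
  sorted root_le w -> (a, b) \in splits w -> sorted root_le a /\ sorted root_le b.
Proof.
move=> sw /splits_subseq[aw bw].
by split; apply: subseq_sorted sw => //; exact: root_le_trans.
Qed.

Definition word_le s w := (s == w) || word_lex s w.

Lemma word_lex_irr w : word_lex w w = false.
Proof. by elim: w => //= p w ->; rewrite root_lt_irr andbF. Qed.

Lemma word_lex_asym s w : word_lex s w -> ~~ word_lex w s.
Proof.
elim: s w => [|p s IH] [|q w] //= /orP[pq|/andP[/eqP -> /IH sw]].
  rewrite negb_or root_ltNle negbK /root_le pq orbT /=.
  by apply/negP => /andP[/eqP qp]; rewrite qp root_lt_irr in pq.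
by rewrite root_lt_irr eqxx.
Qed.

Lemma word_le_cons p s q w :
  word_le (p :: s) (q :: w) = root_lt p q || (p == q) && word_le s w.
Proof.
rewrite /word_le /= eqseq_cons; have [->|] //= := eqVneq p q.
by rewrite root_lt_irr.
Qed.

Lemma word_le_nilr s : word_le s [::] = (s == [::]).
Proof. by case: s. Qed.

Lemma word_le_nill s : word_le [::] s = (s == [::]).
Proof. by case: s. Qed.

(** Being least is compatible with merging. If the first letter of [w] goes to [a], it is at least
    the first letter of [s1], which is at least the head of the sorted word [t]. Either this decides
    the comparison, or the three letters agree and can be removed. *)
Lemma splits_lex t s1 s2 w a b : sorted root_le t -> perm_eq t (s1 ++ s2) ->
  (a, b) \in splits w -> word_le s1 a -> word_le s2 b ->
  word_lex t w \/ [/\ w = t, a = s1 & b = s2].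
Proof.
elim: w t s1 s2 a b => [|p w IH] t s1 s2 a b st pt.
  rewrite inE => /eqP[-> ->]; rewrite !word_le_nilr => /eqP s1E /eqP s2E.
  move: pt; rewrite s1E s2E => /perm_nilP ->; right.
  by split.
(* This treats the factor that receives the first letter; it is used once as it stands and once with
   the two factors exchanged. *)
have main u1 u2 x y : perm_eq t (u1 ++ u2) ->
    word_le u1 (p :: x) -> word_le u2 y ->
    (forall t' u1', sorted root_le t' -> perm_eq t' (u1' ++ u2) ->
       word_le u1' x -> word_lex t' w \/ [/\ w = t', x = u1' & y = u2]) ->
    word_lex t (p :: w) \/ [/\ p :: w = t, p :: x = u1 & y = u2].
  move=> ptu; case: u1 ptu => [|p1 u1] ptu; first by rewrite word_le_nill.
  rewrite word_le_cons => p1p u2y rec.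
  case: t st ptu {pt} => [|h t] st ptu; first by have := perm_size ptu.
  have hp1 : root_le h p1.
    have : p1 \in h :: t by rewrite (perm_mem ptu) mem_head.
    rewrite inE => /orP[/eqP ->|p1t]; first exact: root_le_refl.
    by move: st; rewrite /= (path_sortedE root_le_trans) => /andP[/allP ->].
  have {p1p}[p1p|/andP[/eqP p1p u1x]] := orP p1p.
    left=> /=; apply/orP; left.
    case/orP: hp1 => [/eqP -> //|hp1]; exact: root_lt_trans hp1 p1p.
  case/orP: hp1 => [/eqP hp1|hp1]; last by left; rewrite /= -p1p hp1.
  rewrite -p1p -hp1 in ptu *.
  have {}st : sorted root_le t by exact: path_sorted st.
  have {}ptu : perm_eq t (u1 ++ u2) by rewrite -(perm_cons h).
  have [tw|[-> -> ->]] := rec t u1 st ptu u1x; last by right.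
  by left; rewrite /= eqxx tw orbT.
case/splits_consP => [[a' ->]|[b' ->]] xy le1 le2.
  apply: (main s1 s2 a' b) => // t' u1' st' pt' le'.
  exact: (IH t' u1' s2 a' b).
case: (main s2 s1 b' a) => //; [by rewrite perm_sym perm_catC perm_sym| |by left|].
  move=> t' u1' st' pt' le'.
  have [||[-> -> ->]] := IH t' s1 u1' a b' st' _ xy le1 le'; [|by left|by right].
  by rewrite perm_sym perm_catC perm_sym.
by case=> -> -> ->; right.
Qed.

(** The least letter of [t] must be the head of a sorted factor that contains it, so the splitting
    can be built letter by letter. *)
Lemma splits_sorted_mem t a b : sorted root_le t -> sorted root_le a ->
  sorted root_le b -> perm_eq t (a ++ b) -> (a, b) \in splits t.
Proof.
elim: t a b => [|p t IH] a b st sa sb.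
  by rewrite perm_sym => /perm_nilP; case: a sa => // _; case: b sb.
move: st; rewrite /= (path_sortedE root_le_trans) => /andP[/allP pmin st] pt.
have heads x y : sorted root_le x -> perm_eq (p :: t) (x ++ y) ->
    p \in x -> exists2 x', x = p :: x' & perm_eq t (x' ++ y).
  case: x => // q x sx px; have qp : root_le p q.
    have : q \in p :: t by rewrite (perm_mem px) mem_head.
    by rewrite inE => /orP[/eqP ->|/pmin //]; exact: root_le_refl.
  rewrite inE => pqx; have {pqx} pq : root_le q p.
    case/orP: pqx => [/eqP ->|]; first exact: root_le_refl.
    move: sx; rewrite /= (path_sortedE root_le_trans) => /andP[/allP + _].
    exact.
  have {qp pq} qE : p = q by apply: root_le_anti; rewrite qp pq.
  by exists x; rewrite ?qE // -(perm_cons p) -cat_cons {2}qE.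
rewrite mem_cat; have : p \in a ++ b by rewrite -(perm_mem pt) mem_head.
rewrite mem_cat => /orP[pa|pb]; apply/orP.
  have [a' aE pt'] := heads a b sa pt pa; left; apply/mapP; exists (a', b).
    by apply: IH => //; move: sa; rewrite aE => /path_sorted.
  by rewrite aE.
have [|b' bE pt'] := heads b a sb _ pb.
  by rewrite perm_sym perm_catC perm_sym.
right; apply/mapP; exists (a, b').
  apply: IH => //; first by move: sb; rewrite bE => /path_sorted.
  by rewrite perm_sym perm_catC perm_sym.
by rewrite bE.
Qed.

Definition factT T : nat := \prod_p (T p)`!.

Lemma factT_neq0 T : factT T != 0%N.
Proof. by rewrite -lt0n prodn_gt0 // => p; exact: fact_gt0. Qed.

Lemma factT_cons p T : factT (cnt [:: p] + T) = ((T p).+1 * factT T)%N.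
Proof.
rewrite /factT (bigD1 p) //= [in RHS](bigD1 p) //= addT_E ffunE /= eqxx factS -mulnA.
congr (_ * (_ * _))%N; apply: eq_bigr => q qp; rewrite addT_E !ffunE /=.
by rewrite eq_sym (negPf qp).
Qed.

(* The Leibniz rule for the pairing of words with monomials in which a letter
   acts as a partial derivative. *)
Lemma sum_splits_factT w A B :
  (\sum_(ab <- splits w)
     (cnt ab.1 == A) * factT A * ((cnt ab.2 == B) * factT B) =
   (cnt w == (A + B)%R) * factT (A + B)%R)%N.
Proof.
pose dec p T : {ffun posroot n -> nat} := [ffun q => (T q - (p == q))%N].
have decK p T : (0 < T p)%N -> T = cnt [:: p] + dec p T.
  move=> Tp; apply/ffunP => q; rewrite addT_E !ffunE /= addn0.
  by have [<-|_] := eqVneq p q; rewrite ?subn0 // subnKC.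
(* The partial derivative by the letter [p]: it brings down the exponent [T p] and lowers it by
   one. *)
have consE p T s : ((cnt (p :: s) == T) * factT T =
    T p * ((cnt s == dec p T) * factT (dec p T)))%N.
  have [Tp|Tp] := posnP (T p).
    rewrite Tp mul0n; case: eqP => // Ts; move: Tp.
    by rewrite -Ts ffunE /= eqxx.
  rewrite {1 2}(decK p T Tp) cnt_cons factT_cons.
  have -> : (T p = (dec p T p).+1)%N by rewrite ffunE eqxx subn1 prednK.
  have -> : (cnt [:: p] + cnt s == cnt [:: p] + dec p T) = (cnt s == dec p T).
    apply/eqP/eqP => [/ffunP E|-> //]; apply/ffunP => q.
    by have := E q; rewrite !addT_E => /addnI.
  by rewrite mulnCA.
elim: w A B => [|p w IH] A B.
  rewrite /= big_seq1 /= cnt_nil.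
  have [<-|A0] := eqVneq 0 A; last first.
    rewrite mul0n; have [AB|//] := eqVneq 0 (A + B).
    case/eqP: A0; apply/ffunP => q; have /ffunP/(_ q) := AB; rewrite addT_E !ffunE.
    by move=> /esym/eqP; rewrite addn_eq0 => /andP[/eqP ->].
  rewrite add0r; have [<-|_] := eqVneq 0 B; last by rewrite !mul0n muln0.
  by rewrite !mul1n /factT big1 // => q _; rewrite ffunE.
rewrite big_splits_cons consE big_split /=.
under eq_bigr do rewrite consE -mulnA.
rewrite -big_distrr /= IH.
under eq_bigr do rewrite consE mulnCA.
rewrite -big_distrr /= IH.
have decl : (0 < A p)%N -> dec p A + B = dec p (A + B).
  move=> Ap; apply/ffunP => q; rewrite !(addT_E, ffunE).
  by have [<-|_] := eqVneq p q; lia.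
have decr : (0 < B p)%N -> A + dec p B = dec p (A + B).
  move=> Bp; apply/ffunP => q; rewrite !(addT_E, ffunE).
  by have [<-|_] := eqVneq p q; lia.
rewrite addT_E mulnDl; congr (_ + _)%N.
  by have [->|Ap] := posnP (A p); rewrite ?mul0n // decl.
by have [->|Bp] := posnP (B p); rewrite ?mul0n // decr.
Qed.
End Words.
(** * Modules over gl_n *)

Section GlModules.
Context {F : fieldType} {n : nat}.
Implicit Types (w : seq (posroot n)) (x : freealg F n).

(* [E i j] is the action of the matrix unit E_{i,j}. *)
Record glmod (V : lmodType F) (m : 'I_n -> F) (E : 'I_n -> 'I_n -> {linear V -> V})
    (v : V) : Prop := Glmod {
  gl_comm : forall i j k l u, E i j (E k l u) =
    E k l (E i j u) + (j == k)%:R *: E i l u - (l == i)%:R *: E k j u;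
  gl_raise : forall i j : 'I_n, (i < j)%N -> E i j v = 0;
  gl_diag : forall i, E i i v = m i *: v
}.

Definition wact (V : lmodType F) (E : 'I_n -> 'I_n -> {linear V -> V}) w (u : V) :=
  foldr (fun p u => E (val p).2 (val p).1 u) u w.

Lemma wact_cat (V : lmodType F) (E : 'I_n -> 'I_n -> {linear V -> V}) a b u :
  wact E (a ++ b) u = wact E a (wact E b u).
Proof. exact: foldr_cat. Qed.

Lemma wact_is_linear (V : lmodType F) (E : 'I_n -> 'I_n -> {linear V -> V}) w :
  linear (wact E w).
Proof. by move=> c u u'; elim: w => //= p w ->; rewrite linearP. Qed.
HB.instance Definition _ (V : lmodType F) (E : 'I_n -> 'I_n -> {linear V -> V}) w :=
  GRing.isLinear.Build F V V *:%R (wact E w) (wact_is_linear E w).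

(* E_{i,j} applied to [w v] is [mopw m w i j] applied to [v], in every module with
   a singular vector [v] of weight [m]; read off from the commutation relations. *)
Fixpoint mopw (m : 'I_n -> F) w (i j : 'I_n) : freealg F n :=
  if w is p :: w' then
    fhat p * mopw m w' i j + (j == (val p).2)%:R *: mopw m w' i (val p).1
      - ((val p).1 == i)%:R *: mopw m w' (val p).2 j
  else if insub (j, i) is Some p then fhat p else if i == j then m i *: 1 else 0.

Definition mop m i j : freealg F n -> freealg F n :=
  mlin (fun w : {fmonom posroot n} => mopw m w i j).
HB.instance Definition _ m i j := GRing.Linear.on (mop m i j).

Section Module.
Context (V : lmodType F) (m : 'I_n -> F) (E : 'I_n -> 'I_n -> {linear V -> V}) (v : V).
Hypothesis EV : glmod m E v.

Definition fact : freealg F n -> V := mlin (fun w : {fmonom posroot n} => wact E w v).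
HB.instance Definition _ := GRing.Linear.on fact.

Lemma factU (w : {fmonom posroot n}) : fact << w >> = wact E w v.
Proof. exact: mlinU. Qed.

Lemma factB x y : fact (x - y) = fact x - fact y.
Proof. exact: raddfB. Qed.

Lemma factD x y : fact (x + y) = fact x + fact y.
Proof. exact: raddfD. Qed.

Lemma factZ c x : fact (c *: x) = c *: fact x.
Proof. exact: linearZ. Qed.

Lemma fact1 : fact 1 = v.
Proof. by rewrite [LHS]factU fm1. Qed.

Lemma fact_wordM (a : {fmonom posroot n}) x :
  fact (<< a >> * x) = wact E a (fact x).
Proof.
rewrite {1}[x]malg_basisE mulr_sumr /fact raddf_sum [in RHS]/mlin raddf_sum /=.
apply: eq_bigr => w _; rewrite freealg_scaleAr word_mulU !linearZ /=.
by rewrite mlinU fmM wact_cat.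
Qed.

Lemma fact_fhat p x : fact (fhat p * x) = E (val p).2 (val p).1 (fact x).
Proof. by rewrite fact_wordM fmU. Qed.

Lemma fact_mopw w i j : fact (mopw m w i j) = E i j (wact E w v).
Proof.
elim: w i j => [|p w IH] i j /=.
  case: insubP => [p _ pE|ij].
    by rewrite -[fhat p]mulr1 fact_fhat fact1 pE.
  case: eqP => [<-|/eqP ne]; first by rewrite factZ fact1 (gl_diag EV).
  by rewrite linear0 (gl_raise EV) // ltn_neqAle ne /= leqNgt.
rewrite (gl_comm EV) factB factD fact_fhat IH.
by congr (_ + _ - _); rewrite factZ IH.
Qed.

Lemma fact_mop i j x : fact (mop m i j x) = E i j (fact x).
Proof.
rewrite /mop {1}/mlin {2}/fact /mlin !raddf_sum /=.
by apply: eq_bigr => w _; rewrite !linearZ /= fact_mopw.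
Qed.

Lemma gl_diag_word w i : E i i (wact E w v) =
  (m i + (\sum_(p <- w) (i == (val p).2 :> nat))%:R
       - (\sum_(p <- w) (i == (val p).1 :> nat))%:R) *: wact E w v.
Proof.
elim: w => [|p w IH] /=; first by rewrite !big_nil addr0 subr0 (gl_diag EV).
rewrite (gl_comm EV) IH linearZ /= !big_cons !natrD.
rewrite (eq_sym (val p).1 i) -!val_eqE /=.
have [ip2|_] := eqVneq (i : nat) (val p).2; have [ip1|_] := eqVneq (i : nat) (val p).1.
- by have := posroot_lt p; rewrite -ip1 ip2 ltnn.
- rewrite -(val_inj ip2) scale1r scale0r subr0 -[X in _ + X]scale1r -scalerDl.
  by congr (_ *: _); rewrite mulr1n mulr0n; ring.
- rewrite -(val_inj ip1) scale1r scale0r addr0 -[X in _ - X]scale1r -scalerBl.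
  by congr (_ *: _); rewrite mulr1n mulr0n; ring.
by rewrite !scale0r subr0 addr0; congr (_ *: _); rewrite mulr0n; ring.
Qed.

End Module.

(** The product of the operators [h - d] over the other eigenvalues [d] kills every other term and
    multiplies the terms of eigenvalue [c] by one nonzero scalar. *)
Lemma eigen_sum (V : lmodType F) (h : {linear V -> V}) (I : eqType) (r : seq I)
    (u : I -> V) (a : I -> F) (c : F) :
  (forall i, i \in r -> h (u i) = a i *: u i) -> \sum_(i <- r) u i = 0 ->
  \sum_(i <- r | a i == c) u i = 0.
Proof.
move=> hu sum0; pose D := [seq d <- undup (map a r) | d != c].
pose P (y : V) := foldr (fun d y => h y - d *: y) y D.
have PE i : i \in r -> P (u i) = (\prod_(d <- D) (a i - d)) *: u i.
  move=> ir; rewrite /P; elim: (D) => [|d s IH] /=; first by rewrite big_nil scale1r.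
  by rewrite IH linearZ /= hu // big_cons !scalerA -scalerBl; congr (_ *: _); ring.
have Psum (s : seq I) : P (\sum_(i <- s) u i) = \sum_(i <- s) P (u i).
  rewrite /P; elim: (D) => //= d t ->.
  by rewrite linear_sum scaler_sumr -sumrB.
have : P (\sum_(i <- r) u i) = (\prod_(d <- D) (c - d)) *: \sum_(i <- r | a i == c) u i.
  rewrite Psum (bigID (fun i => a i == c)) /= [X in _ + X]big1_seq ?addr0.
    rewrite scaler_sumr big_seq_cond [RHS]big_seq_cond.
    by apply: eq_bigr => i /andP[ir /eqP aic]; rewrite PE // aic.
  move=> i /andP[aic ir]; rewrite PE //.
  suff /(big_rem _) -> : a i \in D by rewrite /= subrr mul0r scale0r.
  by rewrite mem_filter aic mem_undup map_f.
have -> : P (\sum_(i <- r) u i) = 0.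
  rewrite sum0 /P; elim: (D) => //= d t ->; by rewrite linear0 scaler0 subrr.
move/esym/eqP; rewrite scaler_eq0 => /orP[|/eqP //].
rewrite prodf_seq_eq0 => /hasP[d]; rewrite mem_filter => /andP[dc _].
by rewrite /= subr_eq0 eq_sym (negPf dc).
Qed.

Lemma word_wt_eq0 w : (word_wt w == 0%N) = (w == [::]).
Proof.
case: w => [|p w]; first by rewrite /word_wt big_nil.
by rewrite /word_wt big_cons addn_eq0 subn_eq0 leqNgt posroot_lt.
Qed.

(* The operator sum_i i E_{i,i} has eigenvalue c + [word_wt w] at [w v]. *)
Lemma fact_eq0_coeff1 (V : lmodType F) (m : 'I_n -> F)
    (E : 'I_n -> 'I_n -> {linear V -> V}) (v : V) x :
  [pchar F] =i pred0 -> glmod m E v -> v != 0 -> fact E v x = 0 -> x@_(mone : {fmonom posroot n}) = 0.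
Proof.
move=> F0 EV v0 x0; pose h : {linear V -> V} := \sum_(i < n) i%:R *: E i i.
have hE u : h u = \sum_(i < n) i%:R *: E i i u.
  rewrite /h; elim/big_rec2: _ => // i y f _ <-; by [].
pose c : F := \sum_(i < n) i%:R * m i.
have hw w : h (wact E w v) = (c + (word_wt w)%:R) *: wact E w v.
  rewrite hE; under eq_bigr do rewrite (gl_diag_word EV) scalerA.
  rewrite -scaler_suml; congr (_ *: _).
  under eq_bigr do rewrite mulrBr mulrDr -addrA.
  rewrite big_split /= -/c; congr (c + _).
  elim: w => [|p w IH].
    by rewrite big1 ?/word_wt ?big_nil // => i _; rewrite !big_nil !mulr0 subr0.
  under eq_bigr do rewrite !big_cons !natrD !mulrDr opprD addrACA.
  rewrite big_split /= IH /word_wt big_cons natrD; congr (_ + _).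
  rewrite natrB; last exact/ltnW/posroot_lt.
  have dl (a : 'I_n) : \sum_(i < n) i%:R * (i == a :> nat)%:R = a%:R :> F.
    rewrite (bigD1 a) //= eqxx mulr1 big1 ?addr0 // => i ia.
    by rewrite val_eqE (negPf ia) mulr0.
  by rewrite sumrB !dl.
have /eigen_sum/(_ x0) : forall w : {fmonom posroot n}, w \in msupp x ->
    h (x@_w *: wact E w v) = (c + (word_wt w)%:R) *: (x@_w *: wact E w v).
  by move=> w _; rewrite linearZ /= hw !scalerA mulrC.
move=> /(_ c).
(* The eigenvalue [c] belongs to the empty word alone: all letters have positive length and the
   characteristic is 0. *)
rewrite (eq_bigl (fun w : {fmonom posroot n} => w == mone)); last first.
  move=> w; rewrite -subr_eq0 addrC addKr (pcharf0P _).1 // word_wt_eq0.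
  by rewrite fmP fm1.
have [xs|/mcoeff_outdom -> //] := boolP ((mone : {fmonom posroot n}) \in msupp x).
rewrite (big_rem _ xs) /= eqxx big1_seq ?addr0.
  by rewrite fm1 /= => /eqP; rewrite scaler_eq0 (negPf v0) orbF => /eqP.
move=> w /andP[/eqP ->]; rewrite mem_rem_uniq ?fset_uniq // inE eqxx //.
Qed.

End GlModules.
(** * Contravariant forms *)

Section Hermitian.
Context {C : numClosedFieldType} {n : nat}.
Implicit Types (w : seq (posroot n)) (x : freealg C n).

Record herm (V : lmodType C) (E : 'I_n -> 'I_n -> {linear V -> V})
    (h : V -> V -> C) : Prop := Herm {
  herm_linl : forall a u u' z, h (a *: u + u') z = a * h u z + h u' z;
  herm_linr : forall a u z z', h u (a *: z + z') = a^* * h u z + h u z';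
  herm_adj : forall i j u z, h (E i j u) z = h u (E j i z);
  herm_ge0 : forall u, 0 <= h u u;
  herm_eq0 : forall u, h u u = 0 -> u = 0
}.

Section Form.
Context (V : lmodType C) (E : 'I_n -> 'I_n -> {linear V -> V}) (h : V -> V -> C).
Hypothesis hE : herm E h.

Lemma herm0l u : h 0 u = 0.
Proof. by have := herm_linl hE 1 0 0 u; rewrite scaler0 addr0 mul1r => /eqP; rewrite addrC -subr_eq subrr eq_sym => /eqP. Qed.

Lemma herm0r u : h u 0 = 0.
Proof. by have := herm_linr hE 1 u 0 0; rewrite scaler0 addr0 conjC1 mul1r => /eqP; rewrite addrC -subr_eq subrr eq_sym => /eqP. Qed.

Lemma herm_suml (I : Type) (r : seq I) (a : I -> C) (u : I -> V) z :
  h (\sum_(i <- r) a i *: u i) z = \sum_(i <- r) a i * h (u i) z.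
Proof.
elim: r => [|i r IH]; first by rewrite !big_nil herm0l.
by rewrite !big_cons (herm_linl hE) IH.
Qed.

Lemma herm_sumr (I : Type) (r : seq I) (a : I -> C) (u : I -> V) z :
  h z (\sum_(i <- r) a i *: u i) = \sum_(i <- r) (a i)^* * h z (u i).
Proof.
elim: r => [|i r IH]; first by rewrite !big_nil herm0r.
by rewrite !big_cons (herm_linr hE) IH.
Qed.

Lemma herm_wact w u u' :
  h (wact E w u) u' = h u (foldl (fun y p => E (val p).1 (val p).2 y) u' w).
Proof. by elim: w u' => //= p w IH u'; rewrite (herm_adj hE) IH. Qed.
End Form.

(* The pairing of [x v'] with [w v'] is that of [E_{w^t} x v'] with [v']. By [mop]
   it is h v' v' times the coefficient of 1 in an element that kills [v] along
   with [x]. *)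
Lemma herm_ann (V V' : lmodType C) (m : 'I_n -> C) E E' (v : V) (v' : V') h x :
  glmod m E v -> v != 0 -> glmod m E' v' -> herm E' h ->
  fact E v x = 0 -> fact E' v' x = 0.
Proof.
move=> EV v0 EV' hE x0; apply: (herm_eq0 hE).
set u := {2}(fact _ _ _); rewrite /fact /mlin (herm_suml hE) big1 // => w _.
rewrite (herm_wact hE).
(* The transposed word is applied to [x] formally, in the free algebra, so that one element [z]
   describes the result in both modules. *)
pose z := foldl (fun y p => mop m (val p).1 (val p).2 y) x w.
have zE (U : lmodType C) (G : 'I_n -> 'I_n -> {linear U -> U}) y : glmod m G y ->
    fact G y z = foldl (fun y p => G (val p).1 (val p).2 y) (fact G y x) w.
  move=> GU; rewrite /z; elim: (w : seq _) x {x0 u z} => //= p s IH x.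
  by rewrite IH (fact_mop GU).
rewrite /u -(zE _ _ _ EV').
have z0 : fact E v z = 0.
  rewrite (zE _ _ _ EV) x0; elim: (w : seq _) => //= p s IH.
  by rewrite linear0.
have z1 := fact_eq0_coeff1 (pchar_num C) EV v0 z0.
rewrite /fact /mlin (herm_sumr hE) big1 ?mulr0 // => y _.
have [->|y1] := eqVneq y mone; first by rewrite z1 conjC0 mul0r.
case: y y1 => -[|p y] y1 /=; first by case/eqP: y1; apply/eqP; rewrite fmP fm1.
by rewrite -(herm_adj hE) (gl_raise EV') ?(herm0l hE) ?mulr0 //; exact: posroot_lt.
Qed.

End Hermitian.

(** * Fock space *)

Section Fock.
Import boot.finset.
Context {C : numClosedFieldType} {n : nat}.
Implicit Types (A : {set 'I_n}) (i j : 'I_n).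

(** The sign of moving the basis vector of index [j] to its place in the wedge product indexed by
    [A]. *)
Definition sg j A : C := \prod_(x in A | (x < j)%N) -1.

Lemma sg_sq j A : sg j A * sg j A = 1.
Proof. by rewrite -big_split /= big1 // => x _; rewrite mulrNN mulr1. Qed.

Lemma sgU1 i j A : i \notin A -> sg j (i |: A) = (-1) ^+ (i < j)%N * sg j A.
Proof.
move=> iA; rewrite /sg big_mkcondr big_setU1 //= -big_mkcondr /=.
by case: ifP => // _; rewrite expr1 // expr0.
Qed.

Lemma sgD1 i j A : i \in A -> sg j (A :\ i) = (-1) ^+ (i < j)%N * sg j A.
Proof.
move=> iA; rewrite -{2}(setD1K iA) sgU1 ?setD11 // mulrA -exprD addnn.
by rewrite -signr_odd odd_double mul1r.
Qed.

Section Operators.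
Context {V : lmodType C}.
Implicit Types u : {ffun {set 'I_n} -> V}.

(** A function on the subsets of ['I_n] with values in [V] is an element of the tensor product of
    [V] with the exterior algebra, written in coordinates. Keeping [V] general allows tensor
    products of many Fock spaces to be built one factor at a time. *)
Definition ann j u : {ffun {set 'I_n} -> V} :=
  [ffun A : {set 'I_n} => if j \in A then 0 else sg j A *: u (j |: A)].
Definition cre i u : {ffun {set 'I_n} -> V} :=
  [ffun A : {set 'I_n} => if i \in A then sg i A *: u (A :\ i) else 0].
Definition pw (f : V -> V) u : {ffun {set 'I_n} -> V} := [ffun A : {set 'I_n} => f (u A)].

Lemma ffunPl a u u' A : (a *: u + u') A = a *: u A + u' A.
Proof. by rewrite !ffunE. Qed.

Lemma ann_is_linear j : linear (ann j).
Proof.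
move=> a u u'; apply/ffunP => A; rewrite ffunPl !ffunE.
by case: ifP => _; rewrite ?scaler0 ?addr0 // scalerDr !scalerA mulrC.
Qed.
HB.instance Definition _ j := GRing.isLinear.Build C _ _ *:%R (ann j) (ann_is_linear j).

Lemma cre_is_linear i : linear (cre i).
Proof.
move=> a u u'; apply/ffunP => A; rewrite ffunPl !ffunE.
by case: ifP => _; rewrite ?scaler0 ?addr0 // scalerDr !scalerA mulrC.
Qed.
HB.instance Definition _ i := GRing.isLinear.Build C _ _ *:%R (cre i) (cre_is_linear i).

Lemma pw_is_linear (f : {linear V -> V}) : linear (pw f).
Proof. by move=> a u u'; apply/ffunP => A; rewrite ffunPl !ffunE linearP. Qed.
HB.instance Definition _ (f : {linear V -> V}) :=
  GRing.isLinear.Build C _ _ *:%R (pw f) (pw_is_linear f).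

Lemma ann_pw (f : {linear V -> V}) j u : ann j (pw f u) = pw f (ann j u).
Proof. by apply/ffunP => A; rewrite !ffunE; case: ifP; rewrite ?linear0 ?linearZ. Qed.

Lemma cre_pw (f : {linear V -> V}) j u : cre j (pw f u) = pw f (cre j u).
Proof. by apply/ffunP => A; rewrite !ffunE; case: ifP; rewrite ?linear0 ?linearZ. Qed.

Lemma ann_ann i j u : ann i (ann j u) = - ann j (ann i u).
Proof.
apply/ffunP => A; rewrite !ffunE !inE.
have [<-|ij] := eqVneq i j; first by case: ifP => _; rewrite ?eqxx ?scaler0 oppr0.
rewrite /=; case: ifP => iA; case: ifP => jA; rewrite ?scaler0 ?oppr0 //.
rewrite setUCA !scalerA -scaleNr; congr (_ *: _).
rewrite !sgU1 ?iA ?jA //; have : i != j :> nat by [].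
by case: ltngtP => //= _ _; rewrite expr1 expr0; ring.
Qed.

Lemma cre_cre i j u : cre i (cre j u) = - cre j (cre i u).
Proof.
apply/ffunP => A; rewrite !ffunE !inE.
have [<-|ij] := eqVneq i j; first by case: ifP => _; rewrite ?eqxx ?scaler0 oppr0.
rewrite /=; case: ifP => iA; case: ifP => jA; rewrite ?scaler0 ?oppr0 //.
rewrite !setDDl [[set j] :|: _]setUC !scalerA -scaleNr; congr (_ *: _).
rewrite !sgD1 ?iA ?jA //; have : i != j :> nat by [].
by case: ltngtP => //= _ _; rewrite expr1 expr0; ring.
Qed.

(** With the two preceding lemmas, the canonical anticommutation relations; [fock_comm] follows from
    them alone. *)
Lemma cre_ann i j u : cre i (ann j u) = (i == j)%:R *: u - ann j (cre i u).
Proof.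
apply/ffunP => A; rewrite !ffunE !inE.
have [<-|ij] := eqVneq i j.
  case: ifP => iA; rewrite scale1r /=.
    rewrite subr0 scalerA sgD1 // ltnn mul1r sg_sq scale1r.
    by rewrite setD1K.
  rewrite scalerA sgU1 ?iA // ltnn mul1r sg_sq scale1r setU1K ?iA //.
  by rewrite subrr.
rewrite scale0r sub0r /=; case: ifP => iA; case: ifP => jA; rewrite ?scaler0 ?oppr0 //.
have -> : (j |: A) :\ i = j |: (A :\ i).
  apply/setP => x; rewrite !inE; have [->|//] := eqVneq x j.
  by rewrite eq_sym ij.
rewrite !scalerA -scaleNr; congr (_ *: _).
rewrite sgD1 // sgU1 ?jA //; have : i != j :> nat by [].
by case: ltngtP => //= _ _; rewrite expr1 expr0; ring.
Qed.

(** The matrix unit E_{i,j} acting on the exterior algebra as a derivation. *)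
Definition fockE i j : {ffun {set 'I_n} -> V} -> {ffun {set 'I_n} -> V} :=
  cre i \o ann j.
HB.instance Definition _ i j := GRing.Linear.on (fockE i j).

Lemma fock_comm i j (k l : 'I_n) u : fockE i j (fockE k l u) =
  fockE k l (fockE i j u) + (j == k)%:R *: fockE i l u - (l == i)%:R *: fockE k j u.
Proof.
have swap a b y : ann a (cre b y) = (b == a)%:R *: y - cre b (ann a y).
  by rewrite cre_ann subKr.
rewrite /fockE /= swap [in RHS]swap !linearB !linearZ /= (eq_sym k j) (eq_sym i l).
rewrite cre_cre (ann_ann l j) [in RHS]linearN [in RHS]linearN /= scalerN opprK.
by rewrite [RHS]addrAC (addrAC ((l == i)%:R *: _)) subrr add0r addrC.
Qed.

Lemma fock_pw (f : {linear V -> V}) i j u : fockE i j (pw f u) = pw f (fockE i j u).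
Proof. by rewrite /fockE /= ann_pw cre_pw. Qed.

Definition ev A u : V := u A.

Lemma ev_is_linear A : linear (ev A).
Proof. by move=> a u u'; rewrite /ev ffunPl. Qed.
HB.instance Definition _ A := GRing.isLinear.Build C _ _ *:%R (ev A) (ev_is_linear A).

End Operators.

Definition fockL i j : {linear {ffun {set 'I_n} -> C^o} -> {ffun {set 'I_n} -> C^o}} :=
  fockE i j.

Lemma sg_neq0 j B : sg j B != 0.
Proof.
by apply/eqP => sg0; have := sg_sq j B; rewrite sg0 mul0r => /eqP; rewrite eq_sym oner_eq0.
Qed.

(** A coordinate of the image comes from a single coordinate of [g], up to sign. So nothing cancels,
    and nonvanishing becomes a condition on sets. *)
Lemma fockL_neq0 (a b : 'I_n) g A : a != b -> (fockL b a g A != 0) =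
  [&& b \in A, a \notin A & g (a |: A :\ b) != 0].
Proof.
move=> ab; rewrite /fockL /fockE /= !ffunE; case: ifP => bA //=; last by rewrite eqxx.
rewrite scaler_eq0 (negPf (sg_neq0 _ _)) /= !inE ab /=.
case: ifP => aA /=; first by rewrite eqxx.
by rewrite scaler_eq0 (negPf (sg_neq0 _ _)).
Qed.

Definition seg (k : nat) : {set 'I_n} := [set x : 'I_n | (x < k)%N].
(** The vacuum: the wedge of the first [k] basis vectors, a highest weight vector of the [k]-th
    exterior power. *)
Definition gnd (k : nat) : {ffun {set 'I_n} -> C^o} :=
  [ffun A : {set 'I_n} => (A == seg k)%:R].

Lemma gnd_neq0 (k : nat) A : (gnd k A != 0) = (A == seg k).
Proof.
by rewrite ffunE; case: (A == seg k); rewrite ?mulr0n ?eqxx // mulr1n oner_eq0.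
Qed.

Lemma gnd_raise k i j : (i < j)%N -> fockL i j (gnd k) = 0.
Proof.
move=> ij; apply/ffunP => A; apply/eqP/negPn; rewrite [X in _ != X]ffunE.
rewrite fockL_neq0 ?gnd_neq0; last by rewrite neq_ltn ij orbT.
apply/negP => /and3P[iA jA /eqP E].
have : j \in seg k by rewrite -E !inE eqxx.
rewrite inE => jk; have : i \in seg k by rewrite inE (ltn_trans ij).
by rewrite -E !inE eqxx /= orbF -val_eqE /= => /eqP ijE; rewrite ijE ltnn in ij.
Qed.

Lemma gnd_diag k i : fockL i i (gnd k) = ((i < k)%N)%:R *: gnd k.
Proof.
apply/ffunP => A; rewrite /fockL /fockE /= !ffunE.
have -> : ((i < k)%N)%:R *: ((A == seg k)%:R : C^o) = (i \in A)%:R *: ((A == seg k)%:R : C^o).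
  by have [->|_] := eqVneq A (seg k); rewrite ?inE // !scaler0.
case: ifP => iA; rewrite ?scale0r // !inE eqxx /= scalerA sgD1 // ltnn mul1r sg_sq.
by rewrite setD1K.
Qed.

(** A letter [p] exchanges the index [(val p).1] for [(val p).2], which raises the sum of the
    indices by the length of [p]. *)
Lemma gnd_wt k w A : wact fockL w (gnd k) A != 0 ->
  (word_wt w + \sum_(x in seg k) x = \sum_(x in A) x)%N.
Proof.
elim: w A => [|p w IH] A /=.
  by rewrite gnd_neq0 /word_wt big_nil => /eqP ->.
have pl := posroot_lt p; rewrite fockL_neq0; last by rewrite neq_ltn pl.
case/and3P=> bA aA /IH E; rewrite /word_wt big_cons -addnA -/(word_wt w) E.
rewrite big_setU1 /=; last by rewrite !inE (negPf aA) andbF.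
by rewrite [RHS](big_setD1 _ bA) /= addnA subnK // ltnW.
Qed.

Definition root_of (l : nat) (i : 'I_n) : option (posroot n) :=
  obind (fun l' : 'I_n => insub (l', i)) (insub l).

(** The letters of a column from row [l] on, [s] being its entries in these rows. An entry on the
    diagonal contributes no letter. *)
Fixpoint colw (l : nat) (s : seq 'I_n) : seq (posroot n) :=
  if s is i :: s' then
    if root_of l i is Some p then p :: colw l.+1 s' else colw l.+1 s'
  else [::].

(** The column with its entries in the rows before [l] reset to the diagonal. Undoing the first
    letter of [colw l s] leads to the set for [l.+1], and the last set is the vacuum. *)
Definition colset (l : nat) (s : seq 'I_n) : {set 'I_n} :=
  seg l :|: [set x | x \in s].

Lemma root_of_id (i : 'I_n) : root_of i i = None.
Proof. by rewrite /root_of valK /= insubF //= ltnn. Qed.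

Lemma root_of_lt (l : nat) (i : 'I_n) : (l < i)%N ->
  exists2 p, root_of l i = Some p & (val p).1 = l :> nat /\ (val p).2 = i.
Proof.
move=> li; rewrite /root_of (insubT (fun l => (l < n)%N) (ltn_trans li (ltn_ord i))) /=.
case: insubP => [p _ pE|]; last by rewrite /= li.
by exists p; rewrite // pE.
Qed.

Definition incr (l : nat) (s : seq 'I_n) :=
  all (fun i : 'I_n => (l <= i)%N) s && sorted (fun i j : 'I_n => (i < j)%N) s.

Lemma incr_cons l i s : incr l (i :: s) ->
  [/\ (l <= i)%N, incr l.+1 s & {in s, forall x : 'I_n, (i < x)%N}].
Proof.
rewrite /incr /= path_sortedE; last by move=> x y z; exact: ltn_trans.
case/and3P=> /andP[li _] /allP is_ ss; split => //.
by rewrite ss andbT; apply/allP => x /is_; exact: leq_ltn_trans.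
Qed.

Lemma colset_id (i : 'I_n) s : colset i (i :: s) = colset i.+1 s.
Proof.
by apply/setP => x; rewrite !inE ltnS [(x <= i)%N]leq_eqVlt -val_eqE orbCA orbA.
Qed.

Lemma colset_step (p : posroot n) s : incr (val p).1 ((val p).2 :: s) ->
  (val p).1 |: colset (val p).1 ((val p).2 :: s) :\ (val p).2 = colset (val p).1.+1 s.
Proof.
case/incr_cons=> _ /andP[_ _] smin; have pl := posroot_lt p.
apply/setP => x; rewrite !inE ltnS [(x <= _)%N]leq_eqVlt -val_eqE /= -!orbA.
congr (_ || _); have [->|//] := eqVneq x (val p).2; rewrite /= ltnNge ltnW //=.
by apply/esym/negP => /smin; rewrite ltnn.
Qed.

(** The first letter [q] of such a word acts last: it takes [(val q).1] out of the set and puts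
    [(val q).2] in. So [(val q).1] is at least [l], and if it equals [l], then [(val q).2] is an
    entry of [s], hence at least its head. If the first letters agree, undoing them leaves the same
    problem for the next row. *)
Lemma colw_le (l k : nat) s w : incr l s -> k = (l + size s)%N ->
  wact fockL w (gnd k) (colset l s) != 0 -> word_le (colw l s) w.
Proof.
elim: s l w => [|i s IH] l w /=.
  move=> _ ->; rewrite addn0; case: w => [//|p w] /=.
  have pl := posroot_lt p; rewrite fockL_neq0; last by rewrite neq_ltn pl.
  by rewrite !inE !orbF => /and3P[pl1 /negP[]]; exact: ltn_trans pl1.
move=> ils kE; have [] := incr_cons ils; rewrite leq_eqVlt => /orP[/eqP liE|li] ls smin.
  rewrite liE root_of_id; rewrite liE in ls kE.
  by rewrite colset_id; apply: IH => //; rewrite kE addSnnS.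
have [p -> [p1 p2]] := root_of_lt li.
case: w => [|q w] /=.
  rewrite gnd_neq0 => /eqP/setP/(_ (val p).1); rewrite !inE p1 ltnn /=.
  rewrite kE addnS ltnS leq_addr => /orP[/eqP E|/smin].
    by have := posroot_lt p; rewrite E p2 ltnn.
  by rewrite p1 ltnNge ltnW.
have ql := posroot_lt q; rewrite fockL_neq0; last by rewrite neq_ltn ql.
case/and3P=> q2 q1; rewrite word_le_cons /root_lt posroot_eqE p1 -val_eqE /= p1.
have : (l <= (val q).1)%N.
  by move: q1; rewrite !inE negb_or -leqNgt => /andP[].
rewrite leq_eqVlt => /orP[/eqP lq|->//]; rewrite lq ltnn eqxx /= p2.
have : (i <= (val q).2)%N.
  move: q2; rewrite !inE lq ltnNge ltnW //= => /orP[/eqP -> //|/smin]; exact: ltnW.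
rewrite leq_eqVlt => /orP[/eqP iq|-> //]; rewrite iq eqxx ltnn /=.
have qE : p = q by apply/eqP; rewrite posroot_eqE p1 p2 lq iq !eqxx.
move: ils; rewrite -p1 -p2 => ils; rewrite -qE.
rewrite colset_step // p1; apply: IH; first by [].
by rewrite kE addSnnS.
Qed.

Lemma colw_neq0 (l k : nat) s : incr l s -> k = (l + size s)%N ->
  wact fockL (colw l s) (gnd k) (colset l s) != 0.
Proof.
elim: s l => [|i s IH] l /=.
  move=> _ ->; rewrite addn0 gnd_neq0; apply/eqP/setP => x.
  by rewrite !inE orbF.
move=> ils kE; have [] := incr_cons ils; rewrite leq_eqVlt => /orP[/eqP liE|li] ls smin.
  rewrite liE root_of_id; rewrite liE in ls kE.
  by rewrite colset_id; apply: IH => //; rewrite kE addSnnS.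
have [p -> [p1 p2]] := root_of_lt li; have pl := posroot_lt p.
rewrite /= fockL_neq0; last by rewrite neq_ltn pl.
rewrite -p1 -p2 !inE eqxx orbT ltnn /=; apply/andP; split.
  apply/negP => /orP[/eqP E|/smin]; first by rewrite E ltnn in pl.
  by rewrite p1 ltnNge ltnW.
rewrite colset_step ?p1 ?p2 //; apply: IH => //.
by rewrite kE addSnnS.
Qed.

Lemma colw_sorted l s : incr l s ->
  all (fun p : posroot n => l <= (val p).1)%N (colw l s) && sorted root_le (colw l s).
Proof.
elim: s l => [|i s IH] l //= /incr_cons[li ls smin].
have {IH} /andP[/allP la sa] := IH _ ls.
move: li; rewrite leq_eqVlt => /orP[/eqP liE|li].
  rewrite liE root_of_id -liE sa andbT.
  by apply/allP => p /la; exact: ltnW.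
have [p -> [p1 p2]] := root_of_lt li.
rewrite /= p1 leqnn /= (path_sortedE root_le_trans) sa andbT; apply/andP; split.
  by apply/allP => q /la; exact: ltnW.
by apply/allP => q /la lq; rewrite /root_le /root_lt p1 lq orbT.
Qed.

Lemma cnt_colw l s (p : posroot n) : incr l s ->
  cnt (colw l s) p =
  ((l <= (val p).1)%N && (onth s ((val p).1 - l) == Some (val p).2)) :> nat.
Proof.
elim: s l => [|i s IH] l; first by rewrite ffunE /= onth0n andbF.
case/incr_cons=> li /IH {}IH smin; have pl := posroot_lt p.
have cE : cnt (colw l (i :: s)) p = ((root_of l i == Some p) + cnt (colw l.+1 s) p)%N.
  rewrite /=; case: (root_of l i) => [q|] //=; rewrite !ffunE /=.
  by rewrite (inj_eq Some_inj).
rewrite cE IH {cE IH}; have [al|la|al] := ltngtP (val p).1 l.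
- rewrite /= addn0; apply/eqP; rewrite eqb0; apply/negP => /eqP.
  move: li; rewrite leq_eqVlt => /orP[/eqP ->|/root_of_lt[q -> [q1 _]] [qp]].
    by rewrite root_of_id.
  by rewrite -q1 qp ltnn in al.
- have -> : ((val p).1 - l = ((val p).1 - l.+1).+1)%N by rewrite -(subSn la) subSS.
  have -> : root_of l i == Some p = false.
    apply/negP => /eqP; move: li; rewrite leq_eqVlt.
    case/orP=> [/eqP ->|/root_of_lt[q -> [q1 _]] [qp]]; first by rewrite root_of_id.
    by rewrite -q1 qp ltnn in la.
  by [].
rewrite al subnn addn0 /= (inj_eq Some_inj); congr nat_of_bool.
move: li; rewrite leq_eqVlt => /orP[/eqP liE|/root_of_lt[q -> [q1 q2]]].
  rewrite liE root_of_id; apply/esym/negP => /eqP iE.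
  by rewrite al liE iE ltnn in pl.
by rewrite (inj_eq Some_inj) posroot_eqE q1 al eqxx q2.
Qed.

Lemma tword_pluckT (I : pluck n) : tword (pluckT I) = colw 0 (val I).
Proof.
have I0 : incr 0 (val I).
  by rewrite /incr; have /andP[-> _] := valP I; rewrite andbT; apply/allP.
have /andP[_ sI] := colw_sorted I0.
apply/eqP; rewrite eq_sym sorted_cntP //; apply/eqP/ffunP => p.
by rewrite cnt_colw // ffunE /in_col subn0.
Qed.
End Fock.
(** * Tensor products of Fock spaces *)

Section Models.
Import boot.finset.
Context {C : numClosedFieldType} {n : nat}.
Implicit Types (A : {set 'I_n}) (i j : 'I_n) (w : seq (posroot n)) (la : wt n).
Implicit Types (T : {ffun posroot n -> nat}).
Local Notation gnd' := (@gnd C n).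

(** Adding [j] to a set matches the nonzero terms of the two sides; the signs are real, so
    conjugation does not change them. *)
Lemma ann_adj (V : lmodType C) (h : V -> V -> C) (E : 'I_n -> 'I_n -> {linear V -> V})
    j (u z : {ffun {set 'I_n} -> V}) : herm E h ->
  \sum_A h (ann j u A) (z A) = \sum_A h (u A) (cre j z A).
Proof.
move=> hE; have sgC k A : (sg k A : C)^* = sg k A.
  by rewrite /sg rmorph_prod /=; apply: eq_bigr => x _; rewrite rmorphN1.
have hZl a x y : h (a *: x) y = a * h x y.
  by rewrite -[a *: x]addr0 (herm_linl hE) (herm0l hE) addr0.
have hZr a x y : h x (a *: y) = a^* * h x y.
  by rewrite -[a *: y]addr0 (herm_linr hE) (herm0r hE) addr0.
rewrite (bigID (fun A => j \in A)) /= big1 ?add0r; last first.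
  by move=> A jA; rewrite ffunE jA (herm0l hE).
rewrite [RHS](bigID (fun A => j \in A)) /= [X in _ = _ + X]big1 ?addr0; last first.
  by move=> A /negPf jA; rewrite ffunE jA (herm0r hE).
rewrite (reindex_onto (fun A => A :\ j) (fun A => j |: A)) /=; last first.
  by move=> A jA; rewrite setU1K.
apply: eq_big => [A|A].
  rewrite !inE eqxx /=; apply/eqP/idP => [<-|jA]; first by rewrite setU11.
  by rewrite setD1K.
rewrite !inE eqxx /= => /eqP AE; have jA : j \in A by rewrite -AE setU11.
by rewrite !ffunE !inE eqxx /= jA setD1K // hZl hZr sgC sgD1 // ltnn mul1r.
Qed.

Lemma cre_adj (V : lmodType C) (h : V -> V -> C) (E : 'I_n -> 'I_n -> {linear V -> V})
    j (u z : {ffun {set 'I_n} -> V}) : herm E h ->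
  \sum_A h (cre j u A) (z A) = \sum_A h (u A) (ann j z A).
Proof.
move=> hE; have sgC k A : (sg k A : C)^* = sg k A.
  by rewrite /sg rmorph_prod /=; apply: eq_bigr => x _; rewrite rmorphN1.
have hZl a x y : h (a *: x) y = a * h x y.
  by rewrite -[a *: x]addr0 (herm_linl hE) (herm0l hE) addr0.
have hZr a x y : h x (a *: y) = a^* * h x y.
  by rewrite -[a *: y]addr0 (herm_linr hE) (herm0r hE) addr0.
rewrite (bigID (fun A => j \notin A)) /= big1 ?add0r; last first.
  by move=> A /negPf jA; rewrite ffunE jA (herm0l hE).
rewrite [RHS](bigID (fun A => j \notin A)) /= [X in _ = _ + X]big1 ?addr0; last first.
  by move=> A /negPn jA; rewrite ffunE jA (herm0r hE).
rewrite (reindex_onto (fun A => j |: A) (fun A => A :\ j)) /=; last first.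
  by move=> A /negPn jA; rewrite setD1K.
apply: eq_big => [A|A].
  rewrite !inE eqxx /=; apply/eqP/idP => [<-|jA]; first by rewrite setD11.
  by rewrite setU1K.
rewrite !inE eqxx /= => /eqP AE; have jA : j \notin A by rewrite -AE setD11.
by rewrite !ffunE !inE eqxx (negPf jA) setU1K // hZl hZr sgC sgU1 // ltnn mul1r.
Qed.

Section FockTensor.
Context (V : lmodType C) (m : 'I_n -> C) (E : 'I_n -> 'I_n -> {linear V -> V}) (v : V).
Context (h : V -> V -> C) (phi : {linear V -> C^o}).
Local Notation V' := {ffun {set 'I_n} -> V}.

(** The diagonal action on the tensor product of [V] with the Fock space; [rk1] below gives its pure
    tensors. *)
Definition tfE i j : {linear V' -> V'} := homD (pw (E i j)) (fockE i j).

Lemma tfEE i j u : tfE i j u = pw (E i j) u + fockE i j u.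
Proof. by []. Qed.

Definition rk1 (x : V) (g : {ffun {set 'I_n} -> C^o}) : V' :=
  [ffun A : {set 'I_n} => (g A : C) *: x].

Lemma tfE_rk1 i j x g : tfE i j (rk1 x g) = rk1 (E i j x) g + rk1 x (fockL i j g).
Proof.
rewrite tfEE; congr (_ + _); apply/ffunP => A; rewrite !ffunE ?linearZ //=.
case: ifP => iA; last by rewrite scale0r.
case: ifP => jA; rewrite ?scaler0 ?scale0r //.
set c := g _; rewrite !scalerA; congr (_ *: _).
by rewrite -[RHS]/((sg i A * sg j (A :\ i)) * c) mulrCA mulrC.
Qed.

(** Each letter acts as a derivation of the tensor product, so a word distributes its letters over
    the two factors. *)
Lemma tfE_wact w x g : wact tfE w (rk1 x g) =
  \sum_(ab <- splits w) rk1 (wact E ab.1 x) (wact fockL ab.2 g).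
Proof.
elim: w => [|p w IH]; first by rewrite big_seq1.
rewrite big_splits_cons -[LHS]/(tfE (val p).2 (val p).1 (wact tfE w (rk1 x g))) IH.
have -> (r : seq _) (f : _ -> V') (i j : 'I_n) :
  tfE i j (\sum_(ab <- r) f ab) = \sum_(ab <- r) tfE i j (f ab) by exact: raddf_sum.
by apply: eq_bigr => ab _; rewrite tfE_rk1.
Qed.

Lemma tfE_glmod (m' : 'I_n -> C) (k : nat) : glmod m E v ->
  (forall i, m' i = m i + ((i < k)%N)%:R) ->
  glmod m' tfE (rk1 v (gnd k)).
Proof.
move=> EV m'E; split.
- move=> i j a l u; rewrite !tfEE !linearD /= !fock_pw fock_comm.
  have -> : pw (E i j) (pw (E a l) u) = pw (E a l) (pw (E i j) u) +
      (j == a)%:R *: pw (E i l) u - (l == i)%:R *: pw (E a j) u.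
    by apply/ffunP => A; rewrite !ffunE (gl_comm EV).
  by rewrite [LHS](AC (4*(1*3)) (1*5*(4*6)*(2*7)*(3*8))).
- move=> i j ij; rewrite tfE_rk1 (gl_raise EV) // gnd_raise //.
  by apply/ffunP => A; rewrite !ffunE scaler0 scale0r addr0.
move=> i; rewrite tfE_rk1 (gl_diag EV) gnd_diag m'E.
by apply/ffunP => A; rewrite !ffunE !scalerA -scalerDl; congr (_ *: _); rewrite mulrDl [_ * m i]mulrC.
Qed.

Lemma tfE_herm : herm E h -> herm tfE (fun u z : V' => \sum_A h (u A) (z A)).
Proof.
move=> hE; split.
- move=> a u u' z; rewrite mulr_sumr -big_split /=; apply: eq_bigr => A _.
  by rewrite !ffunE (herm_linl hE).
- move=> a u z z'; rewrite mulr_sumr -big_split /=; apply: eq_bigr => A _.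
  by rewrite !ffunE (herm_linr hE).
- move=> i j u z; rewrite !tfEE.
  under eq_bigr do rewrite ffunE -[pw _ _ _]scale1r (herm_linl hE) mul1r.
  under [in RHS]eq_bigr do rewrite ffunE -[pw _ _ _]scale1r (herm_linr hE) conjC1 mul1r.
  rewrite !big_split /=; congr (_ + _).
    by apply: eq_bigr => A _; rewrite !ffunE (herm_adj hE).
  by rewrite /fockE /= (cre_adj _ _ _ hE) (ann_adj _ _ _ hE).
- by move=> u; apply: sumr_ge0 => A _; exact: herm_ge0 hE _.
move=> u /eqP; rewrite psumr_eq0; last by move=> A _; exact: herm_ge0 hE _.
move=> /allP u0; apply/ffunP => A; rewrite ffunE; apply: (herm_eq0 hE).
by apply/eqP; apply: u0; rewrite mem_index_enum.
Qed.

(** If [W] and [S] are the least words on which two matrix coefficients do not vanish, then by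
    [splits_lex] their sorted merge is the least one for the product of the coefficients. The
    weights are carried along because the monomial order compares them before the letters. *)
Lemma tfE_phi (W S : seq (posroot n)) (k : nat) A t :
  (forall w, phi (wact E w v) != 0 -> word_le W w /\ word_wt w = word_wt W) ->
  phi (wact E W v) != 0 ->
  (forall w, wact fockL w (gnd' k) A != 0 -> word_le S w /\ word_wt w = word_wt S) ->
  wact fockL S (gnd' k) A != 0 ->
  sorted root_le W -> sorted root_le S -> sorted root_le t -> perm_eq t (W ++ S) ->
  (forall w, phi (wact tfE w (rk1 v (gnd' k)) A) != 0 ->
     word_le t w /\ word_wt w = word_wt t) /\
  phi (wact tfE t (rk1 v (gnd' k)) A) != 0.
Proof.
move=> Wle W0 Sle S0 sW sS st pt.
have phiE w : phi (wact tfE w (rk1 v (gnd' k)) A) =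
    \sum_(ab <- splits w) (wact fockL ab.2 (gnd' k) A) * phi (wact E ab.1 v).
  rewrite tfE_wact sum_ffunE linear_sum; apply: eq_bigr => ab _.
  by rewrite ffunE linearZ.
have wtE w a b : (a, b) \in splits w -> word_wt w = (word_wt a + word_wt b)%N.
  by move=> /splits_perm wab; rewrite /word_wt (perm_big _ wab) big_cat.
have nz w ab : ab \in splits w ->
    (wact fockL ab.2 (gnd' k) A) * phi (wact E ab.1 v) != 0 ->
    (word_lex t w \/ [/\ w = t, ab.1 = W & ab.2 = S]) /\ word_wt w = word_wt t.
  case: ab => a b abw; rewrite mulf_eq0 negb_or => /andP[/Sle[Sb bw] /Wle[Wa aw]].
  split; first exact: splits_lex abw Wa Sb.
  by rewrite (wtE _ _ _ abw) aw bw /word_wt -big_cat (perm_big _ pt).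
split=> [w|].
  rewrite phiE => sum0.
  have /hasP[ab abw /nz -/(_ _ abw)[] tw ->] : has (fun ab =>
      (wact fockL ab.2 (gnd' k) A) * phi (wact E ab.1 v) != 0) (splits w).
    apply: contraNT sum0 => /hasPn z; rewrite big1_seq // => ab /z.
    by rewrite negbK => /eqP.
  by split=> //; rewrite /word_le; case: tw => [->|[-> _ _]]; rewrite ?eqxx ?orbT.
(* For the merged word itself only the splitting [(W, S)] contributes. It may occur several times,
   always with the same nonzero value, so in characteristic 0 the sum is nonzero. *)
rewrite phiE (bigID (fun ab => ab == (W, S))) /= [X in _ + X]big1_seq ?addr0.
  rewrite (eq_bigr (fun _ => wact fockL S (gnd' k) A * phi (wact E W v))); last first.
    by move=> ab /eqP ->.
  rewrite -big_filter big_const_seq count_predT iter_addr addr0 -mulr_natr.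
  rewrite !mulf_neq0 // pnatr_eq0 size_filter -lt0n -has_count.
  by apply/hasP; exists (W, S) => //; exact: splits_sorted_mem.
move=> ab /andP[abWS abt]; apply/eqP; apply: contraNT abWS => /nz -/(_ _ abt)[].
case=> [|[_ aW bS] _]; first by rewrite word_lex_irr.
by rewrite -aW -bS -surjective_pairing.
Qed.

End FockTensor.

(** The row lengths of the Young diagram with [la k] columns of height [k.+1]; as a weight of gl_n
    it restricts to [la] on sl_n. *)
Definition rows la (i : nat) : nat := \sum_(k < n.-1 | (i <= k)%N) la k.

Lemma rowsD la mu (i : nat) : rows (la + mu) i = (rows la i + rows mu i)%N.
Proof. by rewrite /rows -big_split; apply: eq_bigr => k _; rewrite [LHS]ffunE. Qed.

Lemma rows0 (i : nat) : rows 0 i = 0%N.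
Proof. by rewrite /rows big1 // => k _; rewrite ffunE. Qed.

Lemma rows_plwt (I : pluck n) (i : nat) : rows (plwt I) i = (i < size (val I))%N.
Proof.
have /andP[_ /andP[I0 In]] := valP I; rewrite /rows.
have kn : ((size (val I)).-1 < n.-1)%N.
  by rewrite -ltnS !prednK // (leq_ltn_trans _ In).
rewrite big_mkcond (bigD1 (Ordinal kn)) //= big1 ?addn0; last first.
  move=> k kI; rewrite ffunE; case: ifP => // _; apply/eqP; rewrite eqb0.
  by apply: contraNneq kI => kE; rewrite -val_eqE /= -kE.
by rewrite ffunE /= prednK // eqxx -ltnS prednK //; case: ifP.
Qed.

Definition wt_of (s : seq (pluck n)) : wt n := \sum_(I <- s) plwt I.
Definition exp_of (s : seq (pluck n)) : {ffun posroot n -> nat} := \sum_(I <- s) pluckT I.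

(** A certificate that the word of [T] is standard for [la]: an element that annihilates the highest
    weight vector also annihilates [v], and [phi] would detect a highest term at this word. *)
Definition has_model la T : Prop :=
  exists (V : lmodType C) (E : 'I_n -> 'I_n -> {linear V -> V}) (v : V)
    (h : V -> V -> C) (phi : {linear V -> C^o}),
  [/\ glmod (fun i => (rows la i)%:R) E v, herm E h,
      forall w, phi (wact E w v) != 0 ->
        word_le (tword T) w /\ word_wt w = word_wt (tword T)
    & phi (wact E (tword T) v) != 0].

Lemma has_model_of s : has_model (wt_of s) (exp_of s).
Proof.
elim: s => [|I s [V [E [v [h [phi [EV hE phile phi0]]]]]]].
  (* No column: the trivial representation on a line. Each further column tensors the model with a
     Fock space, read at the coordinate indexed by the entries of the column. *)
  rewrite /wt_of /exp_of !big_nil; pose E i j : {linear C^o -> C^o} := hom0.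
  exists C^o, E, 1, (fun x y => x * y^* ), idfun; split.
  - split=> //; first by move=> i j k l u; rewrite /E /= !scaler0 addr0 subrr.
    by move=> i; rewrite rows0 scale0r.
  - split=> [a u u' z|a u z z'|i j u z|u|u].
    + by rewrite mulrDl -mulrA.
    + by rewrite rmorphD rmorphM mulrDr /= mulrCA.
    + by rewrite /E /= mul0r conjC0 mulr0.
    + exact: mul_conjC_ge0.
    + by move/eqP; rewrite mul_conjC_eq0 => /eqP.
  - by rewrite tword0; case=> [|p w] /=; rewrite ?eqxx.
  by rewrite tword0 /= oner_eq0.
have kE : size (val I) = (0 + size (val I))%N by [].
have I0 : incr 0 (val I).
  by rewrite /incr; have /andP[-> _] := valP I; rewrite andbT; apply/allP.
have fock0 := colw_neq0 (C := C) I0 kE; have fockle := colw_le (C := C) I0 kE.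
rewrite -tword_pluckT in fock0 fockle.
have fockwt w : wact fockL w (gnd' (size (val I))) (colset 0 (val I)) != (0 : C) ->
   word_wt w = word_wt (tword (pluckT I)).
  move=> /gnd_wt wE; have := gnd_wt fock0; rewrite -wE => /addIn //.
pose k := size (val I); pose A := colset 0 (val I).
exists {ffun {set 'I_n} -> V}, (tfE E), (rk1 v (gnd' k)).
exists (fun u z : {ffun {set 'I_n} -> V} => \sum_A h (u A) (z A)), (phi \o ev A).
have [|||||tle t0] := @tfE_phi _ E v phi (tword (exp_of s)) (tword (pluckT I)) k A
  (tword (exp_of (I :: s))) phile phi0 _ fock0; try exact: sorted_tword.
- by move=> w w0; split; [exact: fockle | exact: fockwt].
- by apply/cnt_perm; rewrite cnt_cat !cnt_tword /exp_of big_cons addrC.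
split=> //; last exact: tfE_herm.
apply: tfE_glmod EV _ => i.
by rewrite /wt_of big_cons rowsD rows_plwt addnC natrD.
Qed.

End Models.

(** * Cutting words, and the Gelfand-Tsetlin inequalities *)

Section MoreWords.
Context {n : nat}.
Implicit Types (p q r : posroot n) (a b s t w : seq (posroot n)).

Lemma splits_catP s t a b : (a, b) \in splits (s ++ t) ->
  exists a1 b1 a2 b2, [/\ a = a1 ++ a2, b = b1 ++ b2,
    (a1, b1) \in splits s & (a2, b2) \in splits t].
Proof.
elim: s a b => [|p s IH] a b /= => [abt|].
  by exists [::], [::], a, b; rewrite inE eqxx.
case/splits_consP => -[c -> /IH[a1 [b1 [a2 [b2 [-> -> s1 t2]]]]]].
  exists (p :: a1), b1, a2, b2; split => //; rewrite mem_cat; apply/orP; left.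
  by apply/mapP; exists (a1, b1).
exists a1, (p :: b1), a2, b2; split => //; rewrite mem_cat; apply/orP; right.
by apply/mapP; exists (a1, b1).
Qed.

Lemma splits_self s : (s, [::]) \in splits s.
Proof.
elim: s => //= p s IH; rewrite mem_cat; apply/orP; left.
by apply/mapP; exists (s, [::]).
Qed.

Lemma splits_cat_swap s t : (t, s) \in splits (s ++ t).
Proof.
elim: s => [|p s IH] /=; first exact: splits_self.
rewrite mem_cat; apply/orP; right; by apply/mapP; exists (t, s).
Qed.

Lemma word_lex_cat s t a b : word_lex s t -> word_lex (s ++ a) (t ++ b).
Proof.
elim: s t => [|p s IH] [|q t] //= /orP[-> //|/andP[-> /IH ->]].
by rewrite orbT.
Qed.

Lemma word_le_all s t : size s = size t ->
  {in s & t, forall p q, root_le p q} -> word_le s t.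
Proof.
elim: s t => [|p s IH] [|q t] //= [st] le; rewrite word_le_cons.
have := le p q (mem_head _ _) (mem_head _ _); rewrite root_le_eqVlt.
case/orP=> [/eqP ->|-> //]; rewrite eqxx IH ?orbT // => x y xs yt.
by apply: le; rewrite inE ?xs ?yt orbT.
Qed.

Lemma word_wt_cat s t : word_wt (s ++ t) = (word_wt s + word_wt t)%N.
Proof. by rewrite /word_wt big_cat. Qed.

Lemma word_wt_perm s t : perm_eq s t -> word_wt s = word_wt t.
Proof. exact: perm_big. Qed.

Lemma sorted_filter_cat (P : pred (posroot n)) w : sorted root_le w ->
  (forall p q, root_le p q -> P q -> P p) -> w = filter P w ++ filter (predC P) w.
Proof.
move=> + dn; elim: w => //= p w IH; rewrite (path_sortedE root_le_trans).
case/andP=> /allP pw /IH {}IH; case: ifP => Pp /=; first by rewrite -IH.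
have nP : all (predC P) w.
  by apply/allP => q /pw pq /=; apply/negP => Pq; rewrite (dn _ _ pq Pq) in Pp.
rewrite (all_filterP nP) (_ : filter P w = [::]) //; apply/eqP.
by rewrite -size_eq0 size_filter -leqn0 leqNgt -has_count -all_predC.
Qed.

Lemma count_cnt (P : pred (posroot n)) w : count P w = (\sum_(p | P p) cnt w p)%N.
Proof.
elim: w => [|q w IH] /=; first by rewrite big1 // => p _; rewrite ffunE.
rewrite IH big_mkcond [RHS]big_mkcond (bigD1 q) //= [in RHS](bigD1 q) //= !ffunE /= eqxx.
rewrite (eq_bigr (fun p => if P p then cnt (q :: w) p else 0%N)); last first.
  by move=> p pq; rewrite !ffunE /= eq_sym (negPf pq).
by case: (P q); rewrite ?ffunE addnA.
Qed.

(* The number of entries at least [j] in row [l] of the tableau encoded by [T],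
   for [l < j]. *)
Definition rowsum (T : {ffun posroot n -> nat}) (l j : nat) : nat :=
  (\sum_(p : posroot n | ((val p).1 == l :> nat) && (j <= (val p).2)) T p)%N.

(** Row [l] has [rows la l] entries in all, those on the diagonal value [l] included. So the
    condition says that row [l.+1] has at most as many entries up to [j] as row [l] has below [j]:
    columns increase strictly. This is one half of the interlacing inequalities, the other half
    being that [T] is nonnegative; sums replace differences because subtraction in [nat]
    truncates. *)
Definition GT (la : wt n) (T : {ffun posroot n -> nat}) : Prop :=
  forall l j : nat, (l < j < n)%N ->
  (rowsum T l j + rows la l.+1 <= rows la l + rowsum T l.+1 j.+1)%N.

End MoreWords.
(** * Upper bound for the standard words *)

Section Reduction.
Context {F : fieldType} {n : nat} (V : vectType F) (m : 'I_n -> F).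
Context (E : 'I_n -> 'I_n -> {linear V -> V}) (v : V).
Hypothesis F0 : [pchar F] =i pred0.
Hypothesis EV : glmod m E v.
Implicit Types (p q r : posroot n) (w s t W : seq (posroot n)) (u z : V).

Definition low W u : Prop :=
  exists2 x : freealg F n, fact E v x = u &
    forall w : {fmonom posroot n}, x@_w != 0 -> word_lt w W.

Definition red W : Prop := low W (wact E W v).

Lemma low0 W : low W 0.
Proof. by exists 0; rewrite ?raddf0 // => w; rewrite mcoeff0 eqxx. Qed.

Lemma low_lin W a u u' : low W u -> low W u' -> low W (a *: u + u').
Proof.
move=> [x <- xW] [y <- yW]; exists (a *: x + y); first by rewrite factD factZ.
move=> w; rewrite mcoeffD mcoeffZ => xyw.
have [xw|/xW //] := eqVneq x@_w 0; apply: yW.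
by move: xyw; rewrite xw mulr0 add0r.
Qed.

Lemma low_sum W (I : Type) (r : seq I) (P : pred I) (f : I -> V) :
  (forall i, P i -> low W (f i)) -> low W (\sum_(i <- r | P i) f i).
Proof.
move=> fW; elim/big_rec: _ => [|i u Pi uW]; first exact: low0.
by rewrite -[f i]scale1r; apply: low_lin => //; exact: fW.
Qed.

Lemma low_word W w : word_lt w W -> low W (wact E w v).
Proof.
move=> wW; exists << FMonom w >>; first by rewrite factU.
by move=> w'; rewrite mcoeffU1; have [<- //|_] := eqVneq (FMonom w) w'; rewrite eqxx.
Qed.

Lemma low_cat s W u : low W u -> low (s ++ W) (wact E s u).
Proof.
move=> [x <- xW]; exists (<< FMonom s >> * x).
  by rewrite fact_wordM.
move=> w; rewrite mcoeff_neq0 => /msuppM_le[k1 [k2 [+ k2x ->]]].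
rewrite msuppU1 inE => /eqP ->; rewrite fmM word_lt_cat2l.
by apply: xW; rewrite mcoeff_neq0.
Qed.

(** Only prefixes may be added: a suffix would replace the singular vector by another vector. *)
Lemma red_cat s W : red W -> red (s ++ W).
Proof. by rewrite /red wact_cat; exact: low_cat. Qed.

Lemma word_lt_lex s t : word_wt s = word_wt t -> word_lex s t -> word_lt s t.
Proof. by rewrite /word_lt => -> ->; rewrite eqxx orbT. Qed.

Definition mkroot (i j : 'I_n) (ij : (i < j)%N) : posroot n := exist _ (i, j) ij.

(** The commutator of the two letters is zero or the single letter from [(val q).1] to [(val p).2].
    That letter has the total length of [p] and [q] and lies in a row before that of [p], so its
    word is smaller as well. *)
Lemma red_swap p q t : root_lt q p -> red (p :: q :: t).
Proof.
move=> qp; have pl := posroot_lt p; have ql := posroot_lt q.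
have row := root_lt_row qp.
rewrite /red /= (gl_comm EV).
have -> : (val q).1 == (val p).2 = false.
  by apply/negP => /eqP E1; move: row; rewrite E1 leqNgt pl.
have qpW : low [:: p, q & t] (E (val q).2 (val q).1 (E (val p).2 (val p).1 (wact E t v))).
  rewrite -[E _ _ _]/(wact E (q :: p :: t) v); apply: low_word.
  by rewrite /word_lt /word_wt !big_cons addnCA ltnn eqxx /= qp.
rewrite scale0r subr0 addrC.
have [E1|_] := eqVneq (val p).1 (val q).2; last by rewrite scale0r add0r.
apply: low_lin => //.
have rl : ((val q).1 < (val p).2)%N.
  by apply: ltn_trans ql _; rewrite -E1.
rewrite -[E _ _ _]/(wact E (mkroot rl :: t) v); apply: low_word.
have lt1 : root_lt (mkroot rl) p by rewrite /root_lt /= E1 ql.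
apply: word_lt_lex; last by rewrite /= lt1.
rewrite /word_wt !big_cons addnA; congr (_ + _)%N.
by rewrite /= E1 addnBA ?subnK // ltnW // -E1.
Qed.

Lemma red_unsorted W : ~~ sorted root_le W -> red W.
Proof.
elim: W => // p [|q t] IH //=; rewrite negb_and => /orP[pq|qt].
  by apply: red_swap; rewrite root_ltNle.
by rewrite -cat1s; apply: red_cat; exact: IH.
Qed.

Lemma wact_perm_row (i : 'I_n) s t u : all (fun p : posroot n => (val p).1 == i) s ->
  perm_eq s t -> wact E s u = wact E t u.
Proof.
have comm p q z : (val p).1 == i -> (val q).1 == i ->
    E (val p).2 (val p).1 (E (val q).2 (val q).1 z) =
    E (val q).2 (val q).1 (E (val p).2 (val p).1 z).
  move=> /eqP pi /eqP qi; rewrite (gl_comm EV) pi qi.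
  have -> : i == (val q).2 = false.
    by apply/negP => /eqP iq; have := posroot_lt q; rewrite qi -iq ltnn.
  have -> : i == (val p).2 = false.
    by apply/negP => /eqP ip; have := posroot_lt p; rewrite pi -ip ltnn.
  by rewrite !scale0r subr0 addr0.
have move_front p s1 s2 : (val p).1 == i -> all (fun p : posroot n => (val p).1 == i) s1 ->
    wact E (s1 ++ p :: s2) u = wact E (p :: s1 ++ s2) u.
  move=> pi; elim: s1 => //= q s1 IH /andP[qi /IH ->].
  by rewrite /= comm.
elim: s t => [|p s IH] t /= => [_|/andP[pi si] pst].
  by rewrite perm_sym => /perm_nilP ->.
have pt : p \in t by rewrite -(perm_mem pst) mem_head.
case/splitPr: pt pst => t1 t2.
rewrite perm_sym -(cat1s p t2) perm_catCA /= perm_cons perm_sym => pst.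
rewrite move_front //; first by rewrite /= (IH _ si pst).
have : all (fun p : posroot n => (val p).1 == i) (t1 ++ t2) by rewrite -(perm_all _ pst).
by rewrite all_cat => /andP[].
Qed.

Lemma eqr_nat0 (a b : nat) : (a%:R == b%:R :> F) = (a == b).
Proof.
wlog ab : a b / (a <= b)%N => [W|].
  by have [/W//|/ltnW/W] := leqP a b; rewrite eq_sym => ->; rewrite eq_sym.
by rewrite eq_sym -subr_eq0 -natrB // (pcharf0P _).1 // subn_eq0 eqn_leq ab.
Qed.

Section SL2.
Variables (i j : 'I_n) (z : V) (a : nat).
Hypotheses (ij : i != j) (zE : E i j z = 0) (zH : E i i z - E j j z = a%:R *: z).

Lemma sl2_weight k :
  E i i (iter k (E j i) z) - E j j (iter k (E j i) z) =
  (a%:R - k%:R - k%:R) *: iter k (E j i) z.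
Proof.
elim: k => [|k IH]; first by rewrite !subr0.
rewrite iterS (gl_comm EV i i j i) (gl_comm EV j j j i) !eqxx !(negPf ij) !scale0r !scale1r.
rewrite addr0 subr0 opprD addrA [X in X - _ = _]addrAC -linearB IH linearZ /=.
rewrite -!scaleN1r -!scalerDl; congr (_ *: _); rewrite -natr1; ring.
Qed.

Lemma sl2_raise k :
  E i j (iter k.+1 (E j i) z) = (k.+1%:R * (a%:R - k%:R)) *: iter k (E j i) z.
Proof.
elim: k => [|k IH].
  by rewrite /= (gl_comm EV) zE linear0 !eqxx !scale1r add0r zH subr0 mul1r.
rewrite iterS (gl_comm EV) IH !eqxx !scale1r -addrA (sl2_weight k.+1).
rewrite linearZ -[E j i (iter k (E j i) z)]/(iter k.+1 (E j i) z) -scalerDl.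
by congr (_ *: _); rewrite -!natr1; ring.
Qed.

(** In finite dimension the vectors [iter k (E j i) z], of pairwise distinct weights, cannot all be
    nonzero. At the first power that vanishes, applying [E i j] gives by [sl2_raise] a multiple of
    the nonzero preceding vector, and the factor is zero only if that power is [a.+1]. *)
Lemma sl2_nilpotent k : (a < k)%N -> iter k (E j i) z = 0.
Proof.
pose h : {linear V -> V} := homD (E i i) (homN (E j j)).
have [d dz] : exists d, iter d (E j i) z = 0.
  apply: contrapT => nz; have {}nz d : iter d (E j i) z != 0.
    by apply/eqP => d0; apply: nz; exists d.
  pose X := [tuple iter k (E j i) z | k < (\dim {:V}).+1].
  have : ~~ free X.
    apply/negP => /eqP Xf; have := dimvS (subvf <<X>>%VS).
    by rewrite Xf size_tuple ltnn.
  move=> /negP[]; apply/freeP => c c0 k1.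
  pose f (k : 'I_(\dim {:V}).+1) := c k *: X`_k.
  have hf (k2 : 'I_(\dim {:V}).+1) : h (f k2) = (a%:R - k2%:R - k2%:R) *: f k2.
    rewrite /f linearZ /= (nth_mktuple (fun k : 'I__ => iter k (E j i) z) 0 k2).
    by rewrite sl2_weight !scalerA mulrC.
  have := @eigen_sum F V h _ _ f _ (a%:R - k1%:R - k1%:R) (fun k2 _ => hf k2) c0.
  rewrite (eq_bigl (pred1 k1)) ?big_pred1_eq.
    move=> /eqP; rewrite /f scaler_eq0 => /orP[/eqP //|].
    by rewrite (nth_mktuple (fun k : 'I__ => iter k (E j i) z) 0 k1) (negPf (nz _)).
  move=> k2 /=; rewrite -!addrA (inj_eq (addrI _)) -!opprD eqr_opp -!natrD.
  by rewrite eqr_nat0 -val_eqE /= !addnn -!muln2 eqn_mul2r.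
have {d dz} [d dz dmin] : exists2 d, iter d (E j i) z = 0 &
    forall k, (k < d)%N -> iter k (E j i) z != 0.
  have ex : exists d, iter d (E j i) z == 0 by exists d; rewrite dz.
  exists (ex_minn ex); case: ex_minnP => d' /eqP // _ dmin k' k'd.
  by apply: contraTneq k'd => /eqP/dmin; rewrite -leqNgt.
move=> ak; suff da : (d <= k)%N.
  by rewrite -(subnK da) iterD dz; elim: (k - d)%N => //= y ->; rewrite linear0.
case: d dz dmin => // d dz dmin; have := sl2_raise d.
rewrite dz linear0 => /esym/eqP; rewrite scaler_eq0 (negPf (dmin _ _)) // orbF.
by rewrite mulf_eq0 (pcharf0P _).1 //= subr_eq0 eqr_nat0 => /eqP <-.
Qed.
End SL2.

Section Rows.
Variables (i0 i1 : 'I_n) (i01 : i1 = i0.+1 :> nat).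

Lemma lt01 : (i0 < i1)%N. Proof. by rewrite i01. Qed.

Definition root01 : posroot n := mkroot lt01.
(** [up] and [down] move a letter between the two adjacent rows with the second index fixed. The
    default values are not reached for letters of row [i1], and for letters of row [i0] other than
    [root01]. *)
Definition up r : posroot n := insubd root01 (i0, (val r).2).
Definition down r : posroot n := insubd r (i1, (val r).2).

Definition in_row (i : 'I_n) := [pred p : posroot n | (val p).1 == i].

Lemma val_up r : in_row i1 r -> val (up r) = (i0, (val r).2).
Proof.
move=> /eqP r1; rewrite val_insubd /= ifT //.
by have := posroot_lt r; rewrite r1; apply: ltn_trans lt01.
Qed.

Lemma upK r : in_row i1 r -> down (up r) = r.
Proof.
move=> r1; apply: val_inj; rewrite val_insubd val_up //= -(eqP r1) posroot_lt.
by rewrite [RHS]surjective_pairing.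
Qed.

Lemma row0_lt r : in_row i0 r -> r != root01 -> (i1 < (val r).2)%N.
Proof.
move=> /eqP r1; rewrite posroot_eqE /= r1 eqxx /= => r2.
by have := posroot_lt r; rewrite r1 -ltnS -i01 ltnS leq_eqVlt eq_sym (negPf r2).
Qed.

Lemma val_down r : in_row i0 r -> r != root01 -> val (down r) = (i1, (val r).2).
Proof. by move=> r1 r2; rewrite val_insubd /= row0_lt. Qed.

Lemma downK r : in_row i0 r -> r != root01 -> up (down r) = r.
Proof.
move=> r1 r2; have dr : in_row i1 (down r) by rewrite /in_row /= val_down.
apply: val_inj; rewrite (val_up dr) val_down //=.
by rewrite -(eqP r1) [RHS]surjective_pairing.
Qed.

Lemma wact_nseq01 k u : wact E (nseq k root01) u = iter k (E i1 i0) u.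
Proof. by elim: k => //= k ->. Qed.

(** The commutator of a letter [r] of row [i1] with [E i1 i0] is the letter [up r], which commutes
    with [E i1 i0] and with all letters of both rows involved. So each letter of [beta] either
    passes the power or absorbs one factor of it, and the falling factorial counts the ways to do
    so. *)
Lemma expand_row beta N z : all (in_row i1) beta ->
  wact E beta (iter N (E i1 i0) z) =
  \sum_(ab <- splits beta) (N ^_ size ab.1)%:R *:
     wact E (map up ab.1) (iter (N - size ab.1) (E i1 i0) (wact E ab.2 z)).
Proof.
have ne01 : i0 == i1 = false by rewrite -val_eqE /= i01; lia.
have neq_row q : in_row i1 q -> (i0 == (val q).2 = false) * (i1 == (val q).2 = false).
  move=> /eqP q1; have := posroot_lt q; rewrite q1 => q2; split.
    by apply/negP => /eqP iq; have := ltn_trans lt01 q2; rewrite -iq ltnn.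
  by apply/negP => /eqP iq; rewrite -iq ltnn in q2.
have comm_up r a u : in_row i1 r -> all (in_row i1) a ->
    E (val r).2 i1 (wact E (map up a) u) = wact E (map up a) (E (val r).2 i1 u).
  move=> r1; elim: a => //= q a IH /andP[q1 a1]; rewrite val_up //=.
  by rewrite (gl_comm EV) !neq_row // !scale0r subr0 addr0 IH.
have comm_f r k u : in_row i1 r ->
    E (val r).2 i0 (iter k (E i1 i0) u) = iter k (E i1 i0) (E (val r).2 i0 u).
  move=> r1; elim: k => //= k IH.
  by rewrite (gl_comm EV) ne01 neq_row // !scale0r subr0 addr0 IH.
have comm_iter r k u : in_row i1 r -> E (val r).2 i1 (iter k (E i1 i0) u) =
    iter k (E i1 i0) (E (val r).2 i1 u) +
    k%:R *: iter k.-1 (E i1 i0) (E (val r).2 i0 u).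
  move=> r1; elim: k => [|k IH] /=; first by rewrite scale0r addr0.
  rewrite (gl_comm EV) eqxx neq_row // scale0r subr0 scale1r IH linearD linearZ /=.
  rewrite comm_f // -addrA -natr1 scalerDl scale1r; congr (_ + (_ + _)).
  by case: k {IH} => [|k] //=; rewrite !scale0r.
have comm_up0 r a u : in_row i1 r -> all (in_row i1) a ->
    E (val r).2 i0 (wact E (map up a) u) = wact E (map up a) (E (val r).2 i0 u).
  move=> r1; elim: a => //= q a IH /andP[q1 a1]; rewrite val_up //=.
  by rewrite (gl_comm EV) !neq_row // !scale0r subr0 addr0 IH.
elim: beta => [|r beta IH]; first by rewrite big_seq1 /= subn0 ffactn0 scale1r.
move=> /= /andP[r1 beta1]; rewrite (IH beta1) big_splits_cons (eqP r1) linear_sum.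
rewrite big_seq [RHS]big_seq; apply: eq_bigr => -[a b] ab /=.
have a1 : all (in_row i1) a.
  by apply/allP => x xa; apply: (allP beta1); have [/mem_subseq + _] := splits_subseq ab; apply.
rewrite linearZ /= comm_up // comm_iter // linearD linearZ /= scalerDr scalerA addrC.
rewrite val_up //= -natrM -ffactnSr; congr (_ + _); first by rewrite (eqP r1).
by rewrite comm_up0 // comm_f // subnS.
Qed.

Lemma root01_neq_up r : in_row i1 r -> up r != root01.
Proof.
move=> r1; rewrite posroot_eqE val_up //= eqxx /=.
by have := posroot_lt r; rewrite (eqP r1) neq_ltn orbC => ->.
Qed.

Lemma word_wt_up a : all (in_row i1) a -> word_wt (map up a) = (word_wt a + size a)%N.
Proof.
elim: a => [|r a IH] /=; first by rewrite /word_wt !big_nil.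
move=> /andP[r1 a1]; rewrite /word_wt !big_cons -!/(word_wt _) IH // val_up //= (eqP r1).
have := posroot_lt r; rewrite (eqP r1) i01 => r2.
by rewrite -(subnSK (ltnW r2)) addSn addnS addnA.
Qed.

Lemma raise_word w : all (fun p : posroot n => i1 <= (val p).1)%N w ->
  E i0 i1 (wact E w v) = 0.
Proof.
elim: w => [|p w IH] /=; first by rewrite (gl_raise EV) // lt01.
move=> /andP[p1 /IH {}IH]; rewrite (gl_comm EV) IH linear0 add0r.
have -> : i1 == (val p).2 = false.
  by apply/negP => /eqP ip; have := posroot_lt p; rewrite -ip ltnNge p1.
have -> : (val p).1 == i0 = false.
  by apply/negP => /eqP ip; move: p1; rewrite ip leqNgt lt01.
by rewrite !scale0r subr0.
Qed.

Lemma coroot_word s y (a0 : nat) : all (in_row i1) s ->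
  all (fun p : posroot n => i1 < (val p).1)%N y -> m i0 - m i1 = a0%:R ->
  E i0 i0 (wact E (s ++ y) v) - E i1 i1 (wact E (s ++ y) v) =
  (a0 + size s)%:R *: wact E (s ++ y) v.
Proof.
move=> s1 y1 ma; rewrite !(gl_diag_word EV) -scalerBl; congr (_ *: _).
have sum0 (P : pred (posroot n)) w : all (predC P) w -> (\sum_(p <- w) P p = 0)%N.
  by elim: w => [|p w IH] /=; rewrite ?big_nil // big_cons => /andP[/negPf -> /IH].
have i0col : (\sum_(p <- s ++ y) (i0 == (val p).2 :> nat) = 0)%N.
  apply: sum0; rewrite all_cat; apply/andP; split; apply/allP => p.
    move=> /(allP s1)/eqP p1 /=; have := posroot_lt p; rewrite p1 i01 => p2.
    by rewrite neq_ltn (ltn_trans _ p2).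
  move=> /(allP y1) p1 /=; have p2 := posroot_lt p.
  by rewrite neq_ltn (ltn_trans (ltn_trans lt01 p1) p2).
have i0row : (\sum_(p <- s ++ y) (i0 == (val p).1 :> nat) = 0)%N.
  apply: sum0; rewrite all_cat; apply/andP; split; apply/allP => p.
    by move=> /(allP s1)/eqP p1 /=; rewrite p1 neq_ltn lt01.
  by move=> /(allP y1) p1 /=; rewrite neq_ltn (ltn_trans lt01).
have i1col : (\sum_(p <- s ++ y) (i1 == (val p).2 :> nat) = 0)%N.
  apply: sum0; rewrite all_cat; apply/andP; split; apply/allP => p.
    by move=> /(allP s1)/eqP p1 /=; have := posroot_lt p; rewrite p1 neq_ltn => ->.
  move=> /(allP y1) p1 /=; have p2 := posroot_lt p.
  by rewrite neq_ltn (ltn_trans p1 p2).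
have i1row : (\sum_(p <- s ++ y) (i1 == (val p).1 :> nat) = size s)%N.
  rewrite big_cat /= [X in (_ + X)%N]sum0 ?addn0; last first.
    by apply/allP => p /(allP y1) p1 /=; rewrite neq_ltn p1.
  by elim: s s1 {i0col i0row i1col} => [|p s IH] /=; rewrite ?big_nil // big_cons => /andP[/eqP -> /IH ->]; rewrite eqxx.
rewrite i0col i0row i1col i1row !subr0 !addr0 natrD -ma; ring.
Qed.

(** Put [N = size tL]. The letters [sH] of [sR] beyond [j] are left on [y]; the vector [z] so
    obtained is killed by [E i0 i1] and has sl_2-weight less than [N], so [E i1 i0] to the power [N]
    kills it. To this relation apply the remaining letters [sLw] of [sR] and the letters of [tL]
    other than [root01], moved down to row [i1]. In the expansion, returning exactly the latter to
    row [i0] gives the word in question; every other term is smaller or equal to it. *)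
Lemma red_rows (j : nat) tL sR y (a0 : nat) : (i0 < j)%N ->
  all (in_row i0) tL -> all (fun p : posroot n => j <= (val p).2)%N tL ->
  all (in_row i1) sR -> all (fun p : posroot n => i1 < (val p).1)%N y ->
  sorted root_le tL -> sorted root_le sR ->
  m i0 - m i1 = a0%:R ->
  (a0 + count (fun p : posroot n => j < (val p).2)%N sR < size tL)%N ->
  red (tL ++ sR ++ y).
Proof.
move=> i0j tL0 tLj sR1 y1 stL ssR ma; rewrite -size_filter.
set sH := filter _ sR => aN.
pose sLw := filter (predC (fun p : posroot n => j < (val p).2)%N) sR.
have sRE : perm_eq (sLw ++ sH) sR by rewrite perm_catC perm_filterC.
have sLw1 : all (in_row i1) sLw.
  by apply/allP => p; rewrite mem_filter => /andP[_ /(allP sR1)].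
have sH1 : all (in_row i1) sH.
  by apply/allP => p; rewrite mem_filter => /andP[_ /(allP sR1)].
pose z := wact E (sH ++ y) v; pose N := size tL; pose f := E i1 i0.
have fN : iter N f z = 0.
  apply: sl2_nilpotent aN.
  - by rewrite neq_ltn lt01.
  - apply: raise_word; rewrite all_cat; apply/andP; split; apply/allP => p.
      by move/(allP sH1)/eqP => ->.
    by move/(allP y1)/ltnW.
  exact: coroot_word.
pose tL' := filter (predC1 root01) tL.
have tL'0 : {in tL', forall p, in_row i0 p /\ p != root01}.
  by move=> p; rewrite mem_filter /= => /andP[-> /(allP tL0)].
have updown : map up (map down tL') = tL'.
  rewrite -map_comp -[RHS]map_id; apply/eq_in_map => p /tL'0[p0 p1] /=.
  exact: downK.
have dn1 : all (in_row i1) (map down tL').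
  apply/allP => _ /mapP[p /tL'0[p0 p1] ->].
  by rewrite /in_row /= val_down.
have tLE : perm_eq tL (nseq (N - size tL') root01 ++ tL').
  have -> : nseq (N - size tL') root01 = filter (pred1 root01) tL.
    have -> : (N - size tL' = size (filter (pred1 root01) tL))%N.
      by rewrite /N !size_filter -(count_predC (pred1 root01) tL) addnK.
    apply/esym/all_pred1P; exact: filter_all.
  by rewrite perm_sym perm_filterC.
pose beta := sLw ++ map down tL'.
have beta1 : all (in_row i1) beta by rewrite all_cat sLw1.
have sum0 : \sum_(ab <- splits beta) (N ^_ size ab.1)%:R *:
    wact E (map up ab.1) (iter (N - size ab.1) f (wact E ab.2 z)) = 0.
  by rewrite -expand_row // fN linear0.
(* The parts of the term [(a, b)] in the rows [i0] and [i1], put in order; letters of one row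
   commute, so the vector does not change. *)
pose Ra (a : seq (posroot n)) := sort root_le (map up a ++ nseq (N - size a) root01).
pose Sb (b : seq (posroot n)) := sort root_le (b ++ sH).
have Rap a : perm_eq (map up a ++ nseq (N - size a) root01) (Ra a).
  by rewrite perm_sym perm_sort.
have Sbp b : perm_eq (b ++ sH) (Sb b) by rewrite perm_sym perm_sort.
have abrow a b : (a, b) \in splits beta -> all (in_row i1) a /\ all (in_row i1) b.
  move=> /splits_subseq[/mem_subseq sa /mem_subseq sb].
  by split; apply/allP => p; [move/sa|move/sb] => /(allP beta1).
have XE a b : (a, b) \in splits beta ->
    wact E (map up a) (iter (N - size a) f (wact E b z)) = wact E (Ra a ++ Sb b ++ y) v.
  case/abrow=> a1 b1; rewrite !wact_cat -(wact_nseq01 (N - size a)) -wact_cat.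
  rewrite /z (wact_cat E sH) -(wact_cat E b sH).
  rewrite (wact_perm_row (i := i1) _ _ (Sbp b)); last by rewrite all_cat b1.
  rewrite (wact_perm_row (i := i0) _ _ (Rap a)) // all_cat; apply/andP; split.
    by apply/allP => _ /mapP[q /(allP a1) q1 ->]; rewrite /= val_up.
  by apply/allP => q; rewrite mem_nseq => /andP[_ /eqP ->] /=.
have tN : (size tL' <= N)%N by rewrite size_filter count_size.
have key a b : (a, b) \in splits beta -> (size a <= N)%N ->
    word_lt (Ra a ++ Sb b ++ y) (tL ++ sR ++ y) \/ Ra a ++ Sb b ++ y = tL ++ sR ++ y.
  move=> ab aN'; have [a1 b1] := abrow _ _ ab.
  have wtE : word_wt (Ra a ++ Sb b ++ y) = word_wt (tL ++ sR ++ y).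
    rewrite !word_wt_cat -(word_wt_perm (Rap a)) -(word_wt_perm (Sbp b)).
    rewrite (word_wt_perm tLE) -(word_wt_perm sRE) !word_wt_cat word_wt_up //.
    have ns k : word_wt (nseq k root01) = k.
      elim: k => [|k IH]; first by rewrite /word_wt big_nil.
      by rewrite /= /word_wt big_cons -/(word_wt _) IH /= i01 subSnn.
    rewrite !ns -{2}updown word_wt_up // size_map.
    have := word_wt_perm (splits_perm ab); rewrite !word_wt_cat.
    move: (word_wt _) (word_wt _) (word_wt _) (word_wt _) (word_wt _) (word_wt _).
    by move: aN' tN; move: (size a) (size tL') (N); clear; lia.
  have [a1' [b1' [a2 [b2 [aE bE s1 s2]]]]] := splits_catP ab.
  (* Against [tL], the term keeps [sub] and has [lo] in the place of [D]. The two have the same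
     size; the letters of [lo] have second index at most [j], those of [D] at least [j]. *)
  pose lo := map up a1' ++ nseq (N - size a) root01.
  pose D := sort root_le (nseq (N - size tL') root01 ++ map up b2).
  pose sub := sort root_le (map up a2).
  have pD : perm_eq tL (D ++ sub).
    rewrite (perm_trans tLE) //.
    have pab : perm_eq tL' (map up b2 ++ map up a2).
      by rewrite -map_cat -{1}updown; apply: perm_map; rewrite (perm_trans (splits_perm s2)) // perm_catC.
    rewrite (perm_trans (perm_cat (perm_refl _) pab)) // catA.
    by apply: perm_cat; rewrite perm_sym perm_sort.
  have szD : size lo = size D.
    have := perm_size pD; rewrite -/N size_cat [size sub]size_sort size_map.
    rewrite /lo size_cat size_map size_nseq; move: aN'; rewrite aE size_cat.
    by move: (size a1') (size a2) (size D) (N); clear; lia.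
  have leD : word_le lo D.
    apply: word_le_all => // p q pl qD.
    have qL : q \in tL by rewrite (perm_mem pD) mem_cat qD.
    have q2 := allP tLj _ qL; have /eqP q1 := allP tL0 _ qL.
    suff [p1 p2] : (val p).1 = i0 /\ ((val p).2 <= j)%N.
      rewrite -[root_le p q]negbK -root_ltNle /root_lt p1 q1 ltnn eqxx /= -leqNgt.
      exact: leq_trans q2.
    move: pl; rewrite mem_cat => /orP[/mapP[r ra ->]|].
      have rL : r \in sLw by have [/mem_subseq + _] := splits_subseq s1; apply.
      rewrite val_up; last exact: (allP sLw1).
      by split=> //=; move: rL; rewrite mem_filter /= -leqNgt => /andP[].
    by rewrite mem_nseq => /andP[_ /eqP ->] /=; rewrite i01.
  have pR : perm_eq (Ra a) (lo ++ sub).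
    rewrite perm_sym (perm_trans _ (Rap a)) // aE map_cat -!catA perm_cat2l.
    rewrite -aE; apply/cnt_perm; rewrite !cnt_cat addrC; congr (_ + _).
    by apply/cnt_perm; rewrite perm_sort.
  have Dsub : (D, sub) \in splits tL.
    by apply: splits_sorted_mem => //; exact: sort_sorted root_le_total _.
  have subr : word_le sub sub by rewrite /word_le eqxx.
  have [|tLR] := splits_lex (sort_sorted root_le_total _) pR Dsub leD subr.
    by move=> lx; left; apply: word_lt_lex => //; exact: word_lex_cat.
  have tLRa : tL = Ra a by case: tLR.
  right; rewrite -tLRa; congr (_ ++ (_ ++ _)).
  apply: (sorted_eq root_le_trans root_le_anti (sort_sorted root_le_total _) ssR).
  rewrite perm_sort; apply: perm_trans sRE; rewrite perm_cat2r.
  have pa : perm_eq (map down tL') a.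
    have pL : perm_eq tL (map up a ++ nseq (N - size a) root01).
      by rewrite tLRa perm_sym Rap.
    have /(perm_map down) : perm_eq tL' (map up a).
      rewrite (perm_trans (perm_filter _ pL)) // filter_cat.
      rewrite [X in _ ++ X](_ : _ = [::]) ?cats0; last first.
        by apply/eqP; rewrite -size_eq0 size_filter count_nseq /= eqxx.
      rewrite (_ : filter _ _ = map up a) //; apply/all_filterP/allP => _ /mapP[q /(allP a1) q1 ->].
      exact: root01_neq_up.
    rewrite -map_comp (_ : map _ a = a) // -[RHS]map_id.
    by apply/eq_in_map => q /(allP a1) /upK.
  have := splits_perm ab; rewrite /beta perm_sym => bp.
  have : perm_eq (a ++ b) (a ++ sLw).
    by rewrite (perm_trans bp) // perm_catC perm_cat2r.
  by rewrite perm_cat2l.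
pose X (ab : seq (posroot n) * seq (posroot n)) :=
  wact E (Ra ab.1 ++ Sb ab.2 ++ y) v.
pose P (ab : seq (posroot n) * seq (posroot n)) := (size ab.1 <= N)%N &&
  (Ra ab.1 ++ Sb ab.2 ++ y == tL ++ sR ++ y).
have {}sum0 : \sum_(ab <- splits beta) (N ^_ size ab.1)%:R *: X ab = 0.
  by rewrite -[RHS]sum0 big_seq [RHS]big_seq; apply: eq_bigr => -[a b] /XE ->.
(* Several splittings may give the word itself. Their coefficients are natural numbers and one of
   them is positive, so they cannot cancel. *)
pose K := (\sum_(ab <- splits beta | P ab) N ^_ size ab.1)%N.
have PT : P (map down tL', sLw).
  rewrite /P size_map tN /=; apply/eqP; congr (_ ++ (_ ++ _)).
    apply: (sorted_eq root_le_trans root_le_anti (sort_sorted root_le_total _) stL).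
    by rewrite perm_sort updown size_map perm_catC perm_sym.
  apply: (sorted_eq root_le_trans root_le_anti (sort_sorted root_le_total _) ssR).
  by rewrite perm_sort.
have K0 : K%:R != 0 :> F.
  rewrite (pcharf0P _).1 // /K (big_rem _ (splits_cat_swap sLw (map down tL'))) /=.
  by rewrite PT size_map addn_eq0 negb_and -lt0n ffact_gt0 tN.
have lowS : low (tL ++ sR ++ y) (\sum_(ab <- splits beta | ~~ P ab) (N ^_ size ab.1)%:R *: X ab).
  rewrite big_seq_cond; apply: low_sum => -[a b] /andP[ab]; rewrite negb_and /=.
  (* If [a] has more than [N] letters, the exponent [N - size a] is truncated, but the falling
     factorial vanishes. *)
  have [aN'|aN' _] := leqP (size a) N; last first.
    by rewrite ffact_small // scale0r; exact: low0.
  move=> /= ne; rewrite -[_ *: _]addr0; apply: low_lin; last exact: low0.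
  by apply: low_word; have [//|E1] := key _ _ ab aN'; rewrite E1 eqxx in ne.
move: sum0; rewrite (bigID P) /= (eq_bigr (fun ab => (N ^_ size ab.1)%:R *: wact E (tL ++ sR ++ y) v)); last first.
  by move=> ab /andP[_ /eqP abE]; rewrite /X abE.
rewrite -scaler_suml -natr_sum -/K => /eqP; rewrite addr_eq0 => /eqP KE.
rewrite /red -[wact E _ v]scale1r -(mulVf K0) -scalerA KE scalerN -scaleNr.
by rewrite -[_ *: _]addr0; apply: low_lin => //; exact: low0.
Qed.

End Rows.

Lemma rows_succ (la : wt n) (l : 'I_n.-1) : rows la l = (la l + rows la l.+1)%N.
Proof.
rewrite /rows (bigD1 l) //=; congr (_ + _)%N; apply: eq_bigl => k.
by rewrite ltn_neqAle andbC -val_eqE eq_sym.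
Qed.

(** The sorted word is cut before the place of the letter from [l] to [j], and [red_cat] restores
    the prefix. The remainder consists of the letters of row [l] from [j] on, the whole row [l.+1],
    and the later rows. Since consecutive row lengths differ by [la l], the violated inequality is
    the size hypothesis of [red_rows]. *)
Lemma red_tword (la : wt n) (T : {ffun posroot n -> nat}) :
  (forall i, m i = (rows la i)%:R) -> ~ GT la T -> red (tword T).
Proof.
move=> mE /existsNP[l] /existsNP[j] /not_implyP[/andP[lj jn]] /negP.
rewrite -ltnNge; have l1n : (l.+1 < n)%N by exact: leq_ltn_trans jn.
pose i0 : 'I_n := Ordinal (ltnW l1n); pose i1 : 'I_n := Ordinal l1n.
have ln : (l < n.-1)%N by rewrite -ltnS prednK // (ltn_trans _ l1n).
rewrite -[rows la l]/(rows la (Ordinal ln)) rows_succ /= addnAC ltn_add2r => lt.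
have i01 : i1 = i0.+1 :> nat by [].
have r_lt : (i0 < Ordinal jn)%N by [].
pose r := mkroot r_lt.
set W := tword T; have sW : sorted root_le W := sorted_tword T.
rewrite (sorted_filter_cat (P := fun p => root_lt p r) sW); last first.
  by move=> p q /orP[/eqP -> //|]; exact: root_lt_trans.
apply: red_cat; set rest := filter _ W.
have srest : sorted root_le rest by exact: sorted_filter root_le_trans _ _ sW.
have row_le p q : root_le p q -> ((val p).1 <= (val q).1)%N.
  by case/orP=> [/eqP -> //|]; exact: root_lt_row.
rewrite (sorted_filter_cat (P := fun p => ((val p).1 <= i0)%N) srest); last first.
  by move=> p q /row_le; exact: leq_trans.
set tL := filter _ rest; set rest2 := filter _ rest.
have srest2 : sorted root_le rest2 by exact: sorted_filter root_le_trans _ _ srest.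
rewrite (sorted_filter_cat (P := fun p => ((val p).1 <= i1)%N) srest2); last first.
  by move=> p q /row_le; exact: leq_trans.
set sR := filter _ rest2; set y := filter _ rest2.
have tLE : tL = [seq p : posroot n <- W | ((val p).1 == l :> nat) && (j <= (val p).2)%N].
  rewrite /tL /rest -filter_predI; apply: eq_filter => p /=.
  rewrite /root_lt /= -val_eqE /=; case: (ltngtP (val p).1 l) => //= _.
  by rewrite -leqNgt.
have sRE : sR = [seq p : posroot n <- W | (val p).1 == l.+1 :> nat].
  rewrite /sR /rest2 /rest -!filter_predI; apply: eq_filter => p /=.
  rewrite /root_lt /= -val_eqE /= -ltnNge.
  by rewrite -eqn_leq; case: eqP => //= ->; rewrite ltnNge leqnSn /= eqn_leq ltnn.
apply: (red_rows i01 (j := j) (a0 := la (Ordinal ln))) => //.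
- by apply/allP => p; rewrite tLE mem_filter => /andP[/andP[/eqP p1 _] _]; apply/eqP/val_inj.
- by apply/allP => p; rewrite tLE mem_filter => /andP[/andP[]].
- by apply/allP => p; rewrite sRE mem_filter => /andP[/eqP p1 _]; apply/eqP/val_inj.
- by apply/allP => p; rewrite mem_filter /= -ltnNge => /andP[].
- exact: sorted_filter root_le_trans _ _ srest.
- exact: sorted_filter root_le_trans _ _ srest2.
- by rewrite !mE -[i0 : nat]/(Ordinal ln : nat) rows_succ natrD addrK.
rewrite tLE sRE size_filter count_filter !count_cnt cnt_tword.
move: lt; congr (_ + _ < _)%N; apply: eq_bigl => p /=.
by rewrite andbC.
Qed.

End Reduction.
(** * Gelfand-Tsetlin patterns as sums of columns *)

Section Patterns.
Context {n : nat}.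
Implicit Types (la : wt n) (T : {ffun posroot n -> nat}) (I : pluck n) (s : seq 'I_n).

Lemma rowsumD T S l j : rowsum (T + S) l j = (rowsum T l j + rowsum S l j)%N.
Proof. by rewrite /rowsum -big_split; apply: eq_bigr => p _; rewrite addT_E. Qed.

Lemma rowsum_split T l j : rowsum T l j =
  (rowsum T l j.+1 + \sum_(p : posroot n | ((val p).1 == l :> nat) && ((val p).2 == j :> nat)) T p)%N.
Proof.
rewrite addnC /rowsum (bigID (fun p : posroot n => (val p).2 == j :> nat)) /=.
congr (_ + _)%N; apply: eq_bigl => p; rewrite -andbA; congr (_ && _).
  by case: eqP => [->|]; rewrite ?leqnn ?andbF.
by rewrite ltn_neqAle andbC eq_sym.
Qed.

Lemma rowsum_root T (p : posroot n) :
  rowsum T (val p).1 (val p).2 = (rowsum T (val p).1 (val p).2.+1 + T p)%N.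
Proof.
rewrite rowsum_split; congr (_ + _)%N.
by rewrite (eq_bigl (pred1 p)) ?big_pred1_eq // => q; rewrite -posroot_eqE.
Qed.

Lemma rowsum_succ T l j : (rowsum T l j.+1 <= rowsum T l j)%N.
Proof. by rewrite [leqRHS]rowsum_split leq_addr. Qed.

Lemma rowsum_mono T l j k : (j <= k)%N -> (rowsum T l k <= rowsum T l j)%N.
Proof.
move=> /subnK <-; elim: (k - j)%N => // d IH; rewrite addSn.
exact: leq_trans (rowsum_succ _ _ _) IH.
Qed.

Lemma rowsum_big T l j : (n <= j)%N -> rowsum T l j = 0%N.
Proof.
move=> nj; rewrite /rowsum big1 // => p /andP[_ jp].
by have := ltn_ord (val p).2; rewrite ltnNge (leq_trans nj jp).
Qed.

Lemma rowsum_bigrow T l j : (n <= l.+1)%N -> rowsum T l j = 0%N.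
Proof.
move=> nl; rewrite /rowsum big1 // => p /andP[/eqP p1 _].
have := leq_ltn_trans (posroot_lt p) (ltn_ord (val p).2).
by rewrite p1 ltnNge nl.
Qed.

Lemma rowsum_inj T S : (forall l j, (l < j)%N -> rowsum T l j = rowsum S l j) -> T = S.
Proof.
move=> TS; apply/ffunP => p; have pl := posroot_lt p.
have := TS _ _ pl; rewrite !rowsum_root TS; last exact: ltn_trans pl _.
by move/addnI.
Qed.

Lemma rows_mono la l k : (l <= k)%N -> (rows la k <= rows la l)%N.
Proof.
move=> lk; rewrite /rows [leqRHS](bigID (fun i : 'I_n.-1 => k <= i)%N) /=.
apply: (leq_trans _ (leq_addr _ _)); rewrite leq_eqVlt; apply/orP; left.
apply/eqP; apply: eq_bigl => i; apply/idP/andP => [ki|[_ //]].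
by split=> //; exact: leq_trans ki.
Qed.

Lemma rows_big la l : (n.-1 <= l)%N -> rows la l = 0%N.
Proof.
move=> nl; rewrite /rows big1 // => k lk.
by have := ltn_ord k; rewrite ltnNge (leq_trans nl lk).
Qed.

(** By induction from the last row upwards, using the inequality of [GT] with [j = l.+1]. *)
Lemma GT_le la T l j : GT la T -> (l < j)%N -> (rowsum T l j <= rows la l)%N.
Proof.
move=> gt; suff H l' : (l' < n)%N -> (rowsum T l' l'.+1 <= rows la l')%N.
  have [ln lj|nl _] := ltnP l n.
    exact: leq_trans (rowsum_mono _ _ lj) (H _ ln).
  by rewrite rowsum_bigrow // (leq_trans nl).
have [d] := ubnP (n - l'); elim: d l' => // d IH l' d' ln.
have [ln1|nl] := ltnP l'.+1 n; last by rewrite rowsum_bigrow.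
have := gt l' l'.+1; rewrite ltnSn ln1 => /(_ isT) g.
have d1 : (n - l'.+1 < d)%N by move: d' ln1; clear; lia.
have {IH} := IH _ d1 ln1; move: g; clear; lia.
Qed.

Lemma rowsum_pluckT I l j : (l < j)%N ->
  rowsum (pluckT I) l j = (if onth (val I) l is Some i then (j <= i)%N else false) :> nat.
Proof.
move=> lj; rewrite /rowsum.
rewrite (eq_bigr (fun p : posroot n => (onth (val I) l == Some (val p).2) : nat)); last first.
  by move=> p /andP[/eqP p1 _]; rewrite ffunE /in_col p1.
case: (onth (val I) l) => [i|]; last by rewrite big1.
have [ji|ij] := leqP j i; last first.
  rewrite big1 // => p /andP[_ jp]; rewrite (inj_eq Some_inj); case: eqP => // ip.
  by rewrite ip ltnNge jp in ij.
have li : (l < i)%N by exact: leq_trans ji.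
pose l' : 'I_n := Ordinal (ltn_trans li (ltn_ord i)).
have li' : (l' < i)%N by [].
rewrite (bigD1 (mkroot li')) /=; last by rewrite eqxx.
rewrite eqxx big1 // => p /andP[/andP[/eqP p1 _] np]; apply/eqP; rewrite eqb0.
apply: contra np => /eqP[ip]; rewrite posroot_eqE /= p1 eqxx /= -ip.
exact: eqxx.
Qed.

Section Peel.
Variables (la : wt n) (T : {ffun posroot n -> nat}).
Hypotheses (gt : GT la T) (la0 : (0 < rows la 0)%N).

Lemma peel_n : (1 < n)%N.
Proof.
by rewrite ltnNge; apply: contraL la0 => n1; rewrite rows_big // leqn0; case: n n1 => [|[]].
Qed.

(** The height of the first column of the tableau. *)
Definition ncol : nat := find (fun l => rows la l == 0%N) (iota 0 n).

Lemma ncolP l : (l < ncol)%N = (0 < rows la l)%N.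
Proof.
have hasn : has (fun l => rows la l == 0%N) (iota 0 n).
  apply/hasP; exists n.-1; last by rewrite rows_big.
  by rewrite mem_iota add0n /= ltn_predL (ltn_trans _ peel_n).
rewrite lt0n; apply/idP/idP => [ln|].
  have := before_find 0%N ln; rewrite nth_iota ?add0n; first by move=> ->.
  by apply: leq_trans ln _; rewrite -[leqRHS](size_iota 0 n) find_size.
apply: contraNT; rewrite -leqNgt => ln; have := nth_find 0%N hasn.
rewrite nth_iota; last by rewrite -[ltnRHS](size_iota 0 n) -has_find.
by rewrite add0n -!leqn0; apply: leq_trans; exact: rows_mono.
Qed.

Lemma ncol_gt0 : (0 < ncol)%N. Proof. by rewrite ncolP. Qed.

Lemma ncol_lt : (ncol < n)%N.
Proof.
have n1 : (0 < n)%N by exact: ltn_trans peel_n.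
by rewrite -[ltnRHS](prednK n1) ltnS leqNgt ncolP rows_big.
Qed.

(** The least entry of row [l], which stands in the first column: the least value that is not
    exceeded by all [rows la l] entries of the row. *)
Definition colent (l : nat) : nat :=
  (l + find (fun j => rowsum T l (l + j).+1 < rows la l)%N (iota 0 n))%N.

Lemma colentP l j : (l < ncol)%N -> (l < j)%N ->
  (colent l < j)%N = (rowsum T l j < rows la l)%N.
Proof.
rewrite ncolP => l0 lj; rewrite /colent; set P := fun j => _.
have n1 : (0 < n)%N by exact: ltn_trans peel_n.
have hasn : has P (iota 0 n).
  apply/hasP; exists n.-1; first by rewrite mem_iota add0n /= ltn_predL.
  by rewrite /P rowsum_big // -addnS prednK // leq_addl.
apply/idP/idP => [cj|].
  have := nth_find 0%N hasn; rewrite nth_iota; last first.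
    by rewrite -[ltnRHS](size_iota 0 n) -has_find.
  by rewrite add0n; apply: leq_ltn_trans; exact: rowsum_mono.
apply: contraTT; rewrite -leqNgt => jf.
have jl : (j.-1 - l < find P (iota 0 n))%N.
  by move: jf lj; move: (find _ _) => f; clear; lia.
have := before_find 0%N jl; rewrite nth_iota; last first.
  by apply: leq_trans jl _; rewrite -[leqRHS](size_iota 0 n) find_size.
rewrite add0n /P => /negbT; congr (~~ (rowsum T l _ < _)%N).
by move: lj; clear; lia.
Qed.

Lemma colent_lt l : (l < ncol)%N -> (colent l < n)%N.
Proof.
move=> ln; rewrite colentP // ?(ltn_trans ln ncol_lt) //.
by rewrite rowsum_big // -ncolP.
Qed.

Lemma colent_ge l : (l <= colent l)%N. Proof. exact: leq_addr. Qed.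

(** The inequality of [GT] at [j = colent l.+1]: some entry of row [l.+1] is at most [j], so some
    entry of row [l] is below [j]. *)
Lemma colent_incr l : (l.+1 < ncol)%N -> (colent l < colent l.+1)%N.
Proof.
move=> ln; set j := colent l.+1.
have lj : (l < j)%N := colent_ge l.+1.
rewrite colentP //; last exact: ltnW.
have jn : (j < n)%N := colent_lt ln.
have := gt (l := l) (j := j); rewrite lj jn => /(_ isT).
have : (rowsum T l.+1 j.+1 < rows la l.+1)%N.
  by rewrite -colentP // ltnS; exact: colent_ge.
clear; lia.
Qed.

Let o0 : 'I_n := Ordinal (ltn_trans (ltnSn 0) peel_n).
Let cols : seq 'I_n := [seq insubd o0 (colent l) | l <- iota 0 ncol].

Lemma nth_cols l : (l < ncol)%N -> nth o0 cols l = colent l :> nat.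
Proof.
move=> ln; rewrite (nth_map 0%N) ?size_iota // nth_iota // add0n.
by rewrite val_insubd colent_lt.
Qed.

Lemma cols_pluck : sorted (fun i j : 'I_n => (i < j)%N) cols && (0 < size cols < n)%N.
Proof.
rewrite size_map size_iota ncol_gt0 ncol_lt !andbT.
apply/(sortedP o0) => l; rewrite size_map size_iota => ln.
by rewrite !nth_cols // ?colent_incr // ltnW.
Qed.

Definition peel : pluck n := exist _ cols cols_pluck.

Lemma rowsum_peel l j : (l < j)%N ->
  rowsum (pluckT peel) l j = ((0 < rows la l) && (rows la l <= rowsum T l j))%N :> nat.
Proof.
move=> lj; rewrite rowsum_pluckT //= -ncolP.
have [ln|nl] := ltnP l ncol; last first.
  by rewrite onth_default // size_map size_iota.
have -> : onth cols l = Some (nth o0 cols l).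
  by rewrite onthE (nth_map o0) // size_map size_iota.
by rewrite nth_cols //= leqNgt colentP // -leqNgt.
Qed.

Lemma rows_peel l : rows (plwt peel) l = (0 < rows la l)%N.
Proof. by rewrite rows_plwt /= size_map size_iota ncolP. Qed.
End Peel.

(** By induction on the number of columns [rows la 0], removing the first column of the tableau. *)
Lemma GT_decomp la T : GT la T -> exists s : seq (pluck n), la = wt_of s /\ T = exp_of s.
Proof.
have [N] := ubnP (rows la 0); elim: N la T => // N IH la T laN gt.
have [la0|la0] := posnP (rows la 0).
  have r0 l : rows la l = 0%N by apply/eqP; rewrite -leqn0 -la0; exact: rows_mono.
  exists [::]; rewrite /wt_of /exp_of !big_nil; split.
    by apply/ffunP => k; rewrite [RHS]ffunE; have := r0 k; rewrite rows_succ => /eqP; rewrite addn_eq0 => /andP[/eqP].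
  apply: rowsum_inj => l j lj; have := GT_le gt lj; rewrite r0 leqn0 => /eqP ->.
  by rewrite /rowsum big1 // => p _; rewrite ffunE.
pose I := peel gt la0.
pose T' : {ffun posroot n -> nat} := [ffun p => (T p - pluckT I p)%N].
pose la' : wt n := [ffun k => (la k - plwt I k)%N].
have TE : T = pluckT I + T'.
  apply/ffunP => p; rewrite addT_E [T' p]ffunE subnKC //.
  have pl := posroot_lt p.
  have := rowsum_root T p; have := rowsum_root (pluckT I) p.
  rewrite !rowsum_peel //; last exact: ltnW.
  case: (rows la _) => [|r] /=; first by clear; lia.
  by case: leqP; case: leqP; clear; lia.
have laE : la = plwt I + la'.
  apply/ffunP => k; rewrite [RHS]ffunE [RHS]/= [la' k]ffunE.
  apply/esym/subnKC; have := rows_succ (plwt I) k; rewrite !rows_peel.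
  have := rows_succ la k; have := rows_mono la (leqnSn k).
  by move: (rows la k) (rows la k.+1) => [|x] [|y]; clear; lia.
have rowsE l : rows la l = ((0 < rows la l) + rows la' l)%N.
  by rewrite {1}laE rowsD rows_peel.
(* In a nonempty row, [rowsum T' l j] is the minimum of [rowsum T l j] and [rows la l - 1]: removing
   the least entry changes the count only if all entries were counted. From this form the
   inequalities for [T'] follow. *)
have sumE l j : (l < j)%N -> rowsum T l j =
    (((0 < rows la l) && (rows la l <= rowsum T l j))%N + rowsum T' l j)%N.
  by move=> lj; rewrite {1}TE rowsumD rowsum_peel.
have [||s [sla sT]] := IH la' T'.
- by have := rowsE 0%N; rewrite la0; move: laN; clear; lia.
- move=> l j /andP[lj jn]; have := gt l j; rewrite lj jn => /(_ isT).
  have lj1 : (l.+1 < j.+1)%N by [].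
  have := GT_le gt lj; have := GT_le gt lj1.
  have := sumE _ _ lj; have := sumE _ _ lj1; have := rowsE l; have := rowsE l.+1.
  move: (rowsum T' l j) (rowsum T' l.+1 j.+1) (rows la' l) (rows la' l.+1).
  move: (rowsum T l j) (rowsum T l.+1 j.+1) (rows la l) (rows la l.+1).
  by move=> x y [|a] [|b] x' y' a' b' /=; case: leqP; case: leqP; clear; lia.
by exists (I :: s); rewrite /wt_of /exp_of !big_cons -/(wt_of s) -/(exp_of s) -sla -sT.
Qed.
End Patterns.
(** * From sl_n to gl_n *)

Section IrrepGl.
Context {F : fieldType} {n : nat} {la : wt n} (M : hw_irrep F la).
Hypothesis F0 : [pchar F] =i pred0.
Local Notation V := (irr_space M).

(** The traceless part of a matrix unit; the action has prescribed properties on traceless matrices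
    only. *)
Definition tl_unit (i j : 'I_n) : 'M[F]_n := delta_mx i j - ((i == j)%:R / n%:R)%:M.

Lemma ord_natr_neq0 (i : 'I_n) : n%:R != 0 :> F.
Proof. by rewrite (pcharf0P _).1 //; case: n i => // -[]. Qed.

Lemma tr_tl_unit i j : \tr (tl_unit i j) = 0.
Proof.
rewrite /tl_unit raddfB /= mxtrace_scalar -[_ *+ n]mulr_natr divfK ?(ord_natr_neq0 i) //.
rewrite /mxtrace (bigD1 i) //= mxE eqxx big1 => [|k ki]; last by rewrite mxE (negPf ki).
by rewrite addr0 subrr.
Qed.

Lemma tl_unit_bracket i j k l : tl_unit i j *m tl_unit k l - tl_unit k l *m tl_unit i j =
  (j == k)%:R *: tl_unit i l - (l == i)%:R *: tl_unit k j.
Proof.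
have mulE (i1 j1 k1 l1 : 'I_n) : delta_mx i1 j1 *m delta_mx k1 l1 = (j1 == k1)%:R *: delta_mx i1 l1 :> 'M[F]_n.
  by have [<-|jk] := eqVneq j1 k1; rewrite ?mul_delta_mx ?scale1r // mul_delta_mx_0 // scale0r.
rewrite /tl_unit !mulmxBl !mulmxBr !mulE -!scalar_mxM !mul_scalar_mx !mul_mx_scalar.
rewrite (mulrC ((k == l)%:R / n%:R)) !scalerBr.
have -> : (j == k)%:R *: ((i == l)%:R / n%:R)%:M = (l == i)%:R *: ((k == j)%:R / n%:R)%:M :> 'M[F]_n.
  by rewrite !scale_scalar_mx (eq_sym j) (eq_sym l) !mulrA (mulrC (k == j)%:R).
move: (_ *: delta_mx i l) (_ *: delta_mx k j) (_ *: delta_mx k l) (_ *: delta_mx i j).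
move: (_%:M) (_ *: _%:M) => S S' X Y Z W.
by rewrite opprB !opprD !opprK; apply/matrixP => a b; rewrite !mxE; ring.
Qed.

Definition rho A : {linear V -> V} := irr_act M A.

Lemma rho_lin a A B u : \tr A = 0 -> \tr B = 0 -> rho (a *: A + B) u = a *: rho A u + rho B u.
Proof. move=> A0 B0; rewrite -[LHS]/(irr_act M (a *: A + B) u) irr_act_linear //.
by rewrite add_lfunE scale_lfunE. Qed.

Lemma rho0 u : rho 0 u = 0.
Proof.
have tr0 : \tr (0 : 'M[F]_n) = 0 by exact: mxtrace0.
by have := rho_lin (-1) u tr0 tr0; rewrite scaler0 addr0 scaleN1r addNr.
Qed.

Lemma rhoZ a A u : \tr A = 0 -> rho (a *: A) u = a *: rho A u.
Proof. by move=> A0; rewrite -[a *: A]addr0 rho_lin ?mxtrace0 // rho0 addr0. Qed.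

Lemma rhoD A B u : \tr A = 0 -> \tr B = 0 -> rho (A + B) u = rho A u + rho B u.
Proof. by move=> A0 B0; rewrite -[A]scale1r rho_lin // !scale1r. Qed.

Lemma rhoB A B u : \tr A = 0 -> \tr B = 0 -> rho (A - B) u = rho A u - rho B u.
Proof. by move=> A0 B0; rewrite addrC -scaleN1r rho_lin // scaleN1r addrC. Qed.

(* The scalar by which the action of sl_n is shifted to make the weight of the
   singular vector equal to the partition [rows la]. *)
Definition rshift : F := (\sum_(i < n) rows la i)%:R / n%:R.

Definition glE (i j : 'I_n) : {linear V -> V} :=
  homD (rho (tl_unit i j)) (homZ ((i == j)%:R * rshift) idfun).

Lemma glEE i j u : glE i j u = rho (tl_unit i j) u + ((i == j)%:R * rshift) *: u.
Proof. by []. Qed.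

Lemma glE_neq i j u : i != j -> glE i j u = irr_act M (delta_mx i j) u.
Proof.
move=> /negPf ij; rewrite glEE /tl_unit ij !mul0r scale0r addr0.
by rewrite (_ : 0%:M = 0) ?subr0 //; apply/matrixP => a b; rewrite !mxE mul0rn.
Qed.

(** The highest weight fixes only the differences of consecutive diagonal units, so [X] is the same
    for all indices. Its common value follows from the sum: the traceless parts of the diagonal
    units add up to zero, and the row lengths to [n%:R * rshift]. *)
Lemma rho_diag (i : 'I_n) : rho (tl_unit i i) (hw_vec M) = ((rows la i)%:R - rshift) *: hw_vec M.
Proof.
pose X (i : 'I_n) := rho (tl_unit i i) (hw_vec M) - (rows la i)%:R *: hw_vec M.
have Xs (a b : 'I_n) : b = a.+1 :> nat -> X a = X b.
  move=> ab; have an : (a < n.-1)%N by rewrite -ltnS prednK ?(leq_ltn_trans _ (ltn_ord b)) // -ab.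
  have := hw_vec_weight M (k := Ordinal an) (i := a) (j := b) erefl ab.
  have -> : delta_mx a a - delta_mx b b = tl_unit a a - tl_unit b b :> 'M[F]_n.
    by rewrite /tl_unit !eqxx opprB addrA subrK.
  rewrite -/(rho _) rhoB ?tr_tl_unit // => E1.
  apply/eqP; rewrite -subr_eq0 /X opprD opprK addrACA E1 -scaleNr -!scalerDl.
  rewrite (rows_succ la (Ordinal an)) /= -ab natrD.
  by rewrite opprD -addrA addNr addr0 subrr scale0r.
have Xc k (kn : (k < n)%N) : X (Ordinal kn) = X i.
  have X0 l (ln : (l < n)%N) (n0 : (0 < n)%N) : X (Ordinal ln) = X (Ordinal n0).
    elim: l ln => [|l IH] ln; first by congr X; exact: val_inj.
    by rewrite -(Xs (Ordinal (ltnW ln))) // IH.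
  have n0 : (0 < n)%N by exact: leq_ltn_trans kn.
  by rewrite (X0 k kn n0) -(X0 i (ltn_ord i) n0); congr X; exact: val_inj.
have sumX : \sum_(k < n) X k = - (n%:R * rshift) *: hw_vec M.
  rewrite sumrB -scaler_suml -natr_sum /rshift mulrC divfK ?(ord_natr_neq0 i) //.
  have -> : \sum_(k < n) rho (tl_unit k k) (hw_vec M) = 0.
    have trs (r : seq 'I_n) : \tr (\sum_(k <- r) tl_unit k k) = 0.
      by rewrite raddf_sum big1 // => k _; exact: tr_tl_unit.
    have -> : \sum_(k < n) rho (tl_unit k k) (hw_vec M) =
        rho (\sum_(k < n) tl_unit k k) (hw_vec M).
      elim: (index_enum _) => [|k r IH]; first by rewrite !big_nil rho0.
      by rewrite !big_cons rhoD ?tr_tl_unit // IH.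
    rewrite (_ : \sum_(k < n) _ = 0) ?rho0 // /tl_unit.
    apply/matrixP => a b; rewrite summxE mxE.
    under eq_bigr do rewrite !mxE eqxx.
    rewrite sumrB big_const_ord iter_addr addr0 -mulrnA mulnC mulrnA -[_ *+ n]mulr_natr.
    rewrite divfK ?(ord_natr_neq0 i) // (bigD1 a) //= eqxx big1 => [|c ca].
      by rewrite addr0 eq_sym subrr.
    by rewrite eq_sym (negPf ca).
  by rewrite sub0r scaleNr.
have {Xc sumX} : n%:R *: X i = - (n%:R * rshift) *: hw_vec M.
  rewrite -sumX (eq_bigr (fun _ => X i)) => [|[k kn] _]; last exact: Xc.
  by rewrite sumr_const card_ord scaler_nat.
rewrite -mulrN -scalerA => /(scalerI (ord_natr_neq0 i)) /eqP.
by rewrite /X subr_eq => /eqP ->; rewrite -scalerDl addrC.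
Qed.

Lemma glE_glmod : glmod (fun i => (rows la i)%:R) glE (hw_vec M).
Proof.
split=> [i j k l u|i j ij|i].
- have br : rho (tl_unit i j *m tl_unit k l - tl_unit k l *m tl_unit i j) u =
      rho (tl_unit i j) (rho (tl_unit k l) u) - rho (tl_unit k l) (rho (tl_unit i j) u).
    by apply: irr_act_bracket; exact: tr_tl_unit.
  rewrite tl_unit_bracket in br.
  have brE : rho (tl_unit i j) (rho (tl_unit k l) u) =
      rho (tl_unit k l) (rho (tl_unit i j) u) +
      ((j == k)%:R *: rho (tl_unit i l) u - (l == i)%:R *: rho (tl_unit k j) u).
    rewrite -!rhoZ ?tr_tl_unit // -rhoB ?mxtraceZ ?tr_tl_unit ?mulr0 //.
    by rewrite br addrC subrK.
  have rl A c x y : rho A (x + c *: y) = rho A x + c *: rho A y by rewrite linearD linearZ.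
  rewrite !glEE !rl brE !scalerDr !scalerA.
  have -> : (j == k)%:R * ((i == l)%:R * rshift) = (l == i)%:R * ((k == j)%:R * rshift).
    by rewrite (eq_sym j) (eq_sym i) mulrCA.
  rewrite (mulrC ((k == l)%:R * rshift)) opprD -[RHS]addrA [X in _ = _ + X]addrACA subrr addr0.
  by rewrite [LHS](AC (3*2) (1*4*(3*5)*2)).
- by rewrite glE_neq ?(hw_vec_raise M ij) // neq_ltn ij.
by rewrite glEE rho_diag eqxx mul1r -scalerDl subrK.
Qed.
End IrrepGl.
(** * Standard words *)

Section StandardWords.
Context {F : fieldType} {n : nat} {la : wt n} (M : hw_irrep F la).
Hypothesis F0 : [pchar F] =i pred0.
Implicit Types (w : seq (posroot n)) (x : freealg F n).

Definition init_word w : Prop := exists x, annI M x /\ is_initial x (FMonom w).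

Lemma annI_fact x : annI M x <-> fact (glE M) (hw_vec M) x = 0.
Proof.
rewrite /annI /= /free_act /fact.
suff -> : (word_act (M := M))^~ (hw_vec M) = (fun w : {fmonom posroot n} => wact (glE M) w (hw_vec M)) by [].
apply/funext => w; rewrite /word_act; elim: (w : seq _) => [//|p s IH].
rewrite -[RHS]/(glE M (val p).2 (val p).1 (wact (glE M) s (hw_vec M))) -IH glE_neq //.
by rewrite neq_ltn (posroot_lt p) orbT.
Qed.

Lemma red_init w : red (glE M) (hw_vec M) w -> init_word w.
Proof.
move=> [y yE ylt]; exists (<< FMonom w >> - y); split.
  by apply/annI_fact; rewrite factB factU yE subrr.
have yw : y@_(FMonom w) = 0.
  apply/eqP; apply: contraT => /ylt; rewrite /word_lt ltnn eqxx /=.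
  by rewrite word_lex_irr.
split=> [|w']; first by rewrite mcoeffB mcoeffUU yw subr0 oner_eq0.
move=> + ne; rewrite mcoeffB mcoeffU (eq_sym (FMonom w)) (negPf ne) sub0r oppr_eq0.
exact: ylt.
Qed.

Lemma std_word w : ~ init_word w ->
  exists s : seq (pluck n), la = wt_of s /\ w = tword (exp_of s).
Proof.
move=> ni; have EV := glE_glmod M F0.
have sw : sorted root_le w.
  by apply: contra_notT ni => /(red_unsorted EV)/red_init.
have gt : GT la (cnt w).
  apply: contra_notP ni => gt; rewrite -(tword_cnt sw).
  by apply: red_init; exact: red_tword F0 EV _ _ _ gt.
have [s [laE TE]] := GT_decomp gt; exists s; split=> //.
by rewrite -TE tword_cnt.
Qed.

Definition cls w : Lprec M := qproj (initial_annI M) << FMonom w >>.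

Lemma vprecE : vprec M = cls [::].
Proof. by rewrite /vprec /cls -fmoneE. Qed.

Lemma chi_cls p w : chi p (cls w) = cls (p :: w).
Proof.
rewrite /chi lactE /cls word_mulU; congr (qproj _ << _ >>).
by apply/eqP; rewrite fmP fmM fmU.
Qed.

Lemma fhatXE (T : {ffun posroot n -> nat}) : fhatX T = << FMonom (tword T) >> :> freealg F n.
Proof.
rewrite /fhatX /tword; elim: (sort _ _) => [|p s IH] /=; first by rewrite big_nil -fmoneE.
rewrite big_cons IH.
have -> : fhat p ^+ T p = << FMonom (nseq (T p) p) >> :> freealg F n.
  elim: (T p) => [|k IHk]; first by rewrite expr0 -fmoneE.
  rewrite exprS IHk word_mulU; congr << _ >>.
  by apply/eqP; rewrite fmP fmM fmU.
by rewrite word_mulU; congr << _ >>; apply/eqP; rewrite fmP fmM.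
Qed.

Lemma chivE T : chiv M T = cls (tword T).
Proof. by rewrite /chiv vprecE lactE fhatXE word_mulU -[FMonom [::]]fmoneE mulm1. Qed.

Lemma cls_init w : init_word w -> cls w = 0.
Proof.
move=> wI; rewrite /cls -[RHS](raddf0 (qproj (initial_annI M))).
have /Defs.sub_span wS : initial_annI M << FMonom w >> by exists (FMonom w).
by apply/quotmodP; rewrite subr0; apply/span_predP.
Qed.

Lemma Lprec_ind (P : Lprec M -> Prop) : P 0 ->
  (forall a w u, P u -> P (a *: cls w + u)) -> forall u, P u.
Proof.
move=> P0 Pc u; rewrite -[u]reprK -/(qproj _ _) [repr u]malg_basisE.
rewrite linear_sum; elim/big_rec: _ => // w y _ Py.
by rewrite linearZ -[w]fmK; exact: Pc.
Qed.

Lemma Lprec_ext (W : lmodType F) (f g : {linear Lprec M -> W}) :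
  (forall w, f (cls w) = g (cls w)) -> f = g.
Proof.
move=> fg; apply: homP; apply: Lprec_ind => [|a w u fgu]; first by rewrite !linear0.
by rewrite !linearP fg fgu.
Qed.

Section Extension.
Context (W : lmodType F) (g : seq (posroot n) -> W).

Definition qext : Lprec M -> W := qlift (mlin (fun w : {fmonom posroot n} => g w)).

Hypothesis gI : forall w, init_word w -> g w = 0.

Lemma qext_vanish x : initial_annI M x -> mlin (fun w : {fmonom posroot n} => g w) x = 0.
Proof. by case=> w wI <-; rewrite mlinU gI //; move: wI; case: w. Qed.

Lemma qext_is_linear : linear qext.
Proof. exact: (qlift_is_linear (f := mlin _) qext_vanish). Qed.

Lemma qext_cls w : qext (cls w) = g w.
Proof.
rewrite /qext; pose f : {linear freealg F n -> W} := mlin (fun w : {fmonom posroot n} => g w).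
by rewrite [LHS](qliftE (f := f) _ qext_vanish) [LHS]mlinU.
Qed.

End Extension.

(** The module is spanned by the words modulo some of the words themselves, so a linear map may be
    prescribed on words, subject only to vanishing on the initial ones. *)
Lemma qextP (W : lmodType F) (g : seq (posroot n) -> W) :
  (forall w, init_word w -> g w = 0) ->
  exists f : {linear Lprec M -> W}, forall w, f (cls w) = g w.
Proof.
move=> gI; pose f := GRing.isLinear.Build F _ _ *:%R (qext g) (qext_is_linear gI).
pose f' : {linear Lprec M -> W} := HB.pack (qext g) f.
by exists f' => w; exact: qext_cls.
Qed.

End StandardWords.

(** Suppose an annihilating [x] had its highest term at the word of the columns [s]. It also kills
    the vector of the model, by [herm_ann]; but [phi] vanishes on all smaller words, so only the
    highest term would contribute, and not zero. *)
Lemma wt_of_std {C : numClosedFieldType} {n : nat} {la : wt n} (M : hw_irrep C la)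
    (s : seq (pluck n)) : la = wt_of s -> ~ init_word M (tword (exp_of s)).
Proof.
move=> laE [x [/annI_fact x0 [xW xmax]]].
have [V [E [v [h [phi [EV hE phile phi0]]]]]] := has_model_of (C := C) s.
rewrite -laE in EV.
have := herm_ann (glE_glmod M (pchar_num C)) (hw_vec_neq0 M) EV hE x0.
move=> /(congr1 phi); rewrite linear0 /fact /mlin linear_sum /=.
set W := FMonom _ in xW xmax.
have Wx : W \in msupp x by rewrite -mcoeff_neq0.
rewrite (big_rem _ Wx) /= big1_seq ?addr0 => [/eqP|w /andP[_ wx]].
  by rewrite linearZ /= mulf_eq0 (negPf xW) (negPf phi0).
have wW : w != W.
  by apply: contraTneq wx => ->; rewrite mem_rem_uniq ?fset_uniq // inE eqxx.
have /xmax/(_ wW) : x@_w != 0.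
  by rewrite mcoeff_neq0; exact: mem_rem wx.
move=> lt; apply/eqP; rewrite linearZ mulf_eq0; apply/orP; right; apply/eqP.
apply: contraTeq lt => /phile[le wtE].
rewrite /word_lt wtE ltnn eqxx /=.
case/orP: le => [/eqP E1|]; last exact: word_lex_asym.
by case/eqP: wW; apply/eqP; rewrite fmP -E1.
Qed.

(** * The universal property of the tensor product *)

Section TensorProduct.
Context {F : fieldType} (V W : lmodType F).

Lemma tensDl a v v' (w : W) : tens (a *: v + v' : V) w = a *: tens v w + tens v' w.
Proof.
apply/eqP; rewrite -subr_eq0 opprD addrA /tens -linearZ -!raddfB; apply/eqP.
rewrite -[RHS](raddf0 (qproj (@bilinear_rels F V W))).
have /Defs.sub_span rS : @bilinear_rels F V W
  (<< (a *: v + v', w) >> - a *: << (v, w) >> - << (v', w) >>).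
  by left; exists a, v, v', w.
by apply/quotmodP; rewrite subr0; apply/span_predP.
Qed.

Lemma tensDr a (v : V) (w w' : W) : tens v (a *: w + w') = a *: tens v w + tens v w'.
Proof.
apply/eqP; rewrite -subr_eq0 opprD addrA /tens -linearZ -!raddfB; apply/eqP.
rewrite -[RHS](raddf0 (qproj (@bilinear_rels F V W))).
have /Defs.sub_span rS : @bilinear_rels F V W
  (<< (v, a *: w + w') >> - a *: << (v, w) >> - << (v, w') >>).
  by right; exists a, v, w, w'.
by apply/quotmodP; rewrite subr0; apply/span_predP.
Qed.

Lemma tens0l (w : W) : tens (0 : V) w = 0.
Proof. by have := tensDl (-1) 0 0 w; rewrite scaler0 addr0 scaleN1r addNr. Qed.

Lemma tens0r (v : V) : tens v (0 : W) = 0.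
Proof. by have := tensDr (-1) v 0 0; rewrite scaler0 addr0 scaleN1r addNr. Qed.

Definition tens_r (v : V) (w : W) : tensor V W := tens v w.
Definition tens_l (w : W) (v : V) : tensor V W := tens v w.
HB.instance Definition _ v :=
  GRing.isLinear.Build F W (tensor V W) *:%R (tens_r v) (fun a => tensDr a v).
HB.instance Definition _ w :=
  GRing.isLinear.Build F V (tensor V W) *:%R (tens_l w) (fun a v v' => tensDl a v v' w).

Lemma tensor_ind (P : tensor V W -> Prop) : P 0 ->
  (forall a v w t, P t -> P (a *: tens v w + t)) -> forall t, P t.
Proof.
move=> P0 Pc t; rewrite -[t]reprK -/(qproj _ _) [repr t]malg_basisE.
rewrite linear_sum; elim/big_rec: _ => // -[v w] y _ Py.
by rewrite linearZ; exact: Pc.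
Qed.

Lemma tensor_lift (U : lmodType F) (b : V -> W -> U) :
  (forall a v v' w, b (a *: v + v') w = a *: b v w + b v' w) ->
  (forall a v w w', b v (a *: w + w') = a *: b v w + b v w') ->
  exists f : {linear tensor V W -> U}, forall v w, f (tens v w) = b v w.
Proof.
move=> bl br; pose g : {linear {malg F[(V * W)%type]} -> U} := mlin (fun vw => b vw.1 vw.2).
have gU v w : g << (v, w) >> = b v w by exact: mlinU.
have gS r : @bilinear_rels F V W r -> g r = 0.
  case=> [[a [v [v' [w ->]]]]|[a [v [w [w' ->]]]]];
    rewrite !linearB linearZ /= !gU ?bl ?br; by rewrite addrAC addrN sub0r addrC subrr || rewrite -addrA -opprD subrr.
pose f := GRing.isLinear.Build F _ _ *:%R (qlift g) (qlift_is_linear gS).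
pose G : {linear tensor V W -> U} := HB.pack (qlift g) f.
by exists G => v w; rewrite -[LHS]/(qlift g (qproj _ _)) qliftE.
Qed.

End TensorProduct.

(** * The Cartan component of the tensor product *)

Section CartanMap.
Context {F : fieldType} {n : nat} {la mu : wt n}.
Context (M1 : hw_irrep F la) (M2 : hw_irrep F mu).
Hypothesis F0 : [pchar F] =i pred0.
Hypothesis stdP : forall (nu : wt n) (M : hw_irrep F nu) (s : seq (pluck n)),
  nu = wt_of s -> ~ init_word M (tword (exp_of s)).
Implicit Types (p q : posroot n) (a b w : seq (posroot n)).
Local Notation T2 := (tensor (Lprec M1) (Lprec M2)).
Local Notation tcls a b := (tens (cls M1 a) (cls M2 b)).

Lemma tensor_cls_ext (U : lmodType F) (f g : {linear T2 -> U}) :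
  (forall a b, f (tcls a b) = g (tcls a b)) -> f = g.
Proof.
move=> fg.
have tensr u v : tens_r u v = tens u v by [].
have tensl u v : tens_l v u = tens u v by [].
have fg1 a : f \o tens_r (cls M1 a) = g \o tens_r (cls M1 a).
  by apply: (congr1 (fun h : {linear _ -> _} => h : _ -> _)); apply: Lprec_ext => b; exact: fg.
have fg2 v : f \o tens_l v = g \o tens_l v.
  apply: (congr1 (fun h : {linear _ -> _} => h : _ -> _)); apply: Lprec_ext => a.
  exact: (congr1 (fun h => h v) (fg1 a)).
apply: homP; apply: tensor_ind => [|c u v t IHt]; first by rewrite !linear0.
rewrite (linearP f) (linearP g) IHt; congr (_ *: _ + _).
exact: (congr1 (fun h => h u) (fg2 v)).
Qed.

Lemma all_root_le p (T : {ffun posroot n -> nat}) :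
  all (root_le p) (tword T) = [forall q, root_lt q p ==> (T q == 0%N)].
Proof.
apply/allP/forallP => [h q|h q]; last first.
  move=> qT; rewrite -[root_le p q]negbK -root_ltNle; apply/negP => qp.
  have := h q; rewrite qp /= -{1}(cnt_tword T) ffunE; apply/negP.
  by rewrite -lt0n -has_count has_pred1.
apply/implyP => qp; rewrite -{1}(cnt_tword T) ffunE -leqn0 leqNgt -has_count has_pred1.
by apply/negP => /h; rewrite -[root_le p q]negbK -root_ltNle qp.
Qed.

(** The vanishing condition on a homogeneous tensor fails exactly if it fails for both factors. So
    the action is the ordinary coproduct action preceded, in both factors, by the projection to the
    words without letters before [p]. *)
Lemma tensor_chi_exists p : exists2 X : {linear T2 -> T2}, is_tensor_chi p X &
  forall a b, X (tcls a b) =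
    if all (root_le p) a && all (root_le p) b
    then tcls (p :: a) b + tcls a (p :: b) else 0.
Proof.
have trunc (nu : wt n) (M : hw_irrep F nu) : exists f : {linear Lprec M -> Lprec M},
    forall w, f (cls M w) = if all (root_le p) w then cls M w else 0.
  by apply: qextP => w wI; rewrite cls_init // if_same.
have [f1 f1E] := trunc _ M1; have [f2 f2E] := trunc _ M2.
pose b u v := tens (chi p (f1 u)) (f2 v) + tens (f1 u) (chi p (f2 v)).
have [c u u' v|c u v v'|X XE] := tensor_lift (b := b).
- by rewrite /b !linearP !tensDl scalerDr addrACA.
- by rewrite /b !linearP !tensDr scalerDr addrACA.
have Xcls s t : X (tcls s t) = if all (root_le p) s && all (root_le p) t
    then tcls (p :: s) t + tcls s (p :: t) else 0.
  rewrite XE /b f1E f2E; case: ifP => /= _; last by rewrite (linear0 (chi p)) !tens0l addr0.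
  case: ifP => _; first by rewrite (chi_cls M1) (chi_cls M2).
  by rewrite (linear0 (chi p)) !tens0r addr0.
have f1h S c : f1 (c *: chiv M1 S) = if [forall q, root_lt q p ==> (S q == 0%N)]
    then c *: chiv M1 S else 0.
  by rewrite (linearZZ f1) (chivE M1) f1E all_root_le; case: ifP => _; rewrite ?scaler0.
have f2h S c : f2 (c *: chiv M2 S) = if [forall q, root_lt q p ==> (S q == 0%N)]
    then c *: chiv M2 S else 0.
  by rewrite (linearZZ f2) (chivE M2) f2E all_root_le; case: ifP => _; rewrite ?scaler0.
exists X; last exact: Xcls.
move=> S T u v [c uE] [d vE]; rewrite XE /b uE vE f1h f2h.
move: (c *: _) (d *: _) => {}u {}v {c d uE vE}.
case: [exists q, _] / existsP => [[q /andP[qp ST]]|no].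
  case: ifP => [/forallP/(_ q)|_]; last by rewrite (linear0 (chi p)) !tens0l addr0.
  rewrite qp /= => /eqP S0; case: ifP => [/forallP/(_ q)|_].
    by rewrite qp /= => /eqP T0; rewrite S0 T0 in ST.
  by rewrite (linear0 (chi p)) !tens0r addr0.
have z q : root_lt q p -> (S q == 0%N) && (T q == 0%N).
  by move=> qp; rewrite -addn_eq0; apply: contra_notT no => ST; exists q; rewrite qp.
by rewrite !ifT //; apply/forallP => q; apply/implyP => /z /andP[].
Qed.

(** The class of every word is homogeneous, an unsorted word having class zero. Hence the values on
    homogeneous tensors determine the map. *)
Lemma tensor_chiE p a b : tensor_chi M1 M2 p (tcls a b) =
  if all (root_le p) a && all (root_le p) b
  then tcls (p :: a) b + tcls a (p :: b) else 0.
Proof.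
have [X XP XE] := tensor_chi_exists p.
suff -> : tensor_chi M1 M2 p = X by exact: XE.
apply: xget_unique => [|Y YP]; first exact: XP.
have hom (nu : wt n) (M : hw_irrep F nu) w : homog (cnt w) (cls M w).
  have [sw|nsw] := boolP (sorted root_le w).
    by exists 1; rewrite scale1r chivE tword_cnt.
  exists 0; rewrite scale0r cls_init //.
  by apply: red_init; apply: red_unsorted nsw; exact: glE_glmod M F0.
by apply: tensor_cls_ext => s t; rewrite (YP _ _ _ _ (hom _ _ s) (hom _ _ t)) (XP _ _ _ _ (hom _ _ s) (hom _ _ t)).
Qed.

Definition tchi_word w : T2 := foldr (fun p => tensor_chi M1 M2 p) (tcls [::] [::]) w.

(** In a sorted word each letter acts before, or is equal to, no smaller one already present, so the
    truncation never applies and the plain coproduct remains. *)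
Lemma tchi_sorted w : sorted root_le w ->
  tchi_word w = \sum_(ab <- splits w) tcls ab.1 ab.2.
Proof.
elim: w => [|p w IH]; first by rewrite big_seq1.
rewrite /= (path_sortedE root_le_trans) => /andP[/allP pw /IH {}IH].
rewrite -/(tchi_word w) IH big_splits_cons linear_sum big_seq [RHS]big_seq.
apply: eq_bigr => -[a b] /splits_subseq[/mem_subseq aw /mem_subseq bw].
rewrite tensor_chiE ifT //; apply/andP; split; apply/allP => q.
  by move=> /aw /pw.
by move=> /bw /pw.
Qed.

Lemma tchi_unsorted w : ~~ sorted root_le w -> tchi_word w = 0.
Proof.
elim: w => [//|p w IH]; rewrite -[tchi_word (p :: w)]/(tensor_chi M1 M2 p (tchi_word w)).
have [sw|/IH -> _] := boolP (sorted root_le w); last by rewrite linear0.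
rewrite /= (path_sortedE root_le_trans) sw andbT => /allPn[q qw pq].
rewrite tchi_sorted // linear_sum big1_seq // => -[a b] /andP[_ /splits_perm abw].
rewrite tensor_chiE ifF //; apply/negP; rewrite -all_cat -(perm_all _ abw) => /allP/(_ q qw).
by rewrite (negPf pq).
Qed.

Section Map.
Context (M : hw_irrep F (la + mu)).

(** Here both bounds meet. If neither part of a splitting of a sorted [w] is initial, both are words
    of sums of columns by the upper bound; then so is [w], for the sum of the weights, and it is
    standard by the lower bound. *)
Lemma tchi_init w : init_word M w -> tchi_word w = 0.
Proof.
move=> wI; have [sw|] := boolP (sorted root_le w); last exact: tchi_unsorted.
rewrite tchi_sorted // big1_seq // => -[a b] /andP[_ ab].
case: (pselect (init_word M1 a)) => [aI|/(std_word F0)[s1 [laE aE]]].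
  by rewrite (cls_init aI) tens0l.
case: (pselect (init_word M2 b)) => [bI|/(std_word F0)[s2 [muE bE]]].
  by rewrite (cls_init bI) tens0r.
exfalso; have : la + mu = wt_of (s1 ++ s2).
  by rewrite laE muE /wt_of big_cat.
move=> /(stdP (M := M)); apply.
have -> : exp_of (s1 ++ s2) = cnt w.
  by rewrite (splits_cnt ab) aE bE !cnt_tword /exp_of big_cat.
by rewrite tword_cnt.
Qed.

(** Existence of the module map is [tchi_init]; it is unique because the words applied to the
    generator span. *)
Lemma cartanE w : cartan M1 M2 M (cls M w) = tchi_word w.
Proof.
have [D DE] := qextP tchi_init.
have DP : is_cartan D.
  split; first by rewrite (vprecE M) DE (vprecE M1) (vprecE M2).
  move=> p u; have e : D \o chi p = tensor_chi M1 M2 p \o D :> {linear _ -> _}.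
    by apply: Lprec_ext => t /=; rewrite (chi_cls M) !DE.
  exact: (congr1 (fun h : {linear _ -> _} => h u) e).
suff -> : cartan M1 M2 M = D by exact: DE.
apply: xget_unique => [|D' [D'v D'chi]]; first exact: DP.
apply: Lprec_ext => t; rewrite DE; elim: t => [|p t IH].
  rewrite -(vprecE M) D'v (vprecE M1) (vprecE M2); reflexivity.
by rewrite -(chi_cls M) D'chi IH.
Qed.

Lemma cartan_mulE f g w : cartan_mul M f g (cls M w) =
  if sorted root_le w then \sum_(ab <- splits w) f (cls M1 ab.1) * g (cls M2 ab.2) else 0.
Proof.
rewrite -[LHS]/(dtens f g (cartan M1 M2 M (cls M w))) cartanE.
case: ifP => sw; last by rewrite tchi_unsorted ?sw // linear0.
by rewrite tchi_sorted // linear_sum; apply: eq_bigr => ab _; exact: dtensE.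
Qed.
End Map.
End CartanMap.

(** * The functionals eta and their products *)

Section Eta.
Context {F : fieldType} {n : nat}.
Hypothesis F0 : [pchar F] =i pred0.
Hypothesis stdP : forall (nu : wt n) (M : hw_irrep F nu) (s : seq (pluck n)),
  nu = wt_of s -> ~ init_word M (tword (exp_of s)).
Implicit Types (T : {ffun posroot n -> nat}) (w : seq (posroot n)) (s t : seq (pluck n)).

Section OneIrrep.
Context {la : wt n} (M : hw_irrep F la).

(** Setting the value to 0 on initial words makes the functional well defined on the quotient for
    every [T], whether or not its word is standard. *)
Definition eta_word T w : F^o :=
  if `[< init_word M w >] then 0 else ((w == tword T) * factT T)%N%:R.

Lemma eta_word_init T w : init_word M w -> eta_word T w = 0.
Proof. by move=> wI; rewrite /eta_word asboolT. Qed.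

Definition eta_fun T : Lprec M -> F^o := qext (M := M) (eta_word T).
HB.instance Definition _ T := GRing.isLinear.Build F (Lprec M) F^o *:%R (eta_fun T)
  (qext_is_linear (eta_word_init T)).

Definition eta T : dual F (Lprec M) := eta_fun T.

Lemma eta_cls T w : eta T (cls M w) = eta_word T w.
Proof. exact: (qext_cls (eta_word_init T)). Qed.

Lemma eta_clsE T w : ~ init_word M w -> eta T (cls M w) = ((w == tword T) * factT T)%N%:R.
Proof. by move=> wI; rewrite eta_cls /eta_word asboolF. Qed.

Lemma eta_std s w : la = wt_of s ->
  eta (exp_of s) (cls M w) = ((w == tword (exp_of s)) * factT (exp_of s))%N%:R.
Proof.
move=> laE; rewrite eta_cls /eta_word; case: asboolP => // wI.
by case: eqP => // wE; case: (stdP (M := M) laE); rewrite -wE.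
Qed.

Lemma factT_F_neq0 T : (factT T)%:R != 0 :> F.
Proof. by rewrite (pcharf0P _).1 // factT_neq0. Qed.

End OneIrrep.

Lemma tword_inj : injective (@tword n).
Proof. by move=> S T /(congr1 cnt); rewrite !cnt_tword. Qed.

(** The word of S + T splits into the words of S and T in as many ways as the product of the
    binomial coefficients of S + T over S, and each splitting contributes S! T!. This is the reason
    for the factor T! in the definition. *)
Lemma eta_mul (la mu : wt n) (M1 : hw_irrep F la) (M2 : hw_irrep F mu)
    (M : hw_irrep F (la + mu)) s t : la = wt_of s -> mu = wt_of t ->
  cartan_mul M (eta M1 (exp_of s)) (eta M2 (exp_of t)) = eta M (exp_of s + exp_of t).
Proof.
move=> laE muE; apply: Lprec_ext => w; rewrite (cartan_mulE F0 stdP).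
have -> : exp_of s + exp_of t = exp_of (s ++ t) by rewrite /exp_of big_cat.
have -> : eta M (exp_of (s ++ t)) (cls M w) =
    ((w == tword (exp_of (s ++ t))) * factT (exp_of (s ++ t)))%N%:R.
  by apply: eta_std; rewrite laE muE /wt_of big_cat.
case: ifP => sw; last first.
  by case: eqP => // wE; rewrite wE sorted_tword in sw.
rewrite (sorted_cntP _ sw) [exp_of (s ++ t)]big_cat -sum_splits_factT natr_sum big_seq [RHS]big_seq.
apply: eq_bigr => -[a b] /(splits_sorted sw) [sa sb]; rewrite /= -!/(exp_of _).
by rewrite (eta_std _ _ laE) (eta_std _ _ muE) -natrM (sorted_cntP _ sa) (sorted_cntP _ sb).
Qed.

Lemma wt_of_size s : \sum_k wt_of s k = size s.
Proof.
elim: s => [|x s IH]; first by rewrite /wt_of big_nil big1 // => k _; rewrite ffunE.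
rewrite /wt_of big_cons -/(wt_of s); transitivity (\sum_k (plwt x k + wt_of s k)%N).
  by apply: eq_bigr => k _; rewrite [LHS]ffunE.
rewrite big_split /= IH -[RHS]add1n; congr addn.
have /andP[_ /andP[x0 xn]] := valP x.
have kn : ((size (val x)).-1 < n.-1)%N by rewrite -ltnS !prednK // (leq_ltn_trans _ xn).
rewrite (bigD1 (Ordinal kn)) //= ffunE /= prednK // eqxx big1 // => k.
rewrite ffunE -val_eqE /= => kx; apply/eqP; rewrite eqb0; apply: contraNneq kx => <-.
by [].
Qed.

(** The coefficients of a weight add up to the number of columns, so there is just one column, and
    the row lengths give its height. *)
Lemma wt_of_plwt s (x : pluck n) : wt_of s = plwt x ->
  exists2 y, s = [:: y] & size (val y) = size (val x).
Proof.
move=> sx; have xE : plwt x = wt_of [:: x] by rewrite /wt_of big_seq1.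
have := wt_of_size s; rewrite sx xE wt_of_size.
case: s sx => [|y []] // sx _; exists y => //.
have := congr1 (rows^~ (size (val y)).-1) sx; rewrite /wt_of big_seq1 !rows_plwt.
have /andP[_ /andP[y0 yn]] := valP y; have /andP[_ /andP[x0 xn]] := valP x.
have := congr1 (rows^~ (size (val x)).-1) sx; rewrite /wt_of big_seq1 !rows_plwt.
rewrite -[in X in X = nat_of_bool _](ltn_predK y0) -[in X in _ = nat_of_bool X](ltn_predK x0).
move: y0 x0; case: (size (val y)) => // a; case: (size (val x)) => // b _ _ /=.
by rewrite !ltnS !leqnn; case: (leqP a b) => // ab; case: (leqP b a) => // ba _ _; congr S; apply/eqP; rewrite eqn_leq ab.
Qed.

Lemma in_col_le (x : pluck n) (p : 'I_n * 'I_n) : in_col x p -> (p.1 <= p.2)%N.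
Proof.
case: p => l j; rewrite /in_col /=.
have H r a k : incr a r -> onth r k == Some j -> (a + k <= j)%N.
  elim: r a k => [|i r IH] a k; first by rewrite onth0n.
  case/incr_cons => ai ir _; case: k => [/eqP[<-]|k]; first by rewrite addn0.
  by rewrite addnS -addSn; exact: IH.
apply: (H (val x) 0%N).
by rewrite /incr; have /andP[-> _] := valP x; rewrite andbT; apply/allP.
Qed.

(** The exponent does not record diagonal entries; with the height known, a row without a letter
    must hold its diagonal entry. *)
Lemma pluckT_inj (x y : pluck n) : size (val x) = size (val y) ->
  pluckT x = pluckT y -> x = y.
Proof.
move=> xy Txy.
have sub l : (l < size (val x))%N -> onth (val x) l = onth (val y) l.
  move=> lx; have ly : (l < size (val y))%N by rewrite -xy.
  have /andP[_ /andP[_ xn]] := valP x; pose k : 'I_n := Ordinal (ltn_trans lx xn).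
  have [i xi] : exists i, onth (val x) l = Some i 
    by move: (lx); rewrite -onthTE; case: (onth _ _) => // i _; exists i.
  have [j yj] : exists j, onth (val y) l = Some j.
    by move: (ly); rewrite -onthTE; case: (onth _ _) => // i' _; exists i'.
  have ki : (k <= i)%N by apply: (@in_col_le x (k, i)); rewrite /in_col xi.
  have kj : (k <= j)%N by apply: (@in_col_le y (k, j)); rewrite /in_col yj.
  move: ki; rewrite leq_eqVlt => /orP[/eqP ki|ki].
    move: kj; rewrite leq_eqVlt => /orP[/eqP kj|kj].
      by rewrite xi yj; congr Some; apply: ord_inj; exact: etrans (esym ki) kj.
    have /ffunP/(_ (mkroot kj)) := Txy; rewrite !ffunE /in_col /= xi yj eqxx.
    by case: eqP => // -[->].
  have /ffunP/(_ (mkroot ki)) := Txy; rewrite !ffunE /in_col /= xi yj eqxx.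
  by case: eqP => // -[->].
apply: val_inj; apply: eq_from_onth => l.
by have [/sub //|xl] := ltnP l (size (val x)); rewrite !onth_default // -xy.
Qed.

(** So on fundamental weights the functionals [eta] are the dual basis itself, without rescaling. *)
Lemma factT_pluckT (x : pluck n) : factT (pluckT x) = 1%N.
Proof. by rewrite /factT big1 // => p _; rewrite ffunE; case: (in_col _ _). Qed.

End Eta.
(** * The dual algebra *)

Section Palgebra.
Context {F : fieldType} {n : nat} (L : forall la : wt n, hw_irrep F la).
Hypothesis F0 : [pchar F] =i pred0.
Hypothesis stdP : forall (nu : wt n) (M : hw_irrep F nu) (s : seq (pluck n)),
  nu = wt_of s -> ~ init_word M (tword (exp_of s)).
Implicit Types (la mu : wt n) (T : {ffun posroot n -> nat}) (s t : seq (pluck n)).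
Implicit Types (u v b : Pprec L).
Local Notation dualL la := (dual F (Lprec (L la))).

Lemma Pin_in la (f : dualL la) : Pin f la = f.
Proof. by rewrite /Pin /dsin /= dfwith_in. Qed.

Lemma Pin_out la mu (f : dualL la) : la != mu -> Pin f mu = 0.
Proof. by move=> lm; rewrite /Pin /dsin /= dfwith_out. Qed.

Lemma Pprec_compP c u v la : (c *: u + v) la = c *: u la + v la.
Proof. by []. Qed.

Lemma Pprec_comp_sum (I : Type) (r : seq I) (f : I -> Pprec L) la :
  (\sum_(i <- r) f i) la = \sum_(i <- r) f i la.
Proof. by apply: (big_morph (fun u : Pprec L => u la)). Qed.

Lemma PinP c la (f g : dualL la) : Pin (c *: f + g) = c *: Pin f + Pin g.
Proof.
apply: dirsumP => mu; rewrite Pprec_compP.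
have [<-|lm] := eqVneq la mu; first by rewrite !Pin_in.
by rewrite !Pin_out // scaler0 addr0.
Qed.

Definition Psupp b : {fset wt n} := fset_set [set la | b la <> 0].

Lemma PsuppP b la : la \notin Psupp b -> b la = 0.
Proof.
have /asboolP bf := dscomp_subproof b.
rewrite in_fset_set // notin_setE /= => /contrapT; exact.
Qed.

Lemma Pprec_decomp b : b = \sum_(la <- Psupp b) Pin (b la).
Proof.
apply: dirsumP => mu; rewrite Pprec_comp_sum.
have [bmu|/PsuppP bmu] := boolP (mu \in Psupp b).
  rewrite (big_rem _ bmu) Pin_in big1_seq => [|la /andP[_ lb]]; first by rewrite [RHS]addr0.
  by rewrite Pin_out //; apply: contraTneq lb => ->; rewrite mem_rem_uniq ?fset_uniq // inE eqxx.
rewrite bmu big1 // => la _; have [->|lm] := eqVneq la mu; first by rewrite Pin_in.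
by rewrite Pin_out.
Qed.

Section CartanMulLinear.
Context {la mu : wt n} (M1 : hw_irrep F la) (M2 : hw_irrep F mu) (M : hw_irrep F (la + mu)).

Lemma cartan_mulPl c (f f' : dual F (Lprec M1)) (g : dual F (Lprec M2)) :
  cartan_mul M (c *: f + f') g = c *: cartan_mul M f g + cartan_mul M f' g.
Proof.
apply: Lprec_ext => w; rewrite -[RHS]/(c * cartan_mul M f g (cls M w) + cartan_mul M f' g (cls M w)).
rewrite (cartan_mulE F0 stdP M f g w) (cartan_mulE F0 stdP M f' g w)
  (cartan_mulE F0 stdP M (c *: f + f') g w); case: ifP => _; last by rewrite mulr0 addr0.
by rewrite mulr_sumr -big_split; apply: eq_bigr => ab _; rewrite mulrDl mulrA.
Qed.

Lemma cartan_mulPr c (f : dual F (Lprec M1)) (g g' : dual F (Lprec M2)) :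
  cartan_mul M f (c *: g + g') = c *: cartan_mul M f g + cartan_mul M f g'.
Proof.
apply: Lprec_ext => w; rewrite -[RHS]/(c * cartan_mul M f g (cls M w) + cartan_mul M f g' (cls M w)).
rewrite (cartan_mulE F0 stdP M f g w) (cartan_mulE F0 stdP M f g' w)
  (cartan_mulE F0 stdP M f (c *: g + g') w); case: ifP => _; last by rewrite mulr0 addr0.
by rewrite mulr_sumr -big_split; apply: eq_bigr => ab _; rewrite mulrDr mulrCA.
Qed.

Lemma cartan_mul0l (g : dual F (Lprec M2)) : cartan_mul M (0 : dual F (Lprec M1)) g = 0.
Proof. by have := cartan_mulPl (-1) 0 0 g; rewrite scaler0 addr0 scaleN1r addNr. Qed.

Lemma cartan_mul0r (f : dual F (Lprec M1)) : cartan_mul M f (0 : dual F (Lprec M2)) = 0.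
Proof. by have := cartan_mulPr (-1) f 0 0; rewrite scaler0 addr0 scaleN1r addNr. Qed.

End CartanMulLinear.

Lemma PmulE (A B : {fset wt n}) u v :
  (forall la, la \notin A -> u la = 0) -> (forall mu, mu \notin B -> v mu = 0) ->
  Pmul u v = \sum_(x <- (A `*` B)%fset) Pin (cartan_mul (L (x.1 + x.2)) (u x.1) (v x.2)).
Proof.
move=> uA vB; rewrite /Pmul; apply: fsbigTE => -[la mu].
have Pin0 nu : Pin (0 : dualL nu) = 0 by have := PinP (-1) (0 : dualL nu) 0; rewrite scaler0 addr0 scaleN1r addNr.
rewrite in_fsetM negb_and /= => /orP[/uA ->|/vB ->].
  by rewrite cartan_mul0l Pin0.
by rewrite cartan_mul0r Pin0.
Qed.

Lemma PmulPl c u u' v : Pmul (c *: u + u') v = c *: Pmul u v + Pmul u' v.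
Proof.
pose A := (Psupp u `|` Psupp u')%fset.
have uA la : la \notin A -> u la = 0 by rewrite in_fsetU negb_or => /andP[/PsuppP].
have uA' la : la \notin A -> u' la = 0 by rewrite in_fsetU negb_or => /andP[_ /PsuppP].
have cA la : la \notin A -> (c *: u + u') la = 0.
  by move=> lA; rewrite Pprec_compP uA // uA' // scaler0 addr0.
have vB := @PsuppP v.
rewrite (PmulE cA vB) (PmulE uA vB) (PmulE uA' vB) scaler_sumr -big_split.
by apply: eq_bigr => x _; rewrite Pprec_compP cartan_mulPl PinP.
Qed.

Lemma PmulPr c u v v' : Pmul u (c *: v + v') = c *: Pmul u v + Pmul u v'.
Proof.
pose B := (Psupp v `|` Psupp v')%fset.
have vB la : la \notin B -> v la = 0 by rewrite in_fsetU negb_or => /andP[/PsuppP].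
have vB' la : la \notin B -> v' la = 0 by rewrite in_fsetU negb_or => /andP[_ /PsuppP].
have cB la : la \notin B -> (c *: v + v') la = 0.
  by move=> lB; rewrite Pprec_compP vB // vB' // scaler0 addr0.
have uA := @PsuppP u.
rewrite (PmulE uA cB) (PmulE uA vB) (PmulE uA vB') scaler_sumr -big_split.
by apply: eq_bigr => x _; rewrite Pprec_compP cartan_mulPr PinP.
Qed.

Lemma Pmul_Pin la mu (f : dualL la) (g : dualL mu) :
  Pmul (Pin f) (Pin g) = Pin (cartan_mul (L (la + mu)) f g).
Proof.
rewrite (@PmulE [fset la]%fset [fset mu]%fset); first last.
- by move=> nu; rewrite in_fset1 eq_sym => /Pin_out.
- by move=> nu; rewrite in_fset1 eq_sym => /Pin_out.
have -> : ([fset la] `*` [fset mu] = [fset (la, mu)])%fset.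
  by apply/fsetP => -[x y]; rewrite in_fsetM !in_fset1 xpair_eqE.
by rewrite big_seq_fset1 -[LHS]/(Pin (cartan_mul (L (la + mu)) (Pin f la) (Pin g mu))) !Pin_in.
Qed.

Definition Peta la T : Pprec L := Pin (eta (L la) T).

Lemma Peta_mul s t :
  Pmul (Peta (wt_of s) (exp_of s)) (Peta (wt_of t) (exp_of t)) =
  Peta (wt_of s + wt_of t) (exp_of s + exp_of t).
Proof. by rewrite Pmul_Pin eta_mul. Qed.

(** Evaluation at the word of [s] in the component [wt_of s] isolates one element; it reads off
    coefficients in the computation of the kernel. *)
Lemma Peta_comp la T s :
  Peta la T (wt_of s) (cls (L (wt_of s)) (tword (exp_of s))) =
  ((la == wt_of s) && (T == exp_of s))%:R * (factT T)%:R.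
Proof.
rewrite /Peta; have [->|ls] := eqVneq la (wt_of s); last first.
  by rewrite Pin_out // mul0r.
rewrite Pin_in eta_clsE; last exact: stdP.
by rewrite natrM eq_sym (inj_eq (@tword_inj n)).
Qed.

(** The weight 0 is a sum of no columns only, so its one standard word is empty and a functional is
    determined by its value at the generator. *)
Lemma Pone_eta : Pone L = Peta 0 0.
Proof.
rewrite /Pone /Peta; congr Pin.
have wt0 : 0 = wt_of ([::] : seq (pluck n)) by rewrite /wt_of big_nil.
have ex0 : 0 = exp_of ([::] : seq (pluck n)) by rewrite /exp_of big_nil.
have e1 : eta (L 0) 0 (vprec (L 0)) = 1.
  rewrite vprecE ex0 (eta_std stdP) // -ex0 tword0 eqxx mul1n /factT.
  by rewrite big1 // => p _; rewrite ffunE.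
apply: xget_unique; first exact: e1.
move=> f /= f1; apply: Lprec_ext => w.
case: (pselect (init_word (L 0) w)) => [wI|/(std_word F0)[s [s0 wE]]].
  by rewrite cls_init // !linear0.
have : s = [::].
  apply: size0nil; rewrite -(wt_of_size s) -s0 big1 // => k _.
  by rewrite ffunE.
by move=> s_nil; rewrite wE s_nil -ex0 tword0 -vprecE f1 e1.
Qed.

(** A standard word for a fundamental weight is the word of a single column of that height, so the
    values required of the dual basis determine a functional. *)
Lemma evec_dualE (x : pluck n) : evec_dual L x = eta (L (plwt x)) (pluckT x).
Proof.
have xe : pluckT x = exp_of [:: x] by rewrite /exp_of big_seq1.
have xw : plwt x = wt_of [:: x] by rewrite /wt_of big_seq1.
have e1 (y : pluck n) : size (val y) = size (val x) ->
    eta (L (plwt x)) (pluckT x) (evec (L (plwt x)) y) = (y == x)%:R.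
  move=> yx; rewrite /evec chivE xe (eta_std stdP) // -xe factT_pluckT muln1.
  rewrite (inj_eq (@tword_inj n)); congr (nat_of_bool _)%:R.
  by apply/eqP/eqP => [/(pluckT_inj yx)|->].
apply: xget_unique; first exact: e1.
move=> f /= f1; apply: Lprec_ext => w.
case: (pselect (init_word (L (plwt x)) w)) => [wI|/(std_word F0)[s [sE wE]]].
  by rewrite cls_init // !linear0.
have [y sy yx] := wt_of_plwt (esym sE).
have -> : cls (L (plwt x)) w = evec (L (plwt x)) y.
  by rewrite /evec chivE wE sy /exp_of big_seq1.
by rewrite f1 // e1.
Qed.

Lemma exp_of_bound s p : (exp_of s p <= size s)%N.
Proof.
elim: s => [|x s IH]; first by rewrite /exp_of big_nil ffunE.
by rewrite /exp_of big_cons addT_E -[size _]add1n leq_add // ffunE leq_b1.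
Qed.

(** An exponent is at most the number of columns, which [la] determines; this leaves finitely many
    candidates. *)
Lemma std_exponents la : exists2 r : seq {ffun posroot n -> nat}, uniq r &
  forall T, (T \in r) <-> exists s, la = wt_of s /\ T = exp_of s.
Proof.
pose D := (\sum_k la k)%N; pose P T := `[< exists s, la = wt_of s /\ T = exp_of s >].
pose h (g : {ffun posroot n -> 'I_D.+1}) : {ffun posroot n -> nat} := [ffun p => g p : nat].
exists [seq T <- map h (enum {: {ffun posroot n -> 'I_D.+1}}) | P T].
  rewrite filter_uniq // map_inj_uniq ?enum_uniq // => g g' /ffunP gg.
  by apply/ffunP => p; have := gg p; rewrite !ffunE; exact: ord_inj.
move=> T; rewrite mem_filter; split=> [/andP[/asboolP] //|TP].
rewrite /P (asboolT TP) /=; have [s [laE TE]] := TP.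
apply/mapP; exists [ffun p => inord (T p)]; first by rewrite mem_enum.
apply/ffunP => p; rewrite !ffunE inordK // ltnS TE /D laE wt_of_size.
exact: exp_of_bound.
Qed.

Lemma dual_decomp la (f : dualL la) : exists2 r : seq {ffun posroot n -> nat},
  (forall T, T \in r -> exists s, la = wt_of s /\ T = exp_of s) &
  f = \sum_(T <- r) (f (cls (L la) (tword T)) / (factT T)%:R) *: eta (L la) T.
Proof.
have [r r_uniq rP] := std_exponents la; exists r; first by move=> T /rP.
apply: Lprec_ext => w.
have sumE (g : {ffun posroot n -> nat} -> dualL la) (r' : seq {ffun posroot n -> nat}) (u : Lprec (L la)) :
    (\sum_(T <- r') g T) u = \sum_(T <- r') g T u.
  by apply: (big_morph (fun f : dualL la => f u)).
rewrite sumE; case: (pselect (init_word (L la) w)) => [wI|].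
  by rewrite cls_init // linear0 big1 // => T _; rewrite linear0.
move=> wI; have [s [laE wE]] := std_word F0 wI.
have rT : exp_of s \in r by apply/rP; exists s.
rewrite (big_rem _ rT) /= big1_seq ?addr0 => [|T /andP[_]].
  rewrite -[RHS]/(_ * eta (L la) (exp_of s) (cls (L la) w)) (eta_clsE _ wI) -wE eqxx mul1n.
  by rewrite divfK // factT_F_neq0.
rewrite mem_rem_uniq // inE => /andP[Ts _].
rewrite -[LHS]/(_ * eta (L la) T (cls (L la) w)) (eta_clsE _ wI) wE (inj_eq (@tword_inj n)).
by rewrite eq_sym (negPf Ts) mulr0.
Qed.

End Palgebra.
(** * Monomials in the Pluecker variables *)

Section Multisets.
Context {I : choiceType}.
Implicit Types (m : {cmonom I}).

Definition mseq m : seq I := flatten [seq nseq (m x) x | x <- finsupp m].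

Lemma big_mseq (R : Type) (idx : R) (op : Monoid.com_law idx) (h : I -> R) m :
  \big[op/idx]_(x <- mseq m) h x = \big[op/idx]_(x <- finsupp m) iterop (m x) op (h x) idx.
Proof.
rewrite /mseq big_flatten big_map; apply: eq_bigr => x _.
by rewrite big_nseq Monoid.iteropE.
Qed.

Lemma big_mseqM (V : nmodType) (h : I -> V) m1 m2 :
  \sum_(x <- mseq (mmul m1 m2)) h x = \sum_(x <- mseq m1) h x + \sum_(x <- mseq m2) h x.
Proof.
have mE m (d : {fset I}) : (finsupp m `<=` d)%fset ->
    \sum_(x <- mseq m) h x = \sum_(x <- d) h x *+ m x.
  move=> md; rewrite big_mseq (big_fset_incl _ md) //= => x _.
  by rewrite -cmE_eq0 => /eqP ->.
rewrite (mE (mmul m1 m2) (finsupp m1 `|` finsupp m2)%fset) ?mdomD //.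
rewrite (mE m1 _ (fsubsetUl _ (finsupp m2))) (mE m2 _ (fsubsetUr (finsupp m1) _)).
by rewrite -big_split; apply: eq_bigr => x _; rewrite cmM mulrnDr.
Qed.

Lemma mseq1 : mseq mone = [::].
Proof. by rewrite /mseq mdom1 (size0nil (cardfs0 I)). Qed.

Lemma mseqU x : mseq (ucm x) = [:: x].
Proof. by rewrite /mseq mdomU -fset_seq1 /= cmUU. Qed.

Definition mon_of (s : seq I) : {cmonom I} := \big[mmul/mone]_(x <- s) ucm x.

Lemma big_mon_of (V : nmodType) (h : I -> V) s :
  \sum_(x <- mseq (mon_of s)) h x = \sum_(x <- s) h x.
Proof.
elim: s => [|y s IH]; first by rewrite /mon_of !big_nil mseq1 big_nil.
by rewrite /mon_of !big_cons big_mseqM mseqU big_seq1 IH.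
Qed.

End Multisets.

Section Columns.
Context {n : nat}.
Implicit Types (s t : seq (pluck n)) (p : 'I_n * 'I_n) (q : zidx n) (x : pluck n).

Definition col_count s p : nat := \sum_(x <- s) in_col x p.

Lemma exp_of_count s (p : posroot n) : exp_of s p = col_count s (val p).
Proof.
elim: s => [|x s IH]; first by rewrite /exp_of /col_count !big_nil ffunE.
by rewrite /exp_of /col_count !big_cons addT_E -/(exp_of s) IH ffunE.
Qed.

Lemma rows_count s (l : 'I_n) : rows (wt_of s) l = \sum_j col_count s (l, j).
Proof.
rewrite exchange_big /=; elim: s => [|x s IH]; first by rewrite /wt_of !big_nil rows0.
rewrite /wt_of !big_cons rowsD -/(wt_of s) IH rows_plwt; congr addn.
rewrite -onthTE /in_col /=; case: (onth _ _) => [i|] /=; last by rewrite big1.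
by rewrite (bigD1 i) //= eqxx big1 // => j ji; rewrite (inj_eq Some_inj) eq_sym (negPf ji).
Qed.

Lemma rows_inj (la mu : wt n) : (forall l : 'I_n, rows la l = rows mu l) -> la = mu.
Proof.
move=> lm; have E (l : nat) : rows la l = rows mu l.
  have [ln|nl] := ltnP l n; first exact: (lm (Ordinal ln)).
  by rewrite !rows_big // (leq_trans (leq_pred n)).
by apply/ffunP => k; have := E k; rewrite !rows_succ E => /addIn.
Qed.

Lemma col_count_lower s p : (p.2 < p.1)%N -> col_count s p = 0%N.
Proof.
by move=> p21; rewrite /col_count big1 // => x _; apply/eqP; rewrite eqb0;
  apply/negP => /in_col_le; rewrite leqNgt p21.
Qed.

Lemma col_countP s t : (forall q, col_count s (val q) = col_count t (val q)) <->
  wt_of s = wt_of t /\ exp_of s = exp_of t.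
Proof.
split=> [st|[wst est]].
  have {}st p : col_count s p = col_count t p.
    have [p12|p21] := leqP p.1 p.2; last by rewrite !col_count_lower.
    exact: (st (Sub p p12)).
  split; last by apply/ffunP => p; rewrite !exp_of_count.
  by apply: rows_inj => l; rewrite !rows_count; apply: eq_bigr => j _.
have upper l j : l != j -> col_count s (l, j) = col_count t (l, j).
  rewrite neq_ltn => /orP[lj|jl]; last by rewrite !col_count_lower.
  by rewrite -!(exp_of_count _ (mkroot lj)) est.
case=> -[l j] /= _; have [<-|/upper //] := eqVneq l j.
have := rows_count s l; rewrite wst rows_count (bigD1 l) //= [RHS](bigD1 l) //=.
rewrite [in RHS](eq_bigr (fun j => col_count t (l, j))) => [/addIn //|k].
by rewrite eq_sym => /upper.
Qed.

Definition zcolm x : {cmonom zidx n} := \big[mmul/mone]_(q | in_col x (val q)) ucm q.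
(** The exponent vector of the z-monomial to which the toric map sends the monomial [m]. *)
Definition zkey (m : {cmonom pluck n}) : {cmonom zidx n} :=
  \big[mmul/mone]_(x <- mseq m) zcolm x.

Lemma big_mmul (I : Type) (r : seq I) (P : pred I) (h : I -> {cmonom zidx n}) q :
  (\big[mmul/mone]_(i <- r | P i) h i) q = (\sum_(i <- r | P i) h i q)%N.
Proof. by apply: (big_morph (fun m : {cmonom zidx n} => m q)) => [m m'|]; rewrite ?cmM ?cm1. Qed.

Lemma zkeyE m q : zkey m q = col_count (mseq m) (val q).
Proof.
rewrite /zkey big_mmul; apply: eq_bigr => x _; rewrite /zcolm big_mmul.
rewrite (eq_bigr (fun i : zidx n => (i == q) : nat)) => [|i _]; last exact: cmU.
have [xq|xq] := boolP (in_col x (val q)).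
  by rewrite (bigD1 q) //= eqxx big1 // => i /andP[_ /negPf ->].
by rewrite big1 // => i xi; apply/eqP; rewrite eqb0; apply: contraNneq xq => <-.
Qed.

Lemma zkeyP m m' : zkey m = zkey m' <->
  wt_of (mseq m) = wt_of (mseq m') /\ exp_of (mseq m) = exp_of (mseq m').
Proof.
rewrite -col_countP; split=> [mm q|mm]; first by rewrite -!zkeyE mm.
by apply/eqP/cmP => q; rewrite !zkeyE.
Qed.

Context {F : fieldType}.

Lemma malgUM (K : conomType) (k k' : K) : << mmul k k' >> = << k >> * << k' >> :> {malg F[K]}.
Proof. by rewrite malgM_def fgmulUU mulr1. Qed.

Lemma malg_big_mmul (K : conomType) (I : Type) (r : seq I) (P : pred I) (h : I -> K) :
  << \big[mmul/mone]_(i <- r | P i) h i >> = \prod_(i <- r | P i) << h i >> :> {malg F[K]}.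
Proof.
by apply: (big_morph (fun k : K => << k >> : {malg F[K]})) => // k k'; exact: malgUM.
Qed.

Lemma zmonomE m : zmonom m = << zkey m >> :> zring F n.
Proof.
rewrite /zkey malg_big_mmul [RHS]big_mseq; apply: eq_bigr => x _.
have -> : zcol x = << zcolm x >> :> zring F n by rewrite /zcolm malg_big_mmul.
exact: erefl.
Qed.

Lemma toric_mapE (x : plring F n) : toric_map x = \sum_(m <- msupp x) x@_m *: << zkey m >>.
Proof.
rewrite /toric_map mmapE; apply: eq_bigr => m _.
by rewrite mul_malgC zmonomE.
Qed.

End Columns.

(** * The homomorphism from the Pluecker ring and its kernel *)

Section CartanAlgebraMap.
Context {F : fieldType} {n : nat} (L : forall la : wt n, hw_irrep F la).
Hypothesis F0 : [pchar F] =i pred0.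
Hypothesis stdP : forall (nu : wt n) (M : hw_irrep F nu) (s : seq (pluck n)),
  nu = wt_of s -> ~ init_word M (tword (exp_of s)).
Implicit Types (m : {cmonom pluck n}) (x y : plring F n) (s : seq (pluck n)).

Lemma malg_ind (K : choiceType) (P : {malg F[K]} -> Prop) : P 0 ->
  (forall a k z, P z -> P (a *: << k >> + z)) -> forall z, P z.
Proof. by move=> P0 Pc z; rewrite [z]malg_basisE; elim/big_rec: _ => // k w _; exact: Pc. Qed.

Definition pl_mon m : Pprec L := Peta L (wt_of (mseq m)) (exp_of (mseq m)).

Definition pl_fun : plring F n -> Pprec L := mlin pl_mon.
HB.instance Definition _ := GRing.Linear.on pl_fun.
Definition pl_map : {linear plring F n -> Pprec L} := pl_fun.

Lemma pl_mapU m : pl_map << m >> = pl_mon m.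
Proof. exact: mlinU. Qed.

Lemma pl_monM m m' : pl_mon (mmul m m') = Pmul (pl_mon m) (pl_mon m').
Proof. by rewrite (Peta_mul L F0 stdP) /pl_mon /wt_of /exp_of !big_mseqM. Qed.

Lemma Pmul0l (u : Pprec L) : Pmul 0 u = 0.
Proof. by have := PmulPl F0 stdP (-1) 0 0 u; rewrite scaler0 addr0 scaleN1r addNr. Qed.

Lemma Pmul0r (u : Pprec L) : Pmul u 0 = 0.
Proof. by have := PmulPr F0 stdP (-1) u 0 0; rewrite scaler0 addr0 scaleN1r addNr. Qed.

Lemma pl_mapM x y : pl_map (x * y) = Pmul (pl_map x) (pl_map y).
Proof.
move: x; apply: malg_ind => [|a m x IH]; first by rewrite mul0r linear0 Pmul0l.
rewrite mulrDl -scalerAl (linearP pl_map) [pl_map (a *: _ + x)](linearP pl_map).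
apply: etrans (esym (PmulPl F0 stdP a (pl_map << m >>) (pl_map x) (pl_map y))).
apply: (congr2 (fun u v : Pprec L => a *: u + v) _ IH).
move: y {IH}; apply: malg_ind => [|b k y IH]; first by rewrite mulr0 linear0 Pmul0r.
rewrite mulrDr -scalerAr (linearP pl_map) [pl_map (b *: _ + y)](linearP pl_map).
apply: etrans (esym (PmulPr F0 stdP b (pl_map << m >>) (pl_map << k >>) (pl_map y))).
apply: (congr2 (fun u v : Pprec L => b *: u + v) _ IH).
have UE z : pl_map << z >> = pl_mon z := pl_mapU z.
apply: etrans (congr1 pl_map (esym (malgUM m k))) _; apply: etrans (UE _) _.
by apply: etrans (pl_monM _ _) _; apply: (congr2 (@Pmul _ _ L)); rewrite UE.
Qed.

Lemma pl_map1 : pl_map 1 = Pone L.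
Proof.
rewrite (Pone_eta L F0 stdP); transitivity (pl_mon mone); first exact: pl_mapU.
by rewrite /pl_mon mseq1 /wt_of /exp_of !big_nil.
Qed.

Lemma pl_mapX (s : pluck n) : pl_map (plX s) = Pin (evec_dual L s).
Proof.
rewrite (evec_dualE L F0 stdP); transitivity (pl_mon (ucm s)); first exact: pl_mapU.
by rewrite /pl_mon mseqU /wt_of /exp_of !big_seq1.
Qed.

Lemma pl_map_surj (b : Pprec L) : exists x, pl_map x = b.
Proof.
have im0 : exists x, pl_map x = 0 by exists 0; rewrite linear0.
have imP c (u v : Pprec L) : (exists x, pl_map x = u) -> (exists x, pl_map x = v) ->
    exists x, pl_map x = c *: u + v.
  by move=> [x <-] [y <-]; exists (c *: x + y); rewrite (linearP pl_map).
have imr la (c : {ffun posroot n -> nat} -> F) r :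
    (forall T, T \in r -> exists s, la = wt_of s /\ T = exp_of s) ->
    exists x, pl_map x = Pin (\sum_(T <- r) c T *: eta (L la) T).
  elim: r => [|T r IH] rP.
    rewrite big_nil; have -> : Pin (0 : dual F (Lprec (L la))) = 0.
      by have := PinP (-1) (0 : dual F (Lprec (L la))) 0; rewrite scaler0 addr0 scaleN1r addNr.
    exact: im0.
  rewrite big_cons PinP; apply: imP; last first.
    by apply: IH => T' T'r; apply: rP; rewrite inE T'r orbT.
  have [|s [laE ->]] := rP T; first by rewrite mem_head.
  exists << mon_of s >>; rewrite pl_mapU /pl_mon /wt_of /exp_of !big_mon_of.
  by rewrite -/(wt_of s) -/(exp_of s) -laE.
rewrite [b]Pprec_decomp; elim/big_rec: _ => [//|la u _ imu].
rewrite -[Pin _]scale1r; apply: imP imu.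
have [r rP ->] := dual_decomp F0 (b la); apply: imr rP.
Qed.

Lemma pl_mapE x : pl_map x = \sum_(m <- msupp x) x@_m *: pl_mon m.
Proof. by []. Qed.

Lemma pl_mon_comp m m0 :
  pl_mon m (wt_of (mseq m0)) (cls (L _) (tword (exp_of (mseq m0)))) =
  (zkey m == zkey m0)%:R * (factT (exp_of (mseq m0)))%:R.
Proof.
rewrite (Peta_comp L stdP); have -> : (zkey m == zkey m0) =
    (wt_of (mseq m) == wt_of (mseq m0)) && (exp_of (mseq m) == exp_of (mseq m0)).
  by apply/eqP/andP => [/zkeyP[-> ->]|[/eqP ? /eqP ?]]; [rewrite !eqxx|apply/zkeyP].
by case: andP => [[_ /eqP ->] //|_]; rewrite !mul0r.
Qed.

Lemma toric_coeff x k : (toric_map x)@_k = \sum_(m <- msupp x) x@_m * (zkey m == k)%:R.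
Proof.
rewrite toric_mapE.
transitivity (\sum_(m <- msupp x) (x@_m *: << zkey m >> : zring F n)@_k).
  by apply: (big_morph (fun z : zring F n => z@_k)) => [y z|]; rewrite ?mcoeffD ?mcoeff0.
by apply: eq_bigr => m _; rewrite [LHS]mcoeffZ mcoeffU.
Qed.

(** Both maps send a monomial to an element that depends on [zkey m] alone, and distinct keys give
    linearly independent elements on either side. So both kernels are cut out by the vanishing of
    the coefficient sums over monomials with equal key. *)
Lemma pl_map_ker x : pl_map x = 0 <-> toric_ideal x.
Proof.
split=> [x0|x0].
  apply/malgP => k; rewrite mcoeff0 toric_coeff.
  have [[m0 <-]|nk] := pselect (exists m, zkey m = k); last first.
    rewrite big1 // => m _; case: eqP => [mk|_]; last by rewrite mulr0.
    by case: nk; exists m.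
  (* The coefficient sum for the key of [m0], times a nonzero factorial, is the value of [pl_map x]
     at the word of [m0]. *)
  apply: (mulIf (factT_F_neq0 F0 (exp_of (mseq m0)))); rewrite mul0r mulr_suml.
  have := congr1 (fun b : Pprec L =>
    b (wt_of (mseq m0)) (cls (L _) (tword (exp_of (mseq m0))))) x0.
  rewrite pl_mapE Pprec_comp_sum.
  rewrite (big_morph (fun f : dual F (Lprec (L (wt_of (mseq m0)))) =>
     f (cls (L _) (tword (exp_of (mseq m0))))) (id1 := 0) (op1 := +%R)) // => E0.
  apply: etrans E0.
  apply: eq_bigr => m _; rewrite -mulrA -pl_mon_comp; exact: erefl.
(* A choice of one monomial for each key makes [pl_map] factor through the toric map; [mone] is the
   value at keys that no monomial has. *)
pose mk (k : {cmonom zidx n}) : {cmonom pluck n} := xget mone [set m | zkey m = k].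
have mkK m : zkey (mk (zkey m)) = zkey m.
  by have := @xgetPex _ mone [set m' | zkey m' = zkey m] (ex_intro _ m erefl).
pose g : {linear zring F n -> Pprec L} := mlin (fun k => pl_mon (mk k)).
have := congr1 g (x0 : toric_map x = 0).
rewrite linear0 toric_mapE linear_sum => <-; rewrite pl_mapE.
apply: eq_bigr => m _; apply: etrans (esym (linearZZ g _ _)); congr (_ *: _).
rewrite [RHS]mlinU.
by rewrite /pl_mon; have [-> ->] := (zkeyP _ _).1 (mkK m).
Qed.

End CartanAlgebraMap.

Theorem theorem8p10 (R : realType) (n : nat) (n_ge2 : (2 <= n)%N)
    (L : forall la : wt n, hw_irrep R[i] la) :
  exists phi : {linear plring R[i] n -> Pprec L},
    [/\ (forall x y, phi (x * y) = Pmul (phi x) (phi y)) /\ phi 1 = Pone L,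
        forall b : Pprec L, exists x, phi x = b,
        forall x, phi x = 0 <-> toric_ideal x
      & forall s : pluck n, phi (plX s) = Pin (evec_dual L s)].
Proof.
(* The field is now algebraically closed with a conjugation, so the lower bound can be supplied to
   the sections that assumed it. *)
have F0 := pchar_num R[i]; have stdP := @wt_of_std R[i] n.
exists (pl_map L); split; first split.
- exact: pl_mapM F0 stdP.
- exact: pl_map1 F0 stdP.
- exact: pl_map_surj F0.
- exact: pl_map_ker F0 stdP.
- exact: pl_mapX F0 stdP.
Qed.
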